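(* Let $(Z_n)_{n\geq 1}$ be a sequence of random variables belonging to the second Wiener chaos of $X$. 1. Assume that $E(Z_n^2)\rightarrow 1$ and $E(Z_n^4)\rightarrow 3$ as $n\rightarrow\infty$. Then $Z_n$ converges in law to $Z\sim\mathscr{N}(0,1)$ as $n\rightarrow\infty$. Moreover, for every $n$, $$ d_{\rm TV}(Z_n,Z)\leq 2\sqrt{\frac16\big|E(Z_n^4)-3\big|+\frac{3+E(Z_n^2)}{2}\,\big|E(Z_n^2)-1\big|}. $$ 2. Fix $\nu>0$ and assume that $E(Z_n^2)\rightarrow 2\nu$ and $E(Z_n^4)-12E(Z_n^3)\rightarrow 12\nu^2-48\nu$ as $n\rightarrow\infty$. Then, as $n\rightarrow\infty$, $Z_n$ converges in law to $F(\nu)$, where $F(\nu)$ has a centered Gamma distribution of parameter $\nu$. Moreover, for every $n$, $$ d_{\mathscr{H}_2}(Z_n,F(\nu)) \leq \max\{1,1/\nu, 2/\nu^2\}\, \sqrt{\frac16\big|E(Z_n^4)-12E(Z_n^3)-12\nu^2+48\nu\big|+\frac{\big|8-6\nu+E(Z_n^2)\big|}{2}\,\big|E(Z_n^2)-2\nu\big|}. $$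
   Context: $X=\{X(h):h\in\mathfrak H\}$ is an isonormal Gaussian process over a real separable Hilbert space $\mathfrak H$, i.e. a centered Gaussian family with $E[X(h)X(g)]=\langle h,g\rangle_{\mathfrak H}$. The second Wiener chaos of $X$ is the set of random variables $I_2(f)$, $f\in\mathfrak H^{\odot 2}$ (symmetric tensor product), where $I_2$ is the double Wiener-Itô integral: the linear isometry from $\mathfrak H^{\odot 2}$, equipped with the norm $\sqrt{2}\,\|\cdot\|_{\mathfrak H^{\otimes 2}}$, into $L^2(\Omega)$, such that $I_2(h\otimes h)=X(h)^2-1$ when $\|h\|_{\mathfrak H}=1$. Total variation distance: $d_{\rm TV}(U,V)=\sup_B|P(U\in B)-P(V\in B)|$, the supremum being over Borel sets $B\subset\mathbb R$. Centered Gamma law: for $\nu>0$, $F(\nu)\stackrel{\rm Law}{=}2G(\nu/2)-\nu$, where $G(\nu/2)$ has density $g(x)=\frac{x^{\nu/2-1}e^{-x}}{\Gamma(\nu/2)}\mathbf 1_{(0,\infty)}(x)$. For a class $\mathscr H$ of functions, $d_{\mathscr H}(U,V)=\sup\{|E(h(U))-E(h(V))|: h\in\mathscr H\}$. Let $\mathscr C_b^2$ be the class of twice differentiable functions on $\mathbb R$ with bounded derivatives, and $\mathscr{H}_2=\{h\in\mathscr{C}^2_b:\|h\|_\infty\leq1,\ \|h'\|_\infty\leq 1,\ \|h''\|_\infty\leq 1\}$. *)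

(* Defs.v *)
From HB Require Import structures.
From mathcomp Require Import all_boot all_order all_algebra.
From mathcomp Require Import all_classical all_reals all_analysis.
Import Order.TTheory GRing.Theory Num.Theory.
Import numFieldNormedType.Exports.

Set Implicit Arguments.
Unset Strict Implicit.
Unset Printing Implicit Defensive.

Local Open Scope classical_set_scope.
Local Open Scope ring_scope.

(* Completeness is part of [completeNormedModType]. *)
Definition hilbert_dot (R : realType) (V : completeNormedModType R)
    (dot : {dot V for @idfun R}) : Prop :=
  forall x : V, dot x x = `|x| ^+ 2.

Definition separable (V : topologicalType) : Prop :=
  exists A : set V, countable A /\ dense A.

(* [(T, tens)] is the Hilbert tensor square of [H], which these two conditions
   determine up to a unique isometric isomorphism. No scalars are needed in the
   finite sums since they can be absorbed in [h]. *)
Definition hilbert_tensor_square (R : realType) (H T : completeNormedModType R)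
    (dotH : {dot H for @idfun R}) (dotT : {dot T for @idfun R})
    (tens : {bilinear H -> H -> T}) : Prop :=
  (forall a b c d : H, dotT (tens a b) (tens c d) = dotH a c * dotH b d) /\
  dense [set f : T | exists (n : nat) (h k : 'I_n -> H),
                       f = \sum_(i < n) tens (h i) (k i)].

Definition symmetric_tensors (R : realType) (H T : completeNormedModType R)
    (tens : {bilinear H -> H -> T}) : set T :=
  closure [set f : T | exists (n : nat) (h k : 'I_n -> H),
             f = \sum_(i < n) (tens (h i) (k i) + tens (k i) (h i))].

(* Only measurable sets are tested: a [probability] is a function on all sets
   whose values outside the sigma-algebra are meaningless. *)
Definition has_law (R : realType) (d : measure_display) (W : measurableType d)
    (P : probability W R) (U : W -> R) (m : set R -> \bar R) : Prop :=
  forall B : set R, measurable B -> P (U @^-1` B) = m B.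

(* [normal_prob 0 0] is not the Dirac mass at 0 but a junk value. *)
Definition centered_gaussian (R : realType) (s : R) : set R -> \bar R :=
  if s == 0 then \d_(0 : R) else normal_prob 0 s.

Definition isonormal (R : realType) (d : measure_display) (W : measurableType d)
    (P : probability W R) (H : completeNormedModType R)
    (dotH : {dot H for @idfun R}) (X : H -> {RV P >-> R}) : Prop :=
  (forall (n : nat) (c : 'I_n -> R) (h : 'I_n -> H), exists s : R,
     has_law P (fun w => \sum_(i < n) c i * X (h i) w) (centered_gaussian s)) /\
  (forall h g : H, ('E_P[fun w => (X h w * X g w)%R] = (dotH h g)%:E)%E).

(* [I2] takes values in L^2, so that identities between its values hold almost
   surely; its values outside [symmetric_tensors tens] are irrelevant. *)
Definition double_wiener_ito (R : realType) (d : measure_display)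
    (W : measurableType d) (P : probability W R) (H T : completeNormedModType R)
    (tens : {bilinear H -> H -> T}) (X : H -> {RV P >-> R})
    (I2 : T -> {RV P >-> R}) : Prop :=
  [/\ (forall (a : R) (f g : T),
         symmetric_tensors tens f -> symmetric_tensors tens g ->
         {ae P, forall w, I2 (a *: f + g) w = a * I2 f w + I2 g w}),
      (forall f : T, symmetric_tensors tens f ->
         ('N[P]_2[EFin \o I2 f] = (Num.sqrt 2 * `|f|)%:E)%E) &
      (forall h : H, `|h| = 1 ->
         {ae P, forall w, I2 (tens h h) w = X h w ^+ 2 - 1})].

Definition second_chaos (R : realType) (d : measure_display)
    (W : measurableType d) (P : probability W R) (H T : completeNormedModType R)
    (tens : {bilinear H -> H -> T}) (I2 : T -> {RV P >-> R})
    (Z : {RV P >-> R}) : Prop :=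
  exists2 f : T, symmetric_tensors tens f & {ae P, forall w, Z w = I2 f w}.

Definition moment (R : realType) (d : measure_display) (W : measurableType d)
    (P : probability W R) (k : nat) (Z : {RV P >-> R}) : R :=
  fine ('E_P[fun w => (Z w ^+ k)%R])%E.

Definition cvg_in_law (R : realType) (d d' : measure_display)
    (W : measurableType d) (W' : measurableType d')
    (P : probability W R) (Q : probability W' R)
    (Z : nat -> {RV P >-> R}) (V : {RV Q >-> R}) : Prop :=
  forall phi : R -> R, continuous phi ->
    (exists M : R, forall x : R, `|phi x| <= M) ->
    ('E_P[phi \o Z n] @[n --> \oo] --> 'E_Q[phi \o V])%E.

Definition dTV (R : realType) (d d' : measure_display)
    (W : measurableType d) (W' : measurableType d')
    (P : probability W R) (Q : probability W' R)
    (U : {RV P >-> R}) (V : {RV Q >-> R}) : \bar R :=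
  ereal_sup [set `|P (U @^-1` B) - Q (V @^-1` B)|%E | B in
              [set B : set R | measurable B]].

Definition dclass (R : realType) (d d' : measure_display)
    (W : measurableType d) (W' : measurableType d')
    (P : probability W R) (Q : probability W' R) (C : set (R -> R))
    (U : {RV P >-> R}) (V : {RV Q >-> R}) : \bar R :=
  ereal_sup [set `|'E_P[h \o U] - 'E_Q[h \o V]|%E | h in C].

Definition Cb2 (R : realType) : set (R -> R) :=
  [set h : R -> R |
    [/\ (forall x : R, derivable h x 1),
        (forall x : R, derivable h^`()%classic x 1),
        (exists M : R, forall x : R, `|h^`()%classic x| <= M) &
        (exists M : R, forall x : R, `|h^`(2)%classic x| <= M)]].

Definition H2 (R : realType) : set (R -> R) :=
  [set h : R -> R |
    [/\ Cb2 h,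
        (forall x : R, `|h x| <= 1),
        (forall x : R, `|h^`()%classic x| <= 1) &
        (forall x : R, `|h^`(2)%classic x| <= 1)]].
Arguments H2 R : clear implicits.

Definition Gamma (R : realType) (a : R) : R :=
  \int[lebesgue_measure]_(x in `]0, +oo[) (x `^ (a - 1) * expR (- x)).

Definition gamma_pdf (R : realType) (a x : R) : R :=
  if 0 < x then x `^ (a - 1) * expR (- x) / Gamma a else 0.

Definition gamma_law (R : realType) (a : R) (B : set R) : \bar R :=
  (\int[lebesgue_measure]_(x in B) (gamma_pdf a x)%:E)%E.

Definition centered_gamma (R : realType) (nu : R) : set R -> \bar R :=
  fun B => gamma_law (nu / 2) ((fun x => 2 * x - nu) @^-1` B).

(* Main.v *)
Require Import Defs.
From HB Require Import structures.
From mathcomp Require Import all_boot all_order all_algebra.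
From mathcomp Require Import all_classical all_reals all_analysis.
From mathcomp Require Import measurable_realfun.
From mathcomp Require Import ring lra.
From mathcomp Require complex.
Import Order.TTheory GRing.Theory Num.Theory.
Import numFieldNormedType.Exports.

(** Malliavin calculus is used only through its finite-dimensional shadow. A finite
    symmetric tensor is a quadratic form in a finite orthonormal family of the
    Hilbert space, which the spectral theorem for real symmetric matrices
    diagonalizes (diagonal_tensor). Along an orthonormal family the isonormal process
    is a standard normal vector (isonormal_cos), so that on finite tensors the double
    integral is almost surely a diagonal form
      Z = sum_i lam_i (xi_i^2 - 1)
    with independent standard normal xi_i. Independence is read off the joint cosine
    transform: it determines the joint law, so that one coordinate may be replaced by
    an independent copy (gaussian_pair_law).

    Gaussian integration by parts in each coordinate gives
      E[Z f(Z)] = E[Gam f'(Z)]   with   Gam = 2 sum_i lam_i^2 xi_i^2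
    (diag_stein). If f solves the Stein equation
      (a x + b) f'(x) - x f(x) = h(x) - c,
    where c is the mean of h under the target law, then
      E[h(Z)] - c = E[(a Z + b - Gam) f'(Z)]
    is at most sup |f'| times the L^2 norm of a Z + b - Gam. The square of that norm is
    an explicit function of E[Z^2], E[Z^3] and E[Z^4] (diag_stein_bound), since
    a Z + b - Gam is again diagonal up to a constant and the power sums of the lam_i are
    determined by these moments. The choice (a, b) = (0, 1) corresponds to the standard
    normal law and (a, b) = (2, 2 nu) to the centered gamma law of parameter nu.

    A general element of the second chaos is an L^2 limit of such diagonal forms. As
    E[Z^4] <= 60 |f|^4 whenever Z = I2 f (I2_fourth), it is even a limit in L^4, and
    both sides of the bound are continuous for this convergence (I2_stein_bound).

    There remain the Stein equations. For the normal law and h with values in [0, 1],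
    an estimate of Mills ratio type gives |f'| <= 2 (normal_stein_solution). For the
    gamma law and h with h, h', h'' bounded by 1, the solution is an explicit integral,
    and two maximum principles give |f'| <= max (1, 1 / nu) (gamma_stein_solution),
    at most the constant of the theorem.

    In the normal case the bound holds for all Lipschitz h with values in [0, 1] and
    does not involve their Lipschitz constants; indicators of Borel sets are L^1 limits
    of such functions for both laws at once, which gives the total variation distance
    (indicator_le_of_lipschitz). In both cases the bounds tend to 0 on smooth test
    functions, and with bounded second moments this implies convergence in law
    (cvg_smooth_bounded). *)

Set Implicit Arguments.
Unset Strict Implicit.
Unset Printing Implicit Defensive.

Local Open Scope classical_set_scope.
Local Open Scope ring_scope.

(** * Real-valued Lebesgue integrals *)

Section real_integrals.
Context d (T : measurableType d) (R : realType) (mu : {measure set T -> \bar R}).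
Implicit Types f g : T -> R.

Definition intble f := mu.-integrable setT (EFin \o f).

Lemma intble_meas f : intble f -> measurable_fun setT f.
Proof. by move=> /integrableP[/measurable_EFinP]. Qed.

Lemma intble_le f g : measurable_fun setT f -> (forall x, `|f x| <= g x) ->
  intble g -> intble f.
Proof.
move=> mf fg ig; apply: (le_integrable _ _ _ ig) => //.
  exact/measurable_EFinP.
by move=> x _ /=; rewrite lee_fin (le_trans (fg x))// ler_norm.
Qed.

Lemma eq_intble f g : f =1 g -> intble f -> intble g.
Proof. by move=> /funext ->. Qed.

Lemma intbleD f g : intble f -> intble g -> intble (fun x => f x + g x).
Proof. by move=> i1 i2; exact: (integrableD _ i1 i2). Qed.

Lemma intbleB f g : intble f -> intble g -> intble (fun x => f x - g x).
Proof. by move=> i1 i2; exact: (integrableB _ i1 i2). Qed.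

Lemma intbleZ r f : intble f -> intble (fun x => r * f x).
Proof. by move=> i1; exact: (integrableZl _ r i1). Qed.

Lemma intbleZr r f : intble f -> intble (fun x => f x * r).
Proof. by move=> /(intbleZ r); apply: eq_intble => x; rewrite mulrC. Qed.

Lemma intble_norm f : intble f -> intble (fun x => `|f x|).
Proof. exact: integrable_norm. Qed.

Lemma intble0 : intble (fun=> 0).
Proof. exact: integrable0. Qed.

Lemma intble_sum (I : Type) (s : seq I) (f : I -> T -> R) :
  (forall i, intble (f i)) -> intble (fun x => \sum_(i <- s) f i x).
Proof.
move=> fi; elim: s => [|i s IH].
  by apply: (eq_intble _ intble0) => x; rewrite big_nil.
by apply: (eq_intble _ (intbleD (fi i) IH)) => x; rewrite big_cons.
Qed.

Lemma eq_Rint f g : f =1 g -> \int[mu]_x f x = \int[mu]_x g x.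
Proof. by move=> /funext ->. Qed.

Lemma RintD f g : intble f -> intble g ->
  \int[mu]_x (f x + g x) = \int[mu]_x f x + \int[mu]_x g x.
Proof. exact: RintegralD. Qed.

Lemma RintB f g : intble f -> intble g ->
  \int[mu]_x (f x - g x) = \int[mu]_x f x - \int[mu]_x g x.
Proof. exact: RintegralB. Qed.

Lemma RintZ r f : intble f -> \int[mu]_x (r * f x) = r * \int[mu]_x f x.
Proof. exact: RintegralZl. Qed.

Lemma RintZr r f : intble f -> \int[mu]_x (f x * r) = \int[mu]_x f x * r.
Proof. exact: RintegralZr. Qed.

Lemma RintN f : intble f -> \int[mu]_x (- f x) = - \int[mu]_x f x.
Proof.
move=> fi; rewrite -mulN1r -RintZ//.
by apply: eq_Rint => x; rewrite mulN1r.
Qed.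

Lemma Rint0 : \int[mu]_x (0 : R) = 0.
Proof. by rewrite /Rintegral integral0. Qed.

Lemma Rint_sum (I : Type) (s : seq I) (f : I -> T -> R) :
  (forall i, intble (f i)) ->
  \int[mu]_x (\sum_(i <- s) f i x) = \sum_(i <- s) \int[mu]_x f i x.
Proof.
move=> fi; elim: s => [|i s IH].
  by rewrite big_nil -[RHS]Rint0; apply: eq_Rint => x; rewrite big_nil.
rewrite big_cons -IH -RintD//; last exact: intble_sum.
by apply: eq_Rint => x; rewrite big_cons.
Qed.

Lemma Rint_le f g : intble f -> intble g -> (forall x, f x <= g x) ->
  \int[mu]_x f x <= \int[mu]_x g x.
Proof. by move=> fi gi fg; apply: le_Rintegral. Qed.

Lemma Rint_ge0 f : (forall x, 0 <= f x) -> 0 <= \int[mu]_x f x.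
Proof. by move=> f0; apply: Rintegral_ge0. Qed.

Lemma Rint_abs f : intble f -> `|\int[mu]_x f x| <= \int[mu]_x `|f x|.
Proof. by move=> fi; apply: le_normr_Rintegral. Qed.

Lemma Rint_abs_le f g : intble g -> measurable_fun setT f ->
  (forall x, `|f x| <= g x) -> `|\int[mu]_x f x| <= \int[mu]_x g x.
Proof.
move=> gi mf fg; have fi := intble_le mf fg gi.
apply: (le_trans (Rint_abs fi)); apply: Rint_le => //; exact: intble_norm.
Qed.

Lemma intE f : intble f -> (\int[mu]_x (f x)%:E)%E = (\int[mu]_x f x)%:E.
Proof. by move=> fi; rewrite /Rintegral fineK//; exact: integrable_fin_num. Qed.

Lemma ge0_intble f : measurable_fun setT f -> (forall x, 0 <= f x) ->
  (\int[mu]_x (f x)%:E < +oo)%E -> intble f.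
Proof.
move=> mf f0 foo; apply/integrableP; split; first exact/measurable_EFinP.
rewrite (eq_integral (fun x => (f x)%:E))// => x _ /=.
by rewrite ger0_norm.
Qed.

Lemma ae_intble f g : measurable_fun setT g ->
  {ae mu, forall x, f x = g x} -> intble f -> intble g.
Proof.
move=> mg fg fi; have mf := intble_meas fi.
apply/integrableP; split; first exact/measurable_EFinP.
move/integrableP : fi => [_]; apply: le_lt_trans.
rewrite le_eqVlt; apply/orP; left; apply/eqP.
apply: ae_eq_integral => //.
- by apply: measurableT_comp => //; apply: measurableT_comp => //.
- by apply: measurableT_comp => //; apply: measurableT_comp => //.
by apply: filterS fg => x /= fgx _; rewrite fgx.
Qed.

Lemma ae_Rint f g : measurable_fun setT f -> measurable_fun setT g ->
  {ae mu, forall x, f x = g x} -> \int[mu]_x f x = \int[mu]_x g x.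
Proof.
move=> mf mg fg; rewrite /Rintegral; congr fine.
apply: ae_eq_integral => //; [exact/measurable_EFinP|exact/measurable_EFinP|].
by apply: filterS fg => x /= fgx _; rewrite fgx.
Qed.

Lemma Rint_dct (f_ : nat -> T -> R) f g :
  (forall n, measurable_fun setT (f_ n)) -> measurable_fun setT f ->
  (forall x, f_ n x @[n --> \oo] --> f x) ->
  intble g -> (forall n x, `|f_ n x| <= g x) ->
  \int[mu]_x f_ n x @[n --> \oo] --> \int[mu]_x f x.
Proof.
move=> mf_ mf ff gi fg.
have fi : intble f.
  apply: (intble_le mf _ gi) => x.
  by apply: (cvgr_to_le (cvg_norm (ff x))); apply: nearW => n; exact: fg.
have f_i n : intble (f_ n) by exact: (intble_le (mf_ n) (fg n) gi).
apply: fine_cvg; rewrite fineK; last exact: integrable_fin_num.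
have h1 : {ae mu, forall x, [set: T] x ->
    (f_ n x)%:E @[n --> \oo] --> (EFin \o f) x}.
  apply: aeW => x _; apply/fine_cvgP; split; first exact: nearW.
  exact: ff.
have h2 : {ae mu, forall x n, [set: T] x ->
    (`|(f_ n x)%:E| <= (EFin \o g) x)%E}.
  by apply: aeW => x n _; rewrite lee_fin fg.
have h3 n : measurable_fun setT (fun x => (f_ n x)%:E).
  by apply/measurable_EFinP; exact: mf_.
have h4 : measurable_fun setT (EFin \o f) by exact/measurable_EFinP.
by have [] := dominated_convergence measurableT h3 h4 h1 gi h2.
Qed.

Lemma indic_norm_le1 d' (U : measurableType d') (A : set U) (x : U) :
  `|\1_A x| <= 1 :> R.
Proof. by rewrite indicE; case: (_ \in _); rewrite ?normr1 ?normr0. Qed.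

Lemma Rint_set (A : set T) f :
  \int[mu]_(x in A) f x = \int[mu]_x (f x * \1_A x).
Proof.
rewrite Rintegral_mkcond; apply: eq_Rint => x.
by rewrite /restrict indicE; case: ifPn => _; rewrite ?mulr1 ?mulr0.
Qed.

End real_integrals.
Arguments intble {d T R} mu f.
Arguments indic_norm_le1 {R d' U} A x.

Section finite_real_integrals.
Context d (T : measurableType d) (R : realType) (P : probability T R).
Implicit Types f g : T -> R.

Lemma intble_cst (c : R) : intble P (fun=> c).
Proof. exact: finite_measure_integrable_cst. Qed.

Lemma Rint_cst (c : R) : \int[P]_x c = c.
Proof.
have h : fine (P [set: T]) = 1 by rewrite probability_setT.
exact: (etrans (Rintegral_cst P measurableT c)
  (etrans (congr1 (fun z => c * z) h) (mulr1 c))).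
Qed.

Lemma bounded_intble f (M : R) : measurable_fun setT f ->
  (forall x, `|f x| <= M) -> intble P f.
Proof. by move=> mf fM; apply: (intble_le mf fM); exact: intble_cst. Qed.

Lemma Rint_abs_bound f (M : R) : measurable_fun setT f ->
  (forall x, `|f x| <= M) -> `|\int[P]_x f x| <= M.
Proof.
by move=> mf fM; rewrite -(Rint_cst M); apply: Rint_abs_le => //; exact: intble_cst.
Qed.

(** Jensen for the square, from the positivity of a variance. *)
Lemma sqr_Rint_le f : intble P f -> intble P (fun x => f x ^+ 2) ->
  (\int[P]_x f x) ^+ 2 <= \int[P]_x (f x ^+ 2).
Proof.
move=> fi f2i; set a := \int[P]_x f x.
have : 0 <= \int[P]_x ((f x - a) ^+ 2) by apply: Rint_ge0 => x; exact: sqr_ge0.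
have -> : \int[P]_x ((f x - a) ^+ 2) =
    \int[P]_x (f x ^+ 2 - ((2 * a) * f x - a ^+ 2)).
  by apply: eq_Rint => x; ring.
have i1 : intble P (fun x => (2 * a) * f x) by exact: intbleZ.
have i2 := intble_cst (a ^+ 2).
rewrite RintB//; last exact: intbleB.
rewrite RintB// RintZ// Rint_cst -/a; lra.
Qed.

Lemma Rint_abs_le_sqrt f : measurable_fun setT f ->
  intble P (fun x => f x ^+ 2) ->
  \int[P]_x `|f x| <= Num.sqrt (\int[P]_x (f x ^+ 2)).
Proof.
move=> mf f2i.
have fi : intble P f.
  apply: (intble_le mf _ (intbleD (intble_cst 1) f2i)) => x.
  rewrite -(real_normK (num_real (f x))); set a := `|f x|.
  by have := sqr_ge0 (a - 1); rewrite sqrrB1; nra.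
rewrite -[leLHS]ger0_norm; last exact: Rint_ge0.
rewrite -sqrtr_sqr ler_sqrt; last by apply: Rint_ge0 => x; exact: sqr_ge0.
apply: (le_trans (sqr_Rint_le (intble_norm fi) _)).
  by apply: (eq_intble _ f2i) => x; rewrite real_normK// num_real.
rewrite le_eqVlt; apply/orP; left; apply/eqP; apply: eq_Rint => x.
by rewrite real_normK// num_real.
Qed.

End finite_real_integrals.

(** Transfer between measure spaces goes through the pushforward measures, which are
    only assumed to agree on measurable sets. *)
Section same_law.
Context d1 (T1 : measurableType d1) d2 (T2 : measurableType d2)
  d' (Y : measurableType d') (R : realType).
Variables (m1 : {measure set T1 -> \bar R}) (m2 : {measure set T2 -> \bar R}).
Variables (U1 : T1 -> Y) (U2 : T2 -> Y).
Hypotheses (mU1 : measurable_fun setT U1) (mU2 : measurable_fun setT U2).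
Hypothesis law12 : forall B, measurable B -> m1 (U1 @^-1` B) = m2 (U2 @^-1` B).

Lemma same_law_integral (f : Y -> \bar R) : measurable_fun [set: Y] f ->
  (forall y, 0 <= f y)%E -> (\int[m1]_x f (U1 x) = \int[m2]_x f (U2 x))%E.
Proof.
move=> mf f0.
transitivity (\int[pushforward m1 U1]_y f y)%E.
  by rewrite ge0_integral_pushforward// => y _; exact: f0.
transitivity (\int[pushforward m2 U2]_y f y)%E.
  by apply: eq_measure_integral => B mB _; exact: law12.
by rewrite ge0_integral_pushforward// => y _; exact: f0.
Qed.

Lemma same_law_intble (f : Y -> R) : measurable_fun [set: Y] f ->
  intble m1 (f \o U1) -> intble m2 (f \o U2).
Proof.
move=> mf /integrableP[_ h]; apply/integrableP; split.
  by apply/measurable_EFinP; apply: measurableT_comp.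
move: h; rewrite (@same_law_integral (fun y => `|(f y)%:E|%E))//.
by do 2 apply: measurableT_comp => //.
Qed.

Lemma same_law_Rint (f : Y -> R) : measurable_fun [set: Y] f ->
  \int[m1]_x f (U1 x) = \int[m2]_x f (U2 x).
Proof.
move=> mf; rewrite /Rintegral; congr fine.
rewrite integralE [RHS]integralE; congr (_ - _)%E.
- transitivity (\int[m1]_x (EFin \o f)^\+ (U1 x))%E.
    by apply: eq_integral => x _; rewrite !funeposE.
  rewrite same_law_integral//; first by apply: eq_integral => x _; rewrite !funeposE.
  by apply: measurable_funepos; apply/measurable_EFinP.
- transitivity (\int[m1]_x (EFin \o f)^\- (U1 x))%E.
    by apply: eq_integral => x _; rewrite !funenegE.
  rewrite same_law_integral//; first by apply: eq_integral => x _; rewrite !funenegE.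
  by apply: measurable_funeneg; apply/measurable_EFinP.
Qed.

End same_law.

Section density.
Context d (T : measurableType d) (R : realType).
Variables (mu nu : {measure set T -> \bar R}) (p : T -> R).
Hypothesis mp : measurable_fun setT p.
Hypothesis p0 : forall x, 0 <= p x.
Hypothesis nuE : forall B, measurable B -> nu B = (\int[mu]_(x in B) (p x)%:E)%E.
Import HBNNSimple.

Lemma density_nnsfun (f : {nnsfun T >-> R}) :
  (\int[nu]_x (f x)%:E = \int[mu]_x ((f x)%:E * (p x)%:E))%E.
Proof.
have mind r : measurable_fun setT (EFin \o \1_(f @^-1` [set r]) : T -> \bar R).
  exact/measurable_EFinP.
transitivity (\sum_(k \in range f)
    \int[nu]_x (k * \1_(f @^-1` [set k]) x)%:E)%E.
  under eq_integral do rewrite fimfunE -fsumEFin//.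
  rewrite ge0_integral_fsum//.
  - by move=> y; exact/measurable_EFinP/measurable_funM.
  - by move=> y x _; rewrite nnfun_muleindic_ge0.
transitivity (\sum_(k \in range f)
    \int[mu]_x ((k * \1_(f @^-1` [set k]) x)%:E * (p x)%:E))%E; last first.
  under [RHS]eq_integral => x _.
    rewrite fimfunE -EFinM.
    rewrite mulr_fsuml -fsumEFin//.
    under eq_fsbigr do rewrite EFinM.
    over.
  rewrite ge0_integral_fsum//.
  - move=> r; apply: emeasurable_funM; apply/measurable_EFinP => //.
    exact: measurable_funM.
  - move=> r x _; apply: mule_ge0; last by rewrite lee_fin.
    by rewrite nnfun_muleindic_ge0.
apply: eq_fsbigr => r; rewrite inE => -[t _ <-].
have f0 : 0 <= f t by [].
under eq_integral do rewrite EFinM.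
rewrite ge0_integralZl//.
rewrite integral_indic// setIT nuE//.
under [RHS]eq_integral do rewrite EFinM -muleA.
rewrite ge0_integralZl//; last first.
  by move=> x _; apply: mule_ge0; rewrite lee_fin.
  by apply: emeasurable_funM => //; apply/measurable_EFinP.
congr (_ * _)%E; rewrite integral_mkcond; apply: eq_integral => x _.
  by rewrite /restrict indicE; case: ifPn => _; rewrite ?mul1e ?mul0e.
exact: mind.
Qed.

(** Monotone approximation by simple functions, for which the formula is
    linearity and the definition of a density. *)
Lemma density_integral (f : T -> \bar R) : measurable_fun [set: T] f ->
  (forall x, 0 <= f x)%E -> (\int[nu]_x f x = \int[mu]_x (f x * (p x)%:E))%E.
Proof.
move=> mf f0; pose g := nnsfun_approx measurableT mf.
have gf x : (g n x)%:E @[n --> \oo] --> f x.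
  by apply: cvg_nnsfun_approx.
transitivity (limn (fun n => \int[nu]_x (g n x)%:E)%E).
  rewrite -monotone_convergence//.
  - by apply: eq_integral => y _; apply/esym/cvg_lim.
  - by move=> n; exact/measurable_EFinP.
  - by move=> n x _; rewrite lee_fin.
  - by move=> y _ m n mn; rewrite lee_fin; exact/lefP/nd_nnsfun_approx.
rewrite [X in limn X](_ : _ = (fun n => \int[mu]_x ((g n x)%:E * (p x)%:E))%E);
  last by apply/funext => n; rewrite density_nnsfun.
rewrite -monotone_convergence//.
- apply: eq_integral => y _; apply/cvg_lim => //.
  by apply: cvgeZr => //.
- move=> n; apply: emeasurable_funM; exact/measurable_EFinP.
- by move=> n x _; apply: mule_ge0; rewrite lee_fin.
- move=> y _ m n mn; apply: lee_wpmul2r; first by rewrite lee_fin.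
  by rewrite lee_fin; exact/lefP/nd_nnsfun_approx.
Qed.

Lemma density_intble (f : T -> R) : measurable_fun setT f ->
  intble nu f <-> intble mu (fun x => f x * p x).
Proof.
move=> mf; rewrite /intble; split => /integrableP[_ h]; apply/integrableP; split.
- by apply/measurable_EFinP; apply: measurable_funM.
- move: h; rewrite density_integral//; last by do 2 apply: measurableT_comp => //.
  apply: le_lt_trans; rewrite le_eqVlt; apply/orP; left; apply/eqP.
  by apply: eq_integral => x _ /=; rewrite normrM (ger0_norm (p0 x)) EFinM.
- exact/measurable_EFinP.
- rewrite density_integral//; last by do 2 apply: measurableT_comp => //.
  apply: le_lt_trans h; rewrite le_eqVlt; apply/orP; left; apply/eqP.
  by apply: eq_integral => x _ /=; rewrite normrM (ger0_norm (p0 x)) EFinM.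
Qed.

Lemma density_Rint (f : T -> R) : measurable_fun setT f ->
  \int[nu]_x f x = \int[mu]_x (f x * p x).
Proof.
move=> mf; rewrite /Rintegral; congr fine.
rewrite integralE [RHS]integralE; congr (_ - _)%E.
- rewrite density_integral//; last first.
    by apply: measurable_funepos; apply/measurable_EFinP.
  apply: eq_integral => x _; rewrite !funeposE -!EFin_max -EFinM.
  by rewrite maxr_pMl// mul0r.
- rewrite density_integral//; last first.
    by apply: measurable_funeneg; apply/measurable_EFinP.
  apply: eq_integral => x _; rewrite !funenegE -!EFinN -!EFin_max -EFinM.
  by rewrite maxr_pMl// mul0r mulNr.
Qed.

End density.

Section fubini_real.
Context d1 (T1 : measurableType d1) d2 (T2 : measurableType d2) (R : realType).
Variables (m1 : {sigma_finite_measure set T1 -> \bar R})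
          (m2 : {sigma_finite_measure set T2 -> \bar R}).

(** The integrability hypothesis is stated with a bound g on the inner integral,
    so that no measurability of that integral has to be proved beforehand. *)
Lemma prod_intble12 (f : T1 * T2 -> R) (g : T1 -> R) :
  measurable_fun setT f -> (forall x, intble m2 (fun y => f (x, y))) ->
  intble m1 g -> (forall x, `|\int[m2]_y `|f (x, y)| | <= g x) ->
  intble (m1 \x m2)%E f.
Proof.
move=> mf fx gi fg; apply/integrable12ltyP; first exact/measurable_EFinP.
apply: (@le_lt_trans _ _ (\int[m1]_x (g x)%:E)%E); last by rewrite intE ?ltry.
apply: ge0_le_integral => //.
- by move=> x _; apply: integral_ge0.
- apply: (measurable_fun_fubini_tonelli_F (fun z => (`|(f z)%:E|)%E)) => //.
  by do 2 apply: measurableT_comp => //.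
- by apply/measurable_EFinP; apply: intble_meas; exact: gi.
- move=> x _; rewrite (_ : (\int[m2]_y _)%E = (\int[m2]_y `|f (x, y)|)%:E).
    by rewrite lee_fin (le_trans (ler_norm _)).
  by rewrite -intE//; exact: intble_norm.
Qed.

Lemma prod_intble (f : T1 * T2 -> R) (g1 : T1 -> R) (g2 : T2 -> R) :
  measurable_fun setT f -> intble m1 g1 -> intble m2 g2 ->
  (forall x y, `|f (x, y)| <= g1 x * g2 y) ->
  intble (m1 \x m2)%E f.
Proof.
move=> mf i1 i2 fg.
have fx x : intble m2 (fun y => f (x, y)).
  apply: (intble_le _ (fg x)); last exact: intbleZ.
  exact: measurableT_comp mf (pair1_measurable x).
apply: (prod_intble12 (g := fun x => g1 x * \int[m2]_y g2 y)) => //.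
  exact: intbleZr.
move=> x; rewrite ger0_norm; last exact: Rint_ge0.
rewrite -RintZ//; apply: Rint_le; [exact: intble_norm|exact: intbleZ|exact: fg].
Qed.

Lemma intble_prod1 (f : T1 * T2 -> R) : intble (m1 \x m2)%E f ->
  (forall x, intble m2 (fun y => f (x, y))) ->
  intble m1 (fun x => \int[m2]_y f (x, y)).
Proof.
move=> fi fx; have := integrable_fubini_F fi.
by apply: eq_integrable => // x _; rewrite /fubini_F/= intE.
Qed.

Lemma Rint_prod12 (f : T1 * T2 -> R) : intble (m1 \x m2)%E f ->
  (forall x, intble m2 (fun y => f (x, y))) ->
  \int[(m1 \x m2)%E]_z f z = \int[m1]_x \int[m2]_y f (x, y).
Proof.
move=> fi fx; rewrite {1}/Rintegral -integral12_prod_meas1// {2}/Rintegral.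
by congr fine; apply: eq_integral => x _; rewrite /fubini_F intE.
Qed.

Lemma Rint_prod21 (f : T1 * T2 -> R) : intble (m1 \x m2)%E f ->
  (forall y, intble m1 (fun x => f (x, y))) ->
  \int[(m1 \x m2)%E]_z f z = \int[m2]_y \int[m1]_x f (x, y).
Proof.
move=> fi fx; rewrite {1}/Rintegral -integral21_prod_meas1// {2}/Rintegral.
by congr fine; apply: eq_integral => x _; rewrite /fubini_G intE.
Qed.

Lemma Rint_fubini (f : T1 * T2 -> R) : intble (m1 \x m2)%E f ->
  (forall x, intble m2 (fun y => f (x, y))) ->
  (forall y, intble m1 (fun x => f (x, y))) ->
  \int[m1]_x \int[m2]_y f (x, y) = \int[m2]_y \int[m1]_x f (x, y).
Proof. by move=> fi f1 f2; rewrite -Rint_prod12// Rint_prod21. Qed.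

End fubini_real.

(** * Calculus on the real line *)

Section derivative_rules.
Context (R : realType).
Implicit Types (f g : R -> R) (x a b c : R).

Lemma derC x c : is_derive x 1 (fun=> c) 0.
Proof. exact: is_derive_cst. Qed.

Lemma derid x : is_derive x 1 (fun y => y) 1.
Proof. exact: is_derive_id. Qed.

Lemma derD f g x a b : is_derive x 1 f a -> is_derive x 1 g b ->
  is_derive x 1 (fun y => f y + g y) (a + b).
Proof. by move=> fa gb; exact: is_deriveD. Qed.

Lemma derN f x a : is_derive x 1 f a -> is_derive x 1 (fun y => - f y) (- a).
Proof. by move=> fa; exact: is_deriveN. Qed.

Lemma derM f g x a b : is_derive x 1 f a -> is_derive x 1 g b ->
  is_derive x 1 (fun y => f y * g y) (f x * b + g x * a).
Proof. by move=> fa gb; exact: is_deriveM. Qed.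

Lemma derX f x a n : is_derive x 1 f a ->
  is_derive x 1 (fun y => f y ^+ n) (n%:R * f x ^+ n.-1 * a).
Proof.
move=> fa; have -> : (fun y => f y ^+ n) = f ^+ n.
  by apply/funext => y; elim: n => [|n IH]; rewrite ?expr0 // !exprS IH.
exact: is_deriveX.
Qed.

Lemma der_comp f g x a b : is_derive (g x) 1 f a -> is_derive x 1 g b ->
  is_derive x 1 (fun y => f (g y)) (a * b).
Proof. by move=> fa gb; exact: is_derive1_comp. Qed.

Lemma derV f x a : f x != 0 -> is_derive x 1 f a ->
  is_derive x 1 (fun y => (f y)^-1) (- f x ^- 2 * a).
Proof. by move=> f0 fa; exact: is_deriveV. Qed.

Lemma der_exp f x a : is_derive x 1 f a ->
  is_derive x 1 (fun y => expR (f y)) (expR (f x) * a).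
Proof. exact: der_comp. Qed.

Lemma der_cos f x a : is_derive x 1 f a ->
  is_derive x 1 (fun y => cos (f y)) (- sin (f x) * a).
Proof. exact: der_comp. Qed.

Lemma der_sin f x a : is_derive x 1 f a ->
  is_derive x 1 (fun y => sin (f y)) (cos (f x) * a).
Proof. exact: der_comp. Qed.

Lemma der_eq f x a b : is_derive x 1 f a -> a = b -> is_derive x 1 f b.
Proof. by move=> ? <-. Qed.

Lemma der_cvg f x a : is_derive x 1 f a -> f y @[y --> x] --> f x.
Proof.
move=> fa; apply: differentiable_continuous; apply/derivable1_diffP.
exact: (@ex_derive _ _ _ _ _ _ _ fa).
Qed.

Lemma der_derivable f x a : is_derive x 1 f a -> derivable f x 1.
Proof. by move=> fa; exact: (@ex_derive _ _ _ _ _ _ _ fa). Qed.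

Lemma der_derive1 f x a : is_derive x 1 f a -> f^`()%classic x = a.
Proof. by move=> fa; rewrite derive1E; exact: (@derive_val _ _ _ _ _ _ _ fa). Qed.

Lemma derivable_der f x : derivable f x 1 -> is_derive x 1 f (f^`()%classic x).
Proof. by move=> fd; rewrite derive1E; exact: DeriveDef. Qed.

End derivative_rules.

(** Computes a derivative up to unification of its value. *)
Ltac dertac := repeat first
  [ eassumption | apply: derC | apply: derid | eapply derD | eapply derN
  | eapply derM | eapply derX | eapply der_exp | eapply der_cos
  | eapply der_sin ].

Ltac contder := let x := fresh "x" in move=> x; eapply der_cvg; dertac.

Section calculus.
Context (R : realType).
Implicit Types (f g F : R -> R).
Notation lam := (@lebesgue_measure R).

Lemma cont_meas f : continuous f -> measurable_fun [set: R] f.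
Proof. exact: continuous_measurable_fun. Qed.

Lemma cont_within f (A : set R) : continuous f -> {within A, continuous f}.
Proof. by move=> cf; exact: continuous_subspaceT. Qed.

Lemma FTC_segment (f F : R -> R) (a b : R) : a < b -> continuous f ->
  (forall x : R, is_derive x 1 F (f x)) ->
  \int[lam]_(x in `[a, b]) f x = F b - F a.
Proof.
move=> ab cf dF; rewrite /Rintegral (@continuous_FTC2 _ f F a b)//.
- exact: cont_within.
- have cF x : F y @[y --> x] --> F x by exact: der_cvg.
  split.
  + by move=> x _; exact: der_derivable.
  + by apply: cvg_at_right_filter; exact: cF.
  + by apply: cvg_at_left_filter; exact: cF.
- by move=> x _; exact: der_derive1.
Qed.

(** The boundary term is only asked to converge along the integers, which is what
    dominated convergence over the segments [-n, n] delivers. *)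
Lemma FTC_line (f F : R -> R) (l : R) : continuous f ->
  (forall x : R, is_derive x 1 F (f x)) -> intble lam f ->
  F n%:R - F (- n%:R) @[n --> \oo] --> l ->
  \int[lam]_x f x = l.
Proof.
move=> cf dF fi FL.
pose f_ (n : nat) x := f x * \1_(`[- n%:R, n%:R]%classic) x.
have f_l : \int[lam]_x f_ n x @[n --> \oo] --> \int[lam]_x f x.
  apply: (@Rint_dct _ (measurableTypeR R) R lam _ _ (fun x => `|f x|)).
  - move=> n; apply: measurable_funM; first exact: cont_meas.
    exact: measurable_indic.
  - exact: cont_meas.
  - move=> x; apply: cvg_near_cst; near=> n.
    rewrite /f_ indicE mem_set ?mulr1//= in_itv/= -ler_norml.
    by near: n; exact: nbhs_infty_ger.
  - exact: intble_norm.
  - by move=> n x; rewrite /f_ normrM ler_piMr// indic_norm_le1.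
suff : \int[lam]_x f_ n x @[n --> \oo] --> l.
  by move=> fl; exact: (cvg_unique _ f_l fl).
apply: cvg_trans FL; apply: near_eq_cvg; near=> n.
have n0 : (0 < n)%N by near: n; exact: nbhs_infty_gt.
rewrite -(@FTC_segment f F)//; last by rewrite gtrN// ltr0n.
by rewrite Rint_set.
Unshelve. all: by end_near. Qed.

Lemma mvt_lip (f f' : R -> R) (M : R) : (forall x : R, is_derive x 1 f (f' x)) ->
  (forall x, `|f' x| <= M) -> forall x y, `|f x - f y| <= M * `|x - y|.
Proof.
move=> df fM x y; wlog xy : x y / y <= x.
  by move=> h; have [|/ltW] := leP y x; [|rewrite distrC (distrC x)]; exact: h.
have cf : {within `[y, x], continuous f}.
  by apply: cont_within => z; exact: der_cvg.
have [c _ ->] := MVT_segment xy (fun z _ => df z) cf.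
by rewrite normrM ler_wpM2r.
Qed.

Lemma der_nondecreasing (f f' : R -> R) (a b : R) :
  (forall x : R, a <= x <= b -> is_derive x 1 f (f' x)) ->
  (forall x : R, a <= x <= b -> 0 <= f' x) -> a <= b -> f a <= f b.
Proof.
move=> df f0 ab.
have cf : {within `[a, b], continuous f}.
  apply: derivable_within_continuous => x; rewrite in_itv/= => xab.
  exact/der_derivable/df.
have dfi x : x \in `]a, b[ -> is_derive x 1 f (f' x).
  by rewrite in_itv/= => /andP[/ltW ? /ltW ?]; apply: df; apply/andP.
have [c cab h] := MVT_segment ab dfi cf.
by rewrite -subr_ge0 h mulr_ge0 ?subr_ge0// f0//; move: cab; rewrite in_itv.
Qed.

Lemma der0_cst f (a b : R) :
  (forall x : R, a <= x <= b -> is_derive x 1 f 0) -> a <= b -> f a = f b.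
Proof.
move=> df ab; apply/eqP; rewrite eq_le -[X in _ && X]lerN2; apply/andP; split.
  exact: (@der_nondecreasing f (fun=> 0)).
apply: (@der_nondecreasing (fun x => - f x) (fun=> 0)) => // x xab.
by have dfx := df x xab; eapply der_eq; [eapply derN; exact: dfx|rewrite oppr0].
Qed.

Lemma lipschitz_cont f (L : R) : (forall x y, `|f x - f y| <= L * `|x - y|) ->
  continuous f.
Proof.
move=> fL x; apply/cvgrPdist_le => e e0.
have L0 : 0 <= L by have := le_trans (normr_ge0 _) (fL 1 0); rewrite subr0 normr1 mulr1.
have L1 : 0 < L + 1 by rewrite ltr_wpDl.
near=> y; apply: (le_trans (fL x y)).
apply: (@le_trans _ _ ((L + 1) * `|x - y|)); first by rewrite ler_wpM2r// lerDl.
rewrite mulrC -ler_pdivlMr//; near: y; apply: cvgr_dist_le => //.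
exact: divr_gt0.
Unshelve. all: by end_near. Qed.

Lemma lipschitz_affine f (L : R) : (forall x y, `|f x - f y| <= L * `|x - y|) ->
  forall x, `|f x| <= `|f 0| + `|L| * `|x|.
Proof.
move=> fL x; rewrite -[X in `|X|](subrK (f 0)) (le_trans (ler_normD _ _))//.
rewrite addrC lerD2l (le_trans (fL x 0))// subr0 ler_wpM2r//; exact: ler_norm.
Qed.

(** A class that is stable under sums and products, contains all polynomials and
    all bounded functions, and is integrable against every normal law: it takes
    care of all integrability conditions in the Gaussian computations. *)
Definition egrowth f := exists C c : R, forall x, `|f x| <= C * expR (c * `|x|).

Lemma egrowth_pos f : egrowth f ->
  exists C c : R, [/\ 0 <= C, 0 <= c & forall x, `|f x| <= C * expR (c * `|x|)].
Proof.
move=> [C [c h]]; exists `|C|, `|c|; split => // x.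
apply: (le_trans (h x)); apply: (@le_trans _ _ (`|C| * expR (c * `|x|))).
  by apply: ler_wpM2r; rewrite ?expR_ge0// ler_norm.
by apply: ler_wpM2l => //; rewrite ler_expR ler_wpM2r// ler_norm.
Qed.

Lemma egrowth_bounded f M : (forall x, `|f x| <= M) -> egrowth f.
Proof. by move=> fM; exists M, 0 => x; rewrite mul0r expR0 mulr1. Qed.

Lemma egrowth_cst c : egrowth (fun=> c).
Proof. exact: (@egrowth_bounded _ `|c|). Qed.

Lemma egrowth_id : egrowth (fun x => x).
Proof.
exists 1, 1 => x; rewrite !mul1r; apply: le_trans (expR_ge1Dx _).
by rewrite lerDr.
Qed.

Lemma egrowthD f g : egrowth f -> egrowth g -> egrowth (fun x => f x + g x).
Proof.
move=> /egrowth_pos[C1 [c1 [C10 c10 h1]]] /egrowth_pos[C2 [c2 [C20 c20 h2]]].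
exists (C1 + C2), (c1 + c2) => x.
have x0 : 0 <= `|x| by [].
apply: (le_trans (ler_normD _ _)); rewrite mulrDl; apply: lerD.
- apply: (le_trans (h1 x)); apply: ler_wpM2l => //; rewrite ler_expR; nra.
- apply: (le_trans (h2 x)); apply: ler_wpM2l => //; rewrite ler_expR; nra.
Qed.

Lemma egrowthM f g : egrowth f -> egrowth g -> egrowth (fun x => f x * g x).
Proof.
move=> /egrowth_pos[C1 [c1 [C10 c10 h1]]] /egrowth_pos[C2 [c2 [C20 c20 h2]]].
exists (C1 * C2), (c1 + c2) => x.
rewrite normrM mulrDl expRD mulrACA; exact: ler_pM.
Qed.

Lemma egrowthX f n : egrowth f -> egrowth (fun x => f x ^+ n).
Proof.
move=> gf; elim: n => [|n IH]; first exact: egrowth_cst.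
by rewrite (_ : (fun x => _) = (fun x => f x * f x ^+ n));
  [exact: egrowthM|apply/funext => x; rewrite exprS].
Qed.

Lemma egrowth_le f g : (forall x, `|f x| <= g x) -> egrowth g -> egrowth f.
Proof.
move=> fg [C [c h]]; exists C, c => x; apply: le_trans (h x).
exact: le_trans (fg x) (ler_norm _).
Qed.

Lemma egrowth_lip_comp f g (L : R) :
  (forall x y, `|f x - f y| <= L * `|x - y|) -> egrowth g -> egrowth (f \o g).
Proof.
move=> fL gg; apply: (@egrowth_le _ (fun x => `|f 0| + `|L| * `|g x|)).
  by move=> x; exact: (lipschitz_affine fL).
apply: egrowthD; first exact: egrowth_cst.
apply: egrowthM; first exact: egrowth_cst.
by have [C [c h]] := gg; exists C, c => x; rewrite normr_id; exact: h.
Qed.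

End calculus.

(** * Integrals against normal laws *)

Section normal_integrals.
Context (R : realType) (m s : R).
Hypothesis s0 : s != 0.
Notation lam := (@lebesgue_measure R).
Notation p := (normal_pdf m s).

Lemma normal_intble f : measurable_fun [set: R] f ->
  intble (normal_prob m s) f <-> intble lam (fun x => f x * p x).
Proof.
move=> mf; apply: density_intble => //; first exact: measurable_normal_pdf.
by move=> x; exact: normal_pdf_ge0.
Qed.

Lemma normal_Rint f : measurable_fun [set: R] f ->
  \int[normal_prob m s]_x f x = \int[lam]_x (f x * p x).
Proof.
move=> mf; apply: density_Rint => //; first exact: measurable_normal_pdf.
by move=> x; exact: normal_pdf_ge0.
Qed.

(** Completing the square: an exponential costs only a factor two in the
    standard deviation. *)
Lemma normal_pdf_expR c : exists2 C : R, 0 <= C & forall x,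
  expR (c * `|x|) * p x <= C * normal_pdf m (2 * s) x.
Proof.
have s20 : 2 * s != 0 by rewrite mulf_neq0// pnatr_eq0.
pose K := (`|c| ^+ 2 * s ^+ 2 + `|c| * `|m|).
exists (expR K * (normal_peak s / normal_peak (2 * s))).
  by rewrite mulr_ge0 ?expR_ge0// divr_ge0// normal_peak_ge0.
move=> x; rewrite !normal_pdfE// /normal_fun.
set pk := normal_peak s; set pk2 := normal_peak (2 * s).
have pk20 : pk2 != 0 by rewrite gt_eqF// normal_peak_gt0.
rewrite [X in X <= _](_ : _ = pk * (expR (c * `|x|) * expR (- (x - m) ^+ 2 / (s ^+ 2 *+ 2))));
  last by ring.
rewrite [X in _ <= X](_ : _ = pk * (expR K * expR (- (x - m) ^+ 2 / ((2 * s) ^+ 2 *+ 2))));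
  last by field.
rewrite ler_wpM2l ?normal_peak_ge0// -!expRD ler_expR /K.
have q0 : 0 < s ^+ 2 by rewrite exprn_even_gt0.
have sq : (x - m) ^+ 2 = `|x - m| ^+ 2 by rewrite real_normK// num_real.
have cx : c * `|x| <= `|c| * `|x - m| + `|c| * `|m|.
  rewrite -mulrDr; apply: (@le_trans _ _ (`|c| * `|x|)).
    by rewrite ler_wpM2r// ler_norm.
  by rewrite ler_wpM2l// -{1}(subrK m x) ler_normD.
have key : `|c| * `|x - m| <= `|x - m| ^+ 2 / (4 * s ^+ 2) + `|c| ^+ 2 * s ^+ 2.
  rewrite -subr_ge0 (_ : _ - _ =
    (`|x - m| - 2 * `|c| * s ^+ 2) ^+ 2 / (4 * s ^+ 2)); last by field.
  by rewrite divr_ge0 ?sqr_ge0// mulr_ge0// ltW.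
rewrite sq; set A := `|x - m| in cx key *; set B := `|c| in cx key *.
have -> : - A ^+ 2 / (s ^+ 2 *+ 2) = - (2 * (A ^+ 2 / (4 * s ^+ 2))) by field.
have -> : - A ^+ 2 / ((2 * s) ^+ 2 *+ 2) = - (2^-1 * (A ^+ 2 / (4 * s ^+ 2))).
  by field.
have : 0 <= A ^+ 2 / (4 * s ^+ 2).
  by rewrite divr_ge0 ?sqr_ge0// mulr_ge0// ltW.
move: cx key; set D := A ^+ 2 / _; set E := B ^+ 2 * _; lra.
Qed.

Lemma egrowth_intble f : measurable_fun [set: R] f -> egrowth f ->
  intble (normal_prob m s) f.
Proof.
move=> mf [C0 [c h]]; apply/normal_intble => //.
have [C C0' hC] := normal_pdf_expR c.
apply: (@intble_le _ (measurableTypeR R) R lam _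
  (fun x => `|C0| * (C * normal_pdf m (2 * s) x))).
- by apply: measurable_funM => //; exact: measurable_normal_pdf.
- move=> x; rewrite normrM (ger0_norm (normal_pdf_ge0 _ _ _)).
  apply: (@le_trans _ _ (`|C0| * (expR (c * `|x|) * p x))).
    rewrite mulrA ler_wpM2r ?normal_pdf_ge0// (le_trans (h x))//.
    by rewrite ler_wpM2r ?expR_ge0// ler_norm.
  by rewrite ler_wpM2l.
- by do 2 apply: intbleZ; exact: integrable_normal_pdf.
Qed.

Lemma normal_pdf_der (x : R) : is_derive x 1 p (- (x - m) / s ^+ 2 * p x).
Proof.
rewrite normal_pdfE// /normal_fun; eapply der_eq; [dertac|rewrite /=].
by field.
Qed.

(** Gaussian integration by parts: the density satisfies p' = -(x-m)/s^2 p. *)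
Lemma normal_ibp g g' : (forall x : R, is_derive x 1 g (g' x)) ->
  continuous g' -> egrowth g -> egrowth g' ->
  \int[normal_prob m s]_x ((x - m) * g x) =
  s ^+ 2 * \int[normal_prob m s]_x g' x.
Proof.
move=> dg cg' gg gg'.
have cg : continuous g by move=> x; exact: der_cvg.
have mg := cont_meas cg; have mg' := cont_meas cg'.
have mxm : measurable_fun [set: R] (fun x : R => x - m).
  by apply: cont_meas; contder.
have mg1 : measurable_fun [set: R] (fun x => (x - m) * g x).
  exact: measurable_funM.
have gxm : egrowth (fun x => x - m).
  by apply: egrowthD; [exact: egrowth_id|exact: egrowth_cst].
have i1 := egrowth_intble mg1 (egrowthM gxm gg).
have i2 := egrowth_intble mg' gg'.
apply/eqP; rewrite eq_sym -subr_eq0 -RintZ// -RintB//; last exact: intbleZ.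
have i3 := intbleB (intbleZ (s ^+ 2) i2) i1.
rewrite normal_Rint; last exact: (intble_meas i3).
move/normal_intble : i3 => /(_ (measurable_funB (measurable_funM
  (measurable_cst _) mg') mg1)) i3.
apply/eqP; apply: (@FTC_line _ _ (fun x => s ^+ 2 * (g x * p x)) _ _ _ i3).
- move=> x; apply: cvgM; last exact: continuous_normal_pdf.
  apply: cvgB; apply: cvgM; [exact: cvg_cst|exact: cg'| |exact: cg].
  by apply: cvgB; [exact: cvg_id|exact: cvg_cst].
- move=> x; apply: der_eq.
    eapply derM; first exact: derC.
    by eapply derM; [exact: dg|exact: normal_pdf_der].
  rewrite /=; by field.
have [C [c [C0 c0 h]]] := egrowth_pos gg.
have [D D0 hD] := normal_pdf_expR (c + 1).
pose K := s ^+ 2 * (C * (D * normal_peak (2 * s))).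
have s20 : 2 * s != 0 by rewrite mulf_neq0// pnatr_eq0.
have bd x : `|s ^+ 2 * (g x * p x)| <= K * expR (- `|x|).
  rewrite /K -mulrA normrM ger0_norm ?sqr_ge0// ler_wpM2l ?sqr_ge0//.
  rewrite normrM (ger0_norm (normal_pdf_ge0 _ _ _)).
  apply: (@le_trans _ _ (C * expR (c * `|x|) * p x)).
    by rewrite ler_wpM2r ?normal_pdf_ge0.
  rewrite -!mulrA ler_wpM2l// expRN mulrA ler_pdivlMr ?expR_gt0//.
  rewrite mulrAC -expRD -{2}(mul1r `|x|) -mulrDl (le_trans (hD x))//.
  by rewrite ler_wpM2l// normal_pdf_ub.
have lim0 : K * expR (- n%:R) + K * expR (- n%:R) @[n --> \oo] --> (0 : R).
  rewrite (_ : 0 = K * 0 + K * 0); last by rewrite mulr0 addr0.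
  have e0 : expR (- n%:R) @[n --> \oo] --> (0 : R) by exact: cvgn_expR.
  by apply: cvgD; apply: cvgMr.
apply/norm_cvg0P; apply: (squeeze_cvgr _ (cvg_cst 0) lim0).
apply: nearW => n; rewrite normr_ge0/= (le_trans (ler_normB _ _))//.
by apply: lerD; rewrite (le_trans (bd _))// ?normrN normr_nat.
Qed.

End normal_integrals.

(** * Moments and cosine transform of centered normal laws *)

Section centered_normal.
Context (R : realType).

Lemma normal_mean_sqr (m s : R) : s != 0 ->
  \int[normal_prob m s]_x ((x - m) ^+ 2) = s ^+ 2.
Proof.
move=> s0; have := @normal_ibp R m s s0 (fun x : R => x - m) (fun=> 1).
rewrite Rint_cst mulr1 => h; rewrite -[RHS]h.
- by apply: eq_Rint => x; rewrite expr2.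
- by move=> x; eapply der_eq; [dertac|rewrite addr0].
- by move=> x; exact: cvg_cst.
- by apply: egrowthD; [exact: egrowth_id|exact: egrowth_cst].
- exact: egrowth_cst.
Qed.

Lemma cos_egrowth (a b : R) : egrowth (fun x : R => cos (a * x + b)).
Proof. by apply: (@egrowth_bounded _ _ 1) => x; exact: cos_max. Qed.

Lemma sin_egrowth (a b : R) : egrowth (fun x : R => sin (a * x + b)).
Proof. by apply: (@egrowth_bounded _ _ 1) => x; exact: sin_max. Qed.

Let cosc (s : R) (c t : R) := \int[normal_prob 0 s]_x cos (t * x + c).

(** Differentiating under the integral brings out a factor x, which integration by
    parts turns back into the transform itself. *)
Lemma normal_cos_der (s c t : R) : s != 0 ->
  is_derive t 1 (cosc s c) (- s ^+ 2 * t * cosc s c t).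
Proof.
move=> s0.
pose f (t x : R) := cos (t * x + c).
have df (u x : R) : is_derive u 1 (f ^~ x) (- x * sin (u * x + c)).
  by rewrite /f; eapply der_eq; [dertac|rewrite /=; ring].
have If (u : R) : intble (normal_prob 0 s) (f u).
  apply: (@bounded_intble _ _ _ _ _ 1); last by move=> x; exact: cos_max.
  by apply: cont_meas; rewrite /f; contder.
have ubd (u x : R) : `|partial1of2 f u x| <= `|x|.
  rewrite /partial1of2 (der_derive1 (df u x)) mulNr normrN normrM.
  by rewrite ler_piMr// sin_max.
have Ix : intble (normal_prob 0 s) (fun x : R => `|x|).
  apply: intble_norm; apply: egrowth_intble => //; exact: egrowth_id.
have I : `]t - 1, t + 1[%classic t by rewrite /= in_itv/= ltrBlDr ltrDl ltr01.
have h1 := @differentiation_under_integral R _ _ (normal_prob 0 s) f setT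
  measurableT t (t - 1) (t + 1) I (fun u _ => If u)
  (fun u x _ _ => der_derivable (df u x)) (fun x : R => `|x|) (fun x : R => normr_ge0 x)
  Ix (fun u x _ _ => ubd u x).
have h2 := @derivable_under_integral R _ _ (normal_prob 0 s) f setT
  measurableT t (t - 1) (t + 1) I (fun u _ => If u)
  (fun u x _ _ => der_derivable (df u x)) (fun x : R => `|x|) (fun x : R => normr_ge0 x)
  Ix (fun u x _ _ => ubd u x).
have := derivable_der h2; rewrite h1.
have -> : \int[normal_prob 0 s]_y partial1of2 f t y =
    \int[normal_prob 0 s]_x (- ((x - 0) * sin (t * x + c))).
  by apply: eq_Rint => x; rewrite /partial1of2 (der_derive1 (df t x)) subr0 mulNr.
have ms : measurable_fun [set: R] (fun x : R => (x - 0) * sin (t * x + c)).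
  by apply: cont_meas; contder.
rewrite RintN; last first.
  apply: egrowth_intble => //; apply: egrowthM; last exact: sin_egrowth.
  by apply: egrowthD; [exact: egrowth_id|exact: egrowth_cst].
have E : \int[normal_prob 0 s]_x ((x - 0) * sin (t * x + c)) =
    s ^+ 2 * \int[normal_prob 0 s]_x (t * cos (t * x + c)).
  apply: (@normal_ibp R 0 s s0).
  - by move=> x; eapply der_eq; [dertac|rewrite /=; ring].
  - by contder.
  - exact: sin_egrowth.
  - by apply: egrowthM; [exact: egrowth_cst|exact: cos_egrowth].
rewrite E RintZ; last exact: If.
by move=> h; apply: der_eq h _; rewrite /cosc; ring.
Qed.

(** By the preceding differential equation, exp ((s t)^2 / 2) times the transform
    is constant in t. The phase c makes one formula cover both cosine and sine. *)
Lemma normal_cos (s c t : R) : s != 0 ->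
  \int[normal_prob 0 s]_x cos (t * x + c) = expR (- (s * t) ^+ 2 / 2) * cos c.
Proof.
move=> s0; pose h u := expR ((s * u) ^+ 2 / 2) * cosc s c u.
have dh (u : R) : is_derive u 1 h 0.
  rewrite /h; eapply der_eq.
    eapply derM; last exact: normal_cos_der.
    by dertac.
  by rewrite /=; field.
have : `|h t - h 0| <= 0 * `|t - 0|.
  by apply: mvt_lip (fun x : R => dh x) _ _ _ => x; rewrite normr0.
rewrite mul0r normr_le0 subr_eq0 => /eqP.
rewrite /h mulr0 expr0n/= mul0r expR0 mul1r => h0.
rewrite mulNr expRN -/(cosc s c t).
have e0 := expR_gt0 ((s * t) ^+ 2 / 2).
apply: (mulfI (lt0r_neq0 e0)); rewrite h0 mulrA divff ?mul1r ?lt0r_neq0//.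
rewrite /cosc (@eq_Rint _ _ _ _ _ (fun=> cos c)) ?Rint_cst// => x.
by rewrite mul0r add0r.
Qed.

Notation gam := (normal_prob (0 : R) 1).

Lemma gauss_intble f : measurable_fun [set: R] f -> egrowth f -> intble gam f.
Proof. by move=> mf gf; apply: egrowth_intble => //; exact: oner_neq0. Qed.

Lemma gauss_ibp (g g' : R -> R) : (forall x : R, is_derive x 1 g (g' x)) ->
  continuous g' -> egrowth g -> egrowth g' ->
  \int[gam]_x (x * g x) = \int[gam]_x g' x.
Proof.
move=> dg cg' gg gg'; have := normal_ibp 0 (oner_neq0 R) dg cg' gg gg'.
rewrite expr1n mul1r => <-.
by apply: eq_Rint => x; rewrite subr0.
Qed.

Lemma gauss_momentSS n :
  \int[gam]_x (x ^+ n.+2) = n.+1%:R * \int[gam]_x (x ^+ n).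
Proof.
have Xm k : measurable_fun [set: R] (fun x : R => x ^+ k).
  by apply: cont_meas; contder.
have Xg k : egrowth (fun x : R => x ^+ k) by apply: egrowthX; exact: egrowth_id.
rewrite -RintZ; last exact: gauss_intble.
rewrite -[RHS](@gauss_ibp (fun x : R => x ^+ n.+1)).
- by apply: eq_Rint => x; rewrite exprS.
- by move=> x; eapply der_eq; [dertac|rewrite /=; ring].
- by contder.
- exact: Xg.
- by apply: egrowthM; [exact: egrowth_cst|exact: Xg].
Qed.

Lemma gauss_intbleX n : intble gam (fun x : R => x ^+ n).
Proof.
apply: gauss_intble; first by apply: cont_meas; contder.
by apply: egrowthX; exact: egrowth_id.
Qed.

(** All even moments follow from E[x^(n+2)] = (n+1) E[x^n], which is integration
    by parts against x^(n+1). *)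
Lemma gauss_sqr_moments :
  [/\ \int[gam]_x (x ^+ 2 - 1) = 0,
      \int[gam]_x ((x ^+ 2 - 1) ^+ 2) = 2,
      \int[gam]_x ((x ^+ 2 - 1) ^+ 3) = 8 &
      \int[gam]_x ((x ^+ 2 - 1) ^+ 4) = 60].
Proof.
have M0 : \int[gam]_x (x ^+ 0) = 1.
  by rewrite (@eq_Rint _ _ _ _ _ (fun=> 1)) ?Rint_cst// => x; rewrite expr0.
have M2 : \int[gam]_x (x ^+ 2) = 1 by rewrite gauss_momentSS M0 mulr1.
have M4 : \int[gam]_x (x ^+ 4) = 3 by rewrite gauss_momentSS M2 mulr1.
have M6 : \int[gam]_x (x ^+ 6) = 15 by rewrite gauss_momentSS M4; ring.
have M8 : \int[gam]_x (x ^+ 8) = 105 by rewrite gauss_momentSS M6; ring.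
have i0 := intble_cst gam (1 : R).
have i2 := gauss_intbleX 2; have i4 := gauss_intbleX 4.
have i6 := gauss_intbleX 6; have i8 := gauss_intbleX 8.
split.
- by rewrite RintB// Rint_cst M2 subrr.
- transitivity (\int[gam]_x (x ^+ 4 - (2 * x ^+ 2 - 1))).
    by apply: eq_Rint => x; ring.
  have j2 := intbleZ 2 i2; have j3 := intbleB j2 i0.
  by rewrite RintB// RintB// RintZ// M4 M2 Rint_cst; ring.
- transitivity (\int[gam]_x ((x ^+ 6 - 3 * x ^+ 4) + (3 * x ^+ 2 - 1))).
    by apply: eq_Rint => x; ring.
  have j4 := intbleZ 3 i4; have j2 := intbleZ 3 i2.
  have j5 := intbleB i6 j4; have j6 := intbleB j2 i0.
  by rewrite RintD// RintB// RintB// !RintZ// M6 M4 M2 Rint_cst; ring.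
- transitivity (\int[gam]_x ((x ^+ 8 - 4 * x ^+ 6) +
      (6 * x ^+ 4 - (4 * x ^+ 2 - 1)))).
    by apply: eq_Rint => x; ring.
  have j6 := intbleZ 4 i6; have j4 := intbleZ 6 i4; have j2 := intbleZ 4 i2.
  have k1 := intbleB i8 j6; have k2 := intbleB j2 i0; have k3 := intbleB j4 k2.
  by rewrite RintD// RintB// RintB// RintB// !RintZ// M8 M6 M4 M2 Rint_cst; ring.
Qed.

(** Integration by parts for a function of the square: the identity behind the
    one-variable case of E[Z f(Z)] = E[Gam f'(Z)]. *)
Lemma gauss_stein_sqr (f f' : R -> R) (lam c M : R) :
  (forall x : R, is_derive x 1 f (f' x)) -> continuous f' ->
  (forall x, `|f' x| <= M) ->
  \int[gam]_x ((x ^+ 2 - 1) * f (lam * (x ^+ 2 - 1) + c)) =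
  \int[gam]_x (2 * lam * x ^+ 2 * f' (lam * (x ^+ 2 - 1) + c)).
Proof.
move=> df cf' f'M.
pose q x := lam * (x ^+ 2 - 1) + c.
have dq (x : R) : is_derive x 1 q (2 * lam * x).
  by rewrite /q; eapply der_eq; [dertac|rewrite /=; ring].
have cq : continuous q by move=> x; exact: der_cvg.
have gq : egrowth q.
  apply: egrowthD; last exact: egrowth_cst.
  apply: egrowthM; first exact: egrowth_cst.
  apply: egrowthD; last exact: egrowth_cst.
  by apply: egrowthX; exact: egrowth_id.
have dfq (x : R) : is_derive x 1 (f \o q) (f' (q x) * (2 * lam * x)).
  by apply: der_comp.
have cfq : continuous (f \o q) by move=> x; exact: der_cvg.
have cf'q : continuous (f' \o q).
  by move=> x; apply: continuous_comp; [exact: cq|exact: cf'].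
have gf'q : egrowth (f' \o q) by apply: (@egrowth_bounded _ _ M) => x /=.
have gfq : egrowth (f \o q) by exact: egrowth_lip_comp (mvt_lip df f'M) gq.
have c1 : continuous (fun x : R => x * (f' (q x) * (2 * lam * x))).
  move=> x; apply: cvgM; first exact: cvg_id.
  apply: cvgM; first exact: cf'q.
  by apply: cvgM; [exact: cvg_cst|exact: cvg_id].
have g1 : egrowth (fun x : R => x * (f' (q x) * (2 * lam * x))).
  apply: egrowthM; first exact: egrowth_id.
  apply: egrowthM; first exact: gf'q.
  by apply: egrowthM; [exact: egrowth_cst|exact: egrowth_id].
have c2 : continuous (fun x : R => x * (x * f (q x))).
  move=> x; apply: cvgM; first exact: cvg_id.
  by apply: cvgM; [exact: cvg_id|exact: cfq].
have g2 : egrowth (fun x : R => x * f (q x)).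
  by apply: egrowthM; [exact: egrowth_id|exact: gfq].
have i1 := gauss_intble (cont_meas c1) g1.
have i2 := gauss_intble (cont_meas cfq) gfq.
have i3 := gauss_intble (cont_meas c2) (egrowthM (@egrowth_id R) g2).
transitivity (\int[gam]_x (x * (x * f (q x)) - f (q x))).
  by apply: eq_Rint => x; rewrite -/(q x); ring.
have E : \int[gam]_x (x * (x * f (q x))) =
    \int[gam]_x (x * (f' (q x) * (2 * lam * x)) + f (q x)).
  apply: (@gauss_ibp (fun x : R => x * f (q x))).
  - move=> x; eapply der_eq.
      by eapply derM; [exact: derid|exact: dfq].
    by rewrite /= mulr1.
  - by move=> x; apply: cvgD; [exact: c1|exact: cfq].
  - exact: g2.
  - exact: egrowthD.
rewrite RintB// E RintD// addrK; apply: eq_Rint => x; rewrite -/(q x); ring.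
Qed.

End centered_normal.

(** * Uniqueness of cosine transforms and independence *)

Section weighted_pi_lambda.
Context (R : realType) d1 (W1 : measurableType d1) d2 (W2 : measurableType d2).
Variables (P1 : probability W1 R) (P2 : probability W2 R).
Variables (w1 : W1 -> R) (w2 : W2 -> R) (M : R).
Hypotheses (mw1 : measurable_fun setT w1) (mw2 : measurable_fun setT w2).
Hypotheses (w1M : forall x, `|w1 x| <= M) (w2M : forall x, `|w2 x| <= M).
Hypothesis w12 : \int[P1]_x w1 x = \int[P2]_x w2 x.

Lemma weight_indic_le d (W : measurableType d) (w : W -> R) (A : set W) :
  (forall x, `|w x| <= M) -> forall x, `|w x * \1_A x| <= M.
Proof.
move=> wM x; by rewrite normrM -[leRHS]mulr1 ler_pM// indic_norm_le1.
Qed.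

Lemma preim_indic d (W : measurableType d) e (E : measurableType e)
  (p : W -> E) (A : set E) (x : W) : \1_A (p x) = \1_(p @^-1` A) x :> R.
Proof. by rewrite !indicE. Qed.

Lemma measurable_indic_comp d (W : measurableType d) e (E : measurableType e)
  (p : W -> E) (A : set E) : measurable_fun setT p -> measurable A ->
  measurable_fun setT (fun x => \1_A (p x) : R).
Proof.
move=> mp mA; apply: (@measurableT_comp _ _ _ _ _ _ (\1_A : E -> R)) => //.
Qed.

(** The pi-lambda theorem for the weighted laws of p1 and p2. The weights may
    change sign, being merely bounded: this is what allows cosines as weights. *)
Lemma weighted_pi_lambda e (E : measurableType e) (p1 : W1 -> E) (p2 : W2 -> E)
    (G : set (set E)) :
  measurable_fun setT p1 -> measurable_fun setT p2 -> setI_closed G ->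
  e.-measurable `<=` <<s G >> -> G `<=` e.-measurable ->
  (forall A, G A -> \int[P1]_x (w1 x * \1_A (p1 x)) =
                    \int[P2]_x (w2 x * \1_A (p2 x))) ->
  forall A, measurable A -> \int[P1]_x (w1 x * \1_A (p1 x)) =
                            \int[P2]_x (w2 x * \1_A (p2 x)).
Proof.
move=> mp1 mp2 GI Ggen Gm GE.
pose H := [set A : set E | measurable A /\ \int[P1]_x (w1 x * \1_A (p1 x)) =
                            \int[P2]_x (w2 x * \1_A (p2 x))].
have bd d (W : measurableType d) (w : W -> R) (p : W -> E) A x :
    (forall x, `|w x| <= M) -> `|w x * \1_A (p x)| <= M.
  by move=> wM; rewrite preim_indic; exact: weight_indic_le.
have mi d (W : measurableType d) (w : W -> R) (p : W -> E) A :
    measurable_fun setT w -> measurable_fun setT p -> measurable A ->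
    measurable_fun setT (fun x => w x * \1_A (p x)).
  by move=> mw mp mA; apply: measurable_funM => //; exact: measurable_indic_comp.
have ii d (W : measurableType d) (P : probability W R) (w : W -> R) (p : W -> E) A :
    measurable_fun setT w -> measurable_fun setT p -> measurable A ->
    (forall x, `|w x| <= M) -> intble P (fun x => w x * \1_A (p x)).
  move=> mw mp mA wM; apply: (bounded_intble _ (mi _ _ _ _ _ mw mp mA)) => x.
  exact: bd.
have LH : lambda_system setT H.
  split.
  - by move=> A _.
  - split => //; transitivity (\int[P1]_x w1 x).
      by apply: eq_Rint => x; rewrite indicT mulr1.
    by rewrite w12; apply: eq_Rint => x; rewrite indicT mulr1.
  - move=> A B BA [mA hA] [mB hB]; split; first exact: measurableD.
    have iD x : \1_(A `\` B) x = \1_A x - \1_B x :> R.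
      rewrite !indicE in_setD; case: (boolP (x \in B)) => /= xB.
        by rewrite andbF (mem_set (BA x (set_mem xB))) subrr.
      by rewrite andbT subr0.
    transitivity (\int[P1]_x (w1 x * \1_A (p1 x) - w1 x * \1_B (p1 x))).
      by apply: eq_Rint => x; rewrite iD mulrBr.
    rewrite RintB; [|exact: ii..].
    rewrite hA hB -RintB; [|exact: ii..].
    by apply: eq_Rint => x; rewrite iD mulrBr.
  - move=> F ndF FH; have mF n : measurable (F n) by have [] := FH n.
    split; first exact: bigcupT_measurable.
    have cv d (W : measurableType d) (P : probability W R) (w : W -> R) (p : W -> E) :
      measurable_fun setT w -> measurable_fun setT p -> (forall x, `|w x| <= M) ->
      \int[P]_x (w x * \1_(F n) (p x)) @[n --> \oo] -->
        \int[P]_x (w x * \1_(\bigcup_n F n) (p x)).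
      move=> mw mp wM; apply: (Rint_dct (g := fun=> M)).
      + by move=> n; apply: mi.
      + by apply: mi => //; exact: bigcupT_measurable.
      + move=> x; apply: cvgMr; apply: cvg_near_cst.
        have [|xF] := pselect ((\bigcup_n F n) (p x)).
          move=> [k _ Fkx]; near=> n.
          have Fnx : F n (p x).
            have kn : (k <= n)%N by near: n; exact: nbhs_infty_ge.
            by have /subsetPset := ndF _ _ kn; apply.
          by rewrite !indicE !mem_set//; exists k.
        apply: nearW => n; rewrite !indicE !memNset//.
        by move=> Fnx; apply: xF; exists n.
      + exact: intble_cst.
      + by move=> n x; exact: bd.
    have := cv _ _ P2 w2 p2 mw2 mp2 w2M.
    under eq_fun do rewrite -(FH _).2.
    by move/(cvg_unique _ (cv _ _ P1 w1 p1 mw1 mp1 w1M)); apply.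
have GH : G `<=` H by move=> A GA; split; [exact: Gm|exact: GE].
move=> A mA.
suff : H A by case.
by apply: (lambda_system_subset GI LH GH) => //; exact: Ggen.
Unshelve. all: by end_near. Qed.

End weighted_pi_lambda.

Section gaussian_smoothing.
Context (R : realType).
Notation lam := (@lebesgue_measure R).

(** Chebyshev: a concentrated normal law barely crosses a threshold that is far
    from its mean. *)
Lemma normal_ray (m s b : R) : s != 0 -> m != b ->
  `|\int[normal_prob m s]_y \1_(`]-oo, b[%classic) y - \1_(`]-oo, b[%classic) m|
    <= s ^+ 2 / (m - b) ^+ 2.
Proof.
move=> s0 mb; have mb0 : m - b != 0 by rewrite subr_eq0.
have mi : measurable_fun [set: R] (\1_(`]-oo, b[%classic) : R -> R).
  exact: measurable_indic.
have ii : intble (normal_prob m s) (\1_(`]-oo, b[%classic) : R -> R).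
  by apply: (@bounded_intble _ _ _ _ _ 1) => // x; exact: indic_norm_le1.
rewrite -[X in `|_ - X|](Rint_cst (normal_prob m s)) -RintB//; last exact: intble_cst.
have i2 : intble (normal_prob m s) (fun y : R => (y - m) ^+ 2).
  apply: egrowth_intble => //; first by apply: cont_meas; contder.
  apply: egrowthX; apply: egrowthD; [exact: egrowth_id|exact: egrowth_cst].
rewrite -(normal_mean_sqr m s0) -RintZr//.
apply: Rint_abs_le; first exact: intbleZr.
  exact: measurable_funB.
move=> y; rewrite !indicE.
(* The two indicators differ only when b separates y and m. *)
have key : b <= m /\ y < b \/ m < b /\ b <= y ->
    1 <= (y - m) ^+ 2 / (m - b) ^+ 2.
  move=> h; rewrite ler_pdivlMr ?exprn_even_gt0// mul1r.
  by case: h => -[? ?]; nra.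
have [yb|yb] := ltP y b; have [mb'|mb'] := ltP m b.
- by rewrite !mem_set/= ?in_itv//= subrr normr0 divr_ge0 ?sqr_ge0.
- rewrite mem_set/= ?in_itv//= memNset/= ?in_itv/= ?subr0 ?normr1.
    by apply: key; left.
  by rewrite ltNge mb'.
- rewrite memNset/= ?in_itv/= ?mem_set/= ?in_itv//= ?sub0r ?normrN ?normr1.
    by apply: key; right.
  by rewrite ltNge yb.
- rewrite !memNset/= ?in_itv/= ?subrr ?normr0 ?divr_ge0 ?sqr_ge0//.
    by rewrite ltNge mb'.
  by rewrite ltNge yb.
Qed.

End gaussian_smoothing.

Section cosine_uniqueness.
Context (R : realType) d1 (W1 : measurableType d1) d2 (W2 : measurableType d2).
Variables (P1 : probability W1 R) (P2 : probability W2 R).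
Notation lam := (@lebesgue_measure R).

(** The normal density is, up to a constant, the cosine transform of a normal law
    (normal_cos): weighted integrals of Gaussian kernels are therefore averages of
    weighted integrals of cosines. *)
Lemma kernel_cos d (W : measurableType d) (P : probability W R) (w u : W -> R)
    (M s y : R) : measurable_fun setT w -> measurable_fun setT u ->
  (forall x, `|w x| <= M) -> s != 0 ->
  \int[P]_x (w x * normal_pdf (u x) s y) =
  normal_peak s * \int[normal_prob 0 s^-1]_z \int[P]_x (w x * cos (z * u x - z * y)).
Proof.
move=> mw mu wM s0; have s1 : s^-1 != 0 by rewrite invr_neq0.
have mc : measurable_fun [set: W * R]
    (fun v => w v.1 * cos (v.2 * u v.1 - v.2 * y)).
  apply: measurable_funM; first exact: measurableT_comp.
  apply: (@measurableT_comp _ _ _ _ _ _ (@cos R)).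
    by apply: cont_meas; exact: continuous_cos.
  apply: measurable_funB; apply: measurable_funM => //.
  exact: measurableT_comp.
have bd x z : `|w x * cos (z * u x - z * y)| <= M.
  by rewrite normrM -[leRHS]mulr1 ler_pM ?cos_max.
have M0 : 0 <= M by rewrite (le_trans _ (wM point)).
rewrite -(@Rint_fubini _ _ _ _ _ P (normal_prob 0 s^-1)
  (fun v => w v.1 * cos (v.2 * u v.1 - v.2 * y))) /=.
- rewrite -RintZ.
    apply: eq_Rint => x; rewrite RintZ.
      transitivity (w x * (normal_peak s *
        \int[normal_prob 0 s^-1]_z cos ((u x - y) * z + 0))).
        rewrite normal_cos// cos0 mulr1 normal_pdfE// /normal_fun.
        congr (_ * (_ * expR _)); by field.
      rewrite mulrCA; congr (_ * (_ * _)); apply: eq_Rint => z.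
      by congr cos; ring.
    apply: (@bounded_intble _ _ _ _ _ 1); last by move=> z; exact: cos_max.
    by apply: cont_meas; contder.
  apply: (@bounded_intble _ _ _ _ _ M).
    rewrite (_ : (fun x => _) = (fun x => w x * expR (- ((s^-1 * (u x - y)) ^+ 2) / 2))).
      apply: measurable_funM => //; apply: measurableT_comp => //.
      apply: measurable_funM => //; apply: measurableT_comp => //.
      apply: measurable_funX; apply: measurable_funM => //.
      exact: measurable_funB.
    apply/funext => x; rewrite RintZ; last first.
      apply: (@bounded_intble _ _ _ _ _ 1); last by move=> z; exact: cos_max.
      by apply: cont_meas; contder.
    congr (_ * _); transitivity (\int[normal_prob 0 s^-1]_z cos ((u x - y) * z + 0)).
      by apply: eq_Rint => z; congr cos; ring.
    by rewrite normal_cos// cos0 mulr1.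
  move=> x; apply: Rint_abs_bound => //.
  apply: measurable_funM => //; by apply: cont_meas; contder.
- apply: (@prod_intble _ _ _ _ _ _ _ _ (fun=> M) (fun=> 1)) => //.
  + exact: intble_cst.
  + exact: intble_cst.
  + by move=> x z /=; rewrite mulr1.
- move=> x; apply: (@bounded_intble _ _ _ _ _ M) => //.
  apply: measurable_funM => //; by apply: cont_meas; contder.
- move=> z; apply: (@bounded_intble _ _ _ _ _ M) => //.
  apply: measurable_funM => //; apply: (@measurableT_comp _ _ _ _ _ _ (@cos R)).
    by apply: cont_meas; exact: continuous_cos.
  by apply: measurable_funB => //; exact: measurable_funM.
Qed.

(** Fubini: a half-line smoothed by a Gaussian kernel is a superposition of kernels,
    so that kernel_cos applies under the outer integral. *)
Lemma kernel_ray d (W : measurableType d) (P : probability W R) (w u : W -> R)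
    (M s b : R) : measurable_fun setT w -> measurable_fun setT u ->
  (forall x, `|w x| <= M) -> s != 0 ->
  intble P (fun x => w x * \int[normal_prob (u x) s]_y \1_(`]-oo, b[%classic) y) /\
  \int[P]_x (w x * \int[normal_prob (u x) s]_y \1_(`]-oo, b[%classic) y) =
  \int[lam]_y (\1_(`]-oo, b[%classic) y *
    \int[P]_x (w x * normal_pdf (u x) s y)).
Proof.
move=> mw mu wM s0; set I := (\1_(`]-oo, b[%classic) : R -> R).
have mI : measurable_fun [set: R] I by exact: measurable_indic.
have I1 y : `|I y| <= 1 by exact: indic_norm_le1.
pose f (v : W * R) := w v.1 * (I v.2 * normal_pdf (u v.1) s v.2).
have mf : measurable_fun setT f.
  apply: measurable_funM; first exact: measurableT_comp.
  apply: measurable_funM; first exact: measurableT_comp.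
  rewrite (_ : (fun v => _) = (fun v : W * R => normal_peak s *
    expR (- (v.2 - u v.1) ^+ 2 / (s ^+ 2 *+ 2)))); last first.
    by apply/funext => v; rewrite normal_pdfE.
  apply: measurable_funM => //; apply: measurableT_comp => //.
  apply: measurable_funM => //; apply: measurableT_comp => //.
  apply: measurable_funX; apply: measurable_funB => //.
  exact: measurableT_comp.
have sec x : intble lam (fun y => I y * normal_pdf (u x) s y).
  by have /(normal_intble (u x) s mI) := bounded_intble (normal_prob (u x) s) mI I1.
have fb x : `|\int[lam]_y `|f (x, y)| | <= M.
  rewrite ger0_norm; last by apply: Rint_ge0.
  have -> : \int[lam]_y `|f (x, y)| =
      `|w x| * \int[normal_prob (u x) s]_y `|I y|.
    rewrite normal_Rint//; last exact: measurableT_comp.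
    rewrite -RintZ; last first.
        have mnI : measurable_fun [set: R] (fun y => `|I y|).
        exact: measurableT_comp.
      have nI1 y : `| `|I y| | <= 1 by rewrite normr_id.
      by have /(normal_intble (u x) s mnI) :=
        bounded_intble (normal_prob (u x) s) mnI nI1.
    apply: eq_Rint => y; rewrite /f/= !normrM.
    by rewrite (ger0_norm (normal_pdf_ge0 _ _ _)).
  rewrite -[leRHS]mulr1 ler_pM//; first by apply: Rint_ge0.
  rewrite -[leLHS]ger0_norm; last by apply: Rint_ge0.
  apply: Rint_abs_bound; first exact: measurableT_comp.
  by move=> y; rewrite normr_id.
have s1 x : intble lam (fun y => f (x, y)) by exact: (intbleZ (w x) (sec x)).
have s2 y : intble P (fun x => f (x, y)).
  apply: (@bounded_intble _ _ _ _ _ (M * (1 * normal_peak s))).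
    exact: (measurableT_comp mf (pair2_measurable y)).
  move=> x; rewrite /f/= !normrM; apply: ler_pM => //; apply: ler_pM => //.
  by rewrite ger0_norm ?normal_pdf_ge0// normal_pdf_ub.
have fi : intble (P \x lam)%E f.
  by apply: (prod_intble12 (g := fun=> M)) => //; exact: intble_cst.
have E x : w x * \int[normal_prob (u x) s]_y I y = \int[lam]_y f (x, y).
  by rewrite normal_Rint// -RintZ.
split.
  by apply: (eq_intble (fun x => esym (E x))); exact: intble_prod1.
rewrite (eq_Rint _ E) Rint_fubini//; apply: eq_Rint => y.
rewrite -RintZ.
  by apply: eq_Rint => x; rewrite /f/= mulrCA.
apply: (@bounded_intble _ _ _ _ _ (M * normal_peak s)).
  apply: measurable_funM => //.
  rewrite (_ : (fun x => normal_pdf (u x) s y) = (fun x : W => normal_peak s *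
    expR (- (y - u x) ^+ 2 / (s ^+ 2 *+ 2)))); last first.
    by apply/funext => v; rewrite normal_pdfE.
  apply: measurable_funM => //; apply: measurableT_comp => //.
  apply: measurable_funM => //; apply: measurableT_comp => //.
  by apply: measurable_funX; exact: measurable_funB.
move=> x; rewrite normrM ler_pM//.
by rewrite ger0_norm ?normal_pdf_ge0// normal_pdf_ub.
Qed.

(** With standard deviation e^2 and threshold a - e, where e = 1 / (n + 1), the
    distance of u x to the threshold is eventually at least e, also when u x = a;
    normal_ray then bounds the error by e^4 / e^2 <= e. Without the shift the limit
    at u x = a would be 1/2. *)
Lemma cvg_sharp_ray d (W : measurableType d) (P : probability W R) (w u : W -> R)
    (M a : R) : measurable_fun setT w -> measurable_fun setT u ->
  (forall x, `|w x| <= M) ->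
  \int[P]_x (w x * \int[normal_prob (u x) (n.+1%:R^-1 ^+ 2)]_y
      \1_(`]-oo, (a - n.+1%:R^-1)[%classic) y) @[n --> \oo] -->
  \int[P]_x (w x * \1_(`]-oo, a[%classic) (u x)).
Proof.
move=> mw mu wM.
have e0 n : 0 < n.+1%:R^-1 :> R by rewrite invr_gt0.
have e1 : (n.+1%:R^-1 : R) @[n --> \oo] --> (0 : R) by exact: cvg_harmonic.
have I1 (b y : R) : `|\1_(`]-oo, b[%classic) y| <= 1 :> R by exact: indic_norm_le1.
apply: (Rint_dct (g := fun=> M)).
- move=> n; have s0 : (n.+1%:R^-1 : R) ^+ 2 != 0 by rewrite expf_neq0// gt_eqF.
  have [+ _] := kernel_ray P (a - n.+1%:R^-1) mw mu wM s0.
  exact: intble_meas.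
- by apply: measurable_funM => //; apply: measurable_indic_comp.
- move=> x; apply: cvgMr.
  have bound n (b : R) : u x != b -> n.+1%:R^-1 <= `|u x - b| ->
    `|\int[normal_prob (u x) (n.+1%:R^-1 ^+ 2)]_y \1_(`]-oo, b[%classic) y -
      \1_(`]-oo, b[%classic) (u x)| <= n.+1%:R^-1.
    move=> ub eb; have s0 : (n.+1%:R^-1 : R) ^+ 2 != 0.
      by rewrite expf_neq0// gt_eqF.
    apply: (le_trans (normal_ray s0 ub)); set e := n.+1%:R^-1 in eb *.
    have e0n : 0 < e by exact: e0.
    have e1n : e <= 1 by rewrite /e invf_le1 ?ltr0n// ler1n.
    have dd : 0 < (u x - b) ^+ 2 by rewrite exprn_even_gt0//= subr_eq0.
    rewrite ler_pdivrMr//; rewrite -(real_normK (num_real (u x - b))).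
    set D := `|_| in eb *.
    have l1 : e ^+ 2 <= D ^+ 2 by nra.
    have l2 : e ^+ 2 <= e by nra.
    by rewrite (expr2 (e ^+ 2)) ler_pM ?sqr_ge0.
  have tr f g : (\forall n \near \oo, `|f n - g| <= n.+1%:R^-1) ->
      f n @[n --> \oo] --> (g : R).
    move=> fg; apply/cvgrPdist_le => eps eps0.
    have /cvgrPdist_le/(_ _ eps0) h := e1; near=> n.
    rewrite distrC; apply: (@le_trans _ _ n.+1%:R^-1); first by near: n.
    have : `|0 - (n.+1%:R^-1 : R)| <= eps by near: n.
    by rewrite sub0r normrN ger0_norm// ltW.
  apply: tr; have [ua|ua] := ltP (u x) a.
  + have hd : 0 < (a - u x) / 2 by rewrite divr_gt0 ?subr_gt0.
    near=> n.
    have en : n.+1%:R^-1 <= (a - u x) / 2.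
      have : `|0 - (n.+1%:R^-1 : R)| <= (a - u x) / 2.
        by near: n; have /cvgrPdist_le/(_ _ hd) := e1.
      by rewrite sub0r normrN ger0_norm// ltW.
    have e0n := e0 n; set e := n.+1%:R^-1 in en e0n *.
    have l1 : u x < a - e by lra.
    have -> : \1_(`]-oo, a[%classic) (u x) =
        \1_(`]-oo, (a - e)[%classic) (u x) :> R.
      by rewrite !indicE !mem_set//= in_itv.
    apply: bound; first by rewrite lt_eqF.
    by rewrite -/e ltr0_norm ?subr_lt0//; lra.
  + apply: nearW => n.
    have e0n := e0 n; set e := n.+1%:R^-1 in e0n *.
    have l1 : a - e < u x by lra.
    have -> : \1_(`]-oo, a[%classic) (u x) =
        \1_(`]-oo, (a - e)[%classic) (u x) :> R.
      rewrite !indicE !memNset//= in_itv/=; apply/negP; rewrite -leNgt//.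
      exact: ltW.
    apply: bound; first by rewrite gt_eqF.
    by rewrite -/e gtr0_norm ?subr_gt0//; lra.
- exact: intble_cst.
- move=> n x; rewrite normrM -[leRHS]mulr1 ler_pM//.
  by apply: Rint_abs_bound => //; exact: measurable_indic.
Unshelve. all: by end_near. Qed.

(** A signed measure on the line is determined by its cosine transform: smooth the
    half-lines by Gaussian kernels, which the transform determines, sharpen the
    kernels, and conclude by the pi-lambda theorem. *)
Lemma cosine_unique (w1 u1 : W1 -> R) (w2 u2 : W2 -> R) (M : R) :
  measurable_fun setT w1 -> measurable_fun setT u1 ->
  measurable_fun setT w2 -> measurable_fun setT u2 ->
  (forall x, `|w1 x| <= M) -> (forall x, `|w2 x| <= M) ->
  (forall s c : R, \int[P1]_x (w1 x * cos (s * u1 x + c)) =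
                   \int[P2]_x (w2 x * cos (s * u2 x + c))) ->
  forall A : set R, measurable A ->
    \int[P1]_x (w1 x * \1_A (u1 x)) = \int[P2]_x (w2 x * \1_A (u2 x)).
Proof.
move=> mw1 mu1 mw2 mu2 w1M w2M h.
have w12 : \int[P1]_x w1 x = \int[P2]_x w2 x.
  transitivity (\int[P1]_x (w1 x * cos (0 * u1 x + 0))).
    by apply: eq_Rint => x; rewrite mul0r addr0 cos0 mulr1.
  by rewrite h; apply: eq_Rint => x; rewrite mul0r addr0 cos0 mulr1.
apply: (weighted_pi_lambda mw1 mw2 w1M w2M w12 (G := @RGenInftyO.G R)) => //.
- move=> _ _ [a ->] [b ->]; exists (Num.min a b).
  apply/seteqP; split => x /=; rewrite !in_itv/= lt_min.
    by move=> [-> ->].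
  by move=> /andP[].
- have E : @measurable _ (measurableTypeR R) = <<s RGenInftyO.G (R:=R) >> :=
    RGenInftyO.measurableE R.
  by move=> A mA; have : @measurable _ (measurableTypeR R) A := mA; rewrite E.
- by move=> _ [a ->]; exact: measurable_itv.
move=> _ [a ->].
have c1 := cvg_sharp_ray (P := P1) (a := a) mw1 mu1 w1M.
have c2 := cvg_sharp_ray (P := P2) (a := a) mw2 mu2 w2M.
suff E : (fun n : nat => \int[P1]_x (w1 x *
      \int[normal_prob (u1 x) (n.+1%:R^-1 ^+ 2)]_y
        \1_(`]-oo, (a - n.+1%:R^-1)[%classic) y)) =
    (fun n : nat => \int[P2]_x (w2 x *
      \int[normal_prob (u2 x) (n.+1%:R^-1 ^+ 2)]_y
        \1_(`]-oo, (a - n.+1%:R^-1)[%classic) y)).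
  by rewrite E in c1; exact: (cvg_unique _ c1 c2).
apply/funext => n.
have s0 : (n.+1%:R^-1 : R) ^+ 2 != 0 by rewrite expf_neq0// invr_neq0.
have [_ ->] := kernel_ray P1 (a - n.+1%:R^-1) mw1 mu1 w1M s0.
have [_ ->] := kernel_ray P2 (a - n.+1%:R^-1) mw2 mu2 w2M s0.
apply: eq_Rint => y; congr (_ * _).
rewrite (kernel_cos P1 y mw1 mu1 w1M s0) (kernel_cos P2 y mw2 mu2 w2M s0).
congr (_ * _); apply: eq_Rint => z; exact: (h z (- (z * y))).
Qed.

End cosine_uniqueness.

Section cramer_wold.
Context (R : realType) d1 (W1 : measurableType d1) d2 (W2 : measurableType d2).
Variables (P1 : probability W1 R) (P2 : probability W2 R) (n : nat).
Variables (U : 'I_n -> W1 -> R) (V : 'I_n -> W2 -> R).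
Hypotheses (mU : forall j, measurable_fun setT (U j)).
Hypotheses (mV : forall j, measurable_fun setT (V j)).

(** Equality of the Fourier transforms of two weighted joint laws. *)
Definition same_cos (w1 : W1 -> R) (w2 : W2 -> R) :=
  forall (t : 'I_n -> R) (c : R),
    \int[P1]_x (w1 x * cos (\sum_(j < n) t j * U j x + c)) =
    \int[P2]_x (w2 x * cos (\sum_(j < n) t j * V j x + c)).

Lemma measurable_cos_lin d (W : measurableType d) (X : 'I_n -> W -> R)
    (t : 'I_n -> R) (c : R) : (forall j, measurable_fun setT (X j)) ->
  measurable_fun setT (fun x => cos (\sum_(j < n) t j * X j x + c)).
Proof.
move=> mX; apply: (@measurableT_comp _ _ _ _ _ _ (@cos R)).
  by apply: cont_meas; exact: continuous_cos.
apply: measurable_funD => //; apply: measurable_sum => j.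
exact: measurable_funM.
Qed.

Lemma cosM (a b : R) : cos a * cos b = 2^-1 * cos (a + b) + 2^-1 * cos (a - b).
Proof. by rewrite cosD cosB; field. Qed.

Lemma sum_delta d (W : measurableType d) (X : 'I_n -> W -> R) (t : 'I_n -> R)
    (j : 'I_n) (s : R) x :
  \sum_(k < n) (t k + (if k == j then s else 0)) * X k x =
  \sum_(k < n) t k * X k x + s * X j x.
Proof.
under eq_bigr do rewrite mulrDl.
rewrite big_split/=; congr (_ + _).
rewrite (bigD1 j)//= eqxx big1 ?addr0// => k kj.
by rewrite (negbTE kj) mul0r.
Qed.

Variable M : R.

(** One coordinate at a time can be tested against an arbitrary Borel set while the
    others stay tested against cosines: as a function of the j-th coordinate alone,
    with the remaining cosine absorbed in the weight through cos a cos b, this is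
    cosine_unique. *)
Lemma same_cos_indic (w1 : W1 -> R) (w2 : W2 -> R) (j : 'I_n) (A : set R) :
  measurable_fun setT w1 -> measurable_fun setT w2 ->
  (forall x, `|w1 x| <= M) -> (forall x, `|w2 x| <= M) -> measurable A ->
  same_cos w1 w2 ->
  same_cos (fun x => w1 x * \1_A (U j x)) (fun x => w2 x * \1_A (V j x)).
Proof.
move=> mw1 mw2 w1M w2M mA h t c.
have M0 : 0 <= M by apply: le_trans (w1M point).
pose v1 x := w1 x * cos (\sum_(k < n) t k * U k x + c).
pose v2 x := w2 x * cos (\sum_(k < n) t k * V k x + c).
have mv1 : measurable_fun setT v1.
  by apply: measurable_funM => //; exact: measurable_cos_lin.
have mv2 : measurable_fun setT v2.
  by apply: measurable_funM => //; exact: measurable_cos_lin.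
have v1M x : `|v1 x| <= M by rewrite normrM -[leRHS]mulr1 ler_pM// cos_max.
have v2M x : `|v2 x| <= M by rewrite normrM -[leRHS]mulr1 ler_pM// cos_max.
have step d (W : measurableType d) (P : probability W R) (X : 'I_n -> W -> R)
      (w : W -> R) (s c' : R) :
    (forall j, measurable_fun setT (X j)) -> measurable_fun setT w ->
    (forall x, `|w x| <= M) ->
    \int[P]_x (w x * cos (\sum_(k < n) t k * X k x + c) * cos (s * X j x + c')) =
    2^-1 * \int[P]_x (w x * cos (\sum_(k < n)
       (t k + (if k == j then s else 0)) * X k x + (c + c'))) +
    2^-1 * \int[P]_x (w x * cos (\sum_(k < n)
       (t k + (if k == j then - s else 0)) * X k x + (c - c'))).
  move=> mX mw wM.
  have ic t' c'' : intble P (fun x => w x * cos (\sum_(k < n) t' k * X k x + c'')).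
    apply: (@bounded_intble _ _ _ _ _ M).
      by apply: measurable_funM => //; exact: measurable_cos_lin.
    by move=> x; rewrite normrM -[leRHS]mulr1 ler_pM// cos_max.
  have icl t' c'' := intbleZ 2^-1 (ic t' c'').
  rewrite -!RintZ// -RintD//; apply: eq_Rint => x.
  rewrite !sum_delta -mulrA cosM mulrDr; congr (_ + _).
    by rewrite mulrCA; congr (_ * (_ * cos _)); ring.
  by rewrite mulrCA; congr (_ * (_ * cos _)); ring.
have := @cosine_unique R _ W1 _ W2 P1 P2 _ _ _ _ _ mv1 (mU j) mv2 (mV j) v1M v2M _ _ mA.
move=> e; transitivity (\int[P1]_x (v1 x * \1_A (U j x))).
  by apply: eq_Rint => x; rewrite /v1 mulrAC.
rewrite e; first by apply: eq_Rint => x; rewrite /v2 mulrAC.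
by move=> s c'; rewrite /v1 /v2 !step// !h.
Qed.

Lemma measurable_rect_pi (E := (R * R)%type) (G := [set C : set E |
    exists A B, [/\ measurable A, measurable B & C = A `*` B]]) :
  [/\ setI_closed G, measurable `<=` <<s G >> & G `<=` measurable].
Proof.
split.
- move=> _ _ [A1 [B1 [mA1 mB1 ->]]] [A2 [B2 [mA2 mB2 ->]]].
  exists (A1 `&` A2), (B1 `&` B2); split; [exact: measurableI..|].
  by rewrite setXI.
- move=> C mC; rewrite measurable_prod_measurableType in mC.
  move: C mC; apply: sub_sigma_algebra2.
  by move=> _ [A mA [B mB <-]]; exists A, B.
- by move=> _ [A [B [mA mB ->]]]; exact: measurableX.
Qed.

(** Rectangles generate the Borel sets of the plane. *)
Lemma same_law_pair (w1 S1 T1 : W1 -> R) (w2 S2 T2 : W2 -> R) (C : set (R * R)) :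
  measurable_fun setT w1 -> measurable_fun setT w2 ->
  (forall x, `|w1 x| <= M) -> (forall x, `|w2 x| <= M) ->
  measurable_fun setT S1 -> measurable_fun setT S2 ->
  measurable_fun setT T1 -> measurable_fun setT T2 ->
  (forall A B : set R, measurable A -> measurable B ->
    \int[P1]_x (w1 x * (\1_A (S1 x) * \1_B (T1 x))) =
    \int[P2]_x (w2 x * (\1_A (S2 x) * \1_B (T2 x)))) ->
  measurable C ->
  \int[P1]_x (w1 x * \1_C (S1 x, T1 x)) = \int[P2]_x (w2 x * \1_C (S2 x, T2 x)).
Proof.
move=> mw1 mw2 w1M w2M mS1 mS2 mT1 mT2 h mC.
have [GI Gg Gm] := measurable_rect_pi.
have w12 : \int[P1]_x w1 x = \int[P2]_x w2 x.
  have := h setT setT measurableT measurableT.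
  rewrite (eq_Rint _ (g := w1)); last by move=> x; rewrite !indicT !mulr1.
  by rewrite [RHS](eq_Rint _ (g := w2))// => x; rewrite !indicT !mulr1.
have mp1 : measurable_fun setT (fun x => (S1 x, T1 x)) by exact: measurable_fun_pair.
have mp2 : measurable_fun setT (fun x => (S2 x, T2 x)) by exact: measurable_fun_pair.
apply: (weighted_pi_lambda mw1 mw2 w1M w2M w12 mp1 mp2 GI Gg Gm _ mC).
move=> _ [A [B [mA mB ->]]].
have iX (a b : R) : \1_(A `*` B) (a, b) = \1_A a * \1_B b :> R.
  by rewrite !indicE in_setX/= -natrM mulnb.
transitivity (\int[P1]_x (w1 x * (\1_A (S1 x) * \1_B (T1 x)))).
  by apply: eq_Rint => x; rewrite iX.
by rewrite h//; apply: eq_Rint => x; rewrite iX.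
Qed.

End cramer_wold.

Section gaussian_independence.
Context (R : realType) d (W : measurableType d) (P : probability W R) (n : nat).
Variable xi : 'I_n -> W -> R.
Hypothesis mxi : forall j, measurable_fun setT (xi j).
Hypothesis xi_cos : forall (t : 'I_n -> R) (c : R),
  \int[P]_x cos (\sum_(j < n) t j * xi j x + c) =
  expR (- (\sum_(j < n) t j ^+ 2) / 2) * cos c.
Notation gam := (normal_prob (0 : R) 1).
Variable i : 'I_n.
Variable phi : 'I_n -> R -> R.
Hypothesis mphi : forall j, measurable_fun [set: R] (phi j).

(** Independence is expressed by a comparison: the family with its i-th coordinate
    replaced by an independent standard normal variable has the same joint law. *)
Let V (j : 'I_n) (v : measurableTypeR R * W) : R := if j == i then v.1 else xi j v.2.

Let mV j : measurable_fun setT (V j).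
Proof. by rewrite /V; case: (j == i) => //; exact: measurableT_comp. Qed.

Let Q : probability (measurableTypeR R * W)%type R := (gam \x P)%E.

Let same_cos1 : same_cos P Q xi V (fun=> 1) (fun=> 1).
Proof.
move=> t c; under [LHS]eq_Rint do rewrite mul1r.
under [RHS]eq_Rint do rewrite mul1r.
rewrite xi_cos; pose t' j := if j == i then 0 else t j.
have sV v : \sum_(j < n) t j * V j v + c =
    \sum_(j < n) t' j * xi j v.2 + (t i * v.1 + c).
  rewrite (bigD1 i)//= [in RHS](bigD1 i)//= /V /t' eqxx mul0r add0r.
  rewrite addrAC [in LHS]addrC; congr (_ + _).
  by apply: eq_bigr => j ji; rewrite (negbTE ji).
have cb z : `|cos z| <= 1 :> R by exact: cos_max.
have -> : \int[Q]_v cos (\sum_(j < n) t j * V j v + c) =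
    \int[Q]_v cos (\sum_(j < n) t' j * xi j v.2 + (t i * v.1 + c)).
  by apply: eq_Rint => v; rewrite sV.
have mc : measurable_fun setT (fun v : measurableTypeR R * W =>
    cos (\sum_(j < n) t' j * xi j v.2 + (t i * v.1 + c))).
  apply: (@measurableT_comp _ _ _ _ _ _ (@cos R)).
    by apply: cont_meas; exact: continuous_cos.
  apply: measurable_funD.
    by apply: measurable_sum => j; apply: measurable_funM => //; exact: measurableT_comp.
  by apply: measurable_funD => //; exact: measurable_funM.
rewrite [RHS]Rint_prod12; last 2 first.
- by apply: (@bounded_intble _ _ _ _ _ 1).
- move=> z; apply: (@bounded_intble _ _ _ _ _ 1) => //.
  exact: (measurable_cos_lin t' (t i * z + c) mxi).
have -> : \int[gam]_z \int[P]_y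
      cos (\sum_(j < n) t' j * xi j (z, y).2 + (t i * (z, y).1 + c)) =
    \int[gam]_z (expR (- (\sum_(j < n) t' j ^+ 2) / 2) * cos (t i * z + c)).
  by apply: eq_Rint => z; exact: (xi_cos t' (t i * z + c)).
rewrite RintZ; last first.
  apply: (@bounded_intble _ _ _ _ _ 1) => //; by apply: cont_meas; contder.
rewrite normal_cos ?oner_neq0// mulrA -expRD; congr (expR _ * _).
rewrite (bigD1 i)//= [in RHS](bigD1 i)//= /t' eqxx.
rewrite [in RHS](eq_bigr (fun j => t j ^+ 2)); last first.
  by move=> j ji; rewrite (negbTE ji).
by field.
Qed.

Let S1 (l : seq 'I_n) x := \sum_(j <- l) phi j (xi j x).
Let S2 (l : seq 'I_n) v := \sum_(j <- l) phi j (V j v).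

Let mS1 l : measurable_fun setT (S1 l).
Proof. by apply: measurable_sum => j; exact: measurableT_comp. Qed.

Let mS2 l : measurable_fun setT (S2 l).
Proof. by apply: measurable_sum => j; exact: measurableT_comp. Qed.

(** Each step adds one summand: same_cos_indic frees its coordinate from the cosines
    and same_law_pair merges it with the partial sum. *)
Let same_cos_sum l (B : set R) : measurable B ->
  same_cos P Q xi V (fun x => \1_B (S1 l x)) (fun v => \1_B (S2 l v)).
Proof.
elim: l B => [|j l IH] B mB.
  move=> t c.
  have e1 x : \1_B (S1 [::] x) = \1_B 0 :> R by rewrite /S1 big_nil.
  have e2 v : \1_B (S2 [::] v) = \1_B 0 :> R by rewrite /S2 big_nil.
  under [LHS]eq_Rint do rewrite e1; under [RHS]eq_Rint do rewrite e2.
  rewrite !RintZ.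
  - congr (_ * _); have := same_cos1 t c.
    under [LHS]eq_Rint do rewrite mul1r.
    by under [RHS]eq_Rint do rewrite mul1r.
  - apply: (@bounded_intble _ _ _ _ _ 1); last by move=> x; exact: cos_max.
    exact: measurable_cos_lin.
  - apply: (@bounded_intble _ _ _ _ _ 1); last by move=> x; exact: cos_max.
    exact: measurable_cos_lin.
move=> t c.
pose C := [set p : R * R | B (phi j p.2 + p.1)].
have mC : measurable C.
  rewrite (_ : C = (fun p : R * R => phi j p.2 + p.1) @^-1` B)//.
  rewrite -[X in measurable X]setTI; apply: measurable_funD => //.
  exact: measurableT_comp.
have mc1 : measurable_fun setT (fun x => cos (\sum_(j0 < n) t j0 * xi j0 x + c)).
  exact: measurable_cos_lin.
have mc2 : measurable_fun setT (fun x => cos (\sum_(j0 < n) t j0 * V j0 x + c)).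
  exact: measurable_cos_lin.
have := @same_law_pair R _ W _ (measurableTypeR R * W)%type P Q 1 _ (S1 l) (xi j) _ (S2 l) (V j) C
  mc1 mc2 (fun x => cos_max _) (fun x => cos_max _) (mS1 l) (mS2 l) (mxi j) (mV j) _ mC.
have iC1 x : \1_B (S1 (j :: l) x) = \1_C (S1 l x, xi j x) :> R.
  by rewrite !indicE /S1 big_cons.
have iC2 x : \1_B (S2 (j :: l) x) = \1_C (S2 l x, V j x) :> R.
  by rewrite !indicE /S2 big_cons.
move=> h; under [LHS]eq_Rint do rewrite iC1 mulrC.
under [RHS]eq_Rint do rewrite iC2 mulrC.
apply: h => A D mA mD.
have := @same_cos_indic R _ W _ (measurableTypeR R * W)%type P Q n xi V mxi mV 1 _ _ j D
  (measurable_indic_comp (mS1 l) mA) (measurable_indic_comp (mS2 l) mA)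
  (fun x => indic_norm_le1 _ _) (fun x => indic_norm_le1 _ _) mD (IH A mA) t c.
under [LHS]eq_Rint do rewrite mulrC.
by under [RHS]eq_Rint do rewrite mulrC.
Qed.

Variable l : seq 'I_n.
Hypothesis il : i \notin l.

(** The comparison with all cosines constant: the joint law of the i-th coordinate and
    of a sum over other coordinates, which the replacement leaves untouched, is a
    product. *)
Lemma gaussian_pair_law (C : set (R * R)) : measurable C ->
  P ((fun x => (xi i x, \sum_(j <- l) phi j (xi j x))) @^-1` C) =
  (gam \x P)%E ((fun v => (v.1, \sum_(j <- l) phi j (xi j v.2))) @^-1` C).
Proof.
move=> mC.
have S2E v : S2 l v = S1 l v.2.
  rewrite /S2 /S1; apply: eq_big_seq => j jl; rewrite /V ifN//.
  by apply: contraNneq il => <-.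
have m1 : measurable_fun setT (fun _ : W => 1 : R) by [].
have m2 : measurable_fun setT (fun _ : measurableTypeR R * W => 1 : R) by [].
have b1 (x : W) : `|1 : R| <= 1 by rewrite normr1.
have b2 (x : measurableTypeR R * W) : `|1 : R| <= 1 by rewrite normr1.
have := @same_law_pair R _ W _ (measurableTypeR R * W)%type P Q 1 _ (xi i) (S1 l) _ (V i) (S2 l) C
  m1 m2 b1 b2 (mxi i) (mV i) (mS1 l) (mS2 l) _ mC.
move=> h.
have {}h : \int[P]_x (\1_C (xi i x, S1 l x)) = \int[Q]_v (\1_C (v.1, S1 l v.2)) :> R.
  transitivity (\int[P]_x (1 * \1_C (xi i x, S1 l x))).
    by apply: eq_Rint => x; rewrite mul1r.
  rewrite h.
    by apply: eq_Rint => v; rewrite mul1r S2E /V eqxx.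
  move=> A B mA mB.
  have := @same_cos_indic R _ W _ (measurableTypeR R * W)%type P Q n xi V mxi mV 1 _ _ i A
    (measurable_indic_comp (mS1 l) mB) (measurable_indic_comp (mS2 l) mB)
    (fun x => indic_norm_le1 _ _) (fun x => indic_norm_le1 _ _) mA (same_cos_sum l mB)
    (fun=> 0) 0.
  under [X in X = _ -> _]eq_Rint => x.
    rewrite big1 ?addr0 ?cos0 ?mulr1; last by move=> j _; rewrite mul0r.
    over.
  under [X in _ = X -> _]eq_Rint => x.
    rewrite big1 ?addr0 ?cos0 ?mulr1; last by move=> j _; rewrite mul0r.
    over.
  move=> e; under [LHS]eq_Rint do rewrite mul1r mulrC.
  by rewrite e; apply: eq_Rint => x; rewrite mul1r mulrC.
have mp1 : measurable_fun setT (fun x => (xi i x, S1 l x)).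
  exact: measurable_fun_pair.
have mp2 : measurable_fun setT (fun v : measurableTypeR R * W => (v.1, S1 l v.2)).
  by apply: measurable_fun_pair => //; exact: measurableT_comp.
have mD1 : measurable ((fun x => (xi i x, S1 l x)) @^-1` C).
  by rewrite -[X in measurable X]setTI; exact: mp1.
have mD2 : measurable ((fun v : measurableTypeR R * W => (v.1, S1 l v.2)) @^-1` C).
  by rewrite -[X in measurable X]setTI; exact: mp2.
have toP d' (Y : measurableType d') (M : probability Y R) (D : set Y) :
    measurable D -> M D = (\int[M]_x \1_D x)%:E.
  move=> mD; rewrite -intE ?integral_indic ?setIT//.
  apply: (@bounded_intble _ _ _ _ _ 1); first exact: measurable_indic.
  by move=> x; exact: indic_norm_le1.
rewrite (toP _ _ P _ mD1) -[RHS]/(Q _) (toP _ _ Q _ mD2); congr (_%:E).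
by move: h; under eq_Rint do rewrite preim_indic;
  under [X in _ = X -> _]eq_Rint do rewrite preim_indic.
Qed.

Lemma gaussian_pair_intble (f : R * R -> R) : measurable_fun setT f ->
  intble P (fun x => f (xi i x, \sum_(j <- l) phi j (xi j x))) <->
  intble (gam \x P)%E (fun v => f (v.1, \sum_(j <- l) phi j (xi j v.2))).
Proof.
move=> mf.
have mp1 : measurable_fun setT (fun x => (xi i x, S1 l x)).
  exact: measurable_fun_pair.
have mp2 : measurable_fun setT (fun v : measurableTypeR R * W => (v.1, S1 l v.2)).
  by apply: measurable_fun_pair => //; exact: measurableT_comp.
split; first exact: (same_law_intble mp1 mp2 gaussian_pair_law mf).
apply: (same_law_intble mp2 mp1 _ mf) => C mC.
exact/esym/gaussian_pair_law.
Qed.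

Lemma gaussian_pair_Rint (f : R * R -> R) : measurable_fun setT f ->
  \int[P]_x f (xi i x, \sum_(j <- l) phi j (xi j x)) =
  \int[(gam \x P)%E]_v f (v.1, \sum_(j <- l) phi j (xi j v.2)).
Proof.
move=> mf.
have mp1 : measurable_fun setT (fun x => (xi i x, S1 l x)).
  exact: measurable_fun_pair.
have mp2 : measurable_fun setT (fun v : measurableTypeR R * W => (v.1, S1 l v.2)).
  by apply: measurable_fun_pair => //; exact: measurableT_comp.
exact: (same_law_Rint mp1 mp2 gaussian_pair_law mf).
Qed.

End gaussian_independence.

(** * Diagonal elements of the second chaos *)

Section diagonal_chaos.
Context (R : realType) d (W : measurableType d) (P : probability W R) (n : nat).
Variable xi : 'I_n -> W -> R.
Hypothesis mxi : forall j, measurable_fun setT (xi j).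
Hypothesis xi_cos : forall (t : 'I_n -> R) (c : R),
  \int[P]_x cos (\sum_(j < n) t j * xi j x + c) =
  expR (- (\sum_(j < n) t j ^+ 2) / 2) * cos c.
Notation gam := (normal_prob (0 : R) 1).
Implicit Type lam : 'I_n -> R.

Definition diag_sum (l : seq 'I_n) lam (x : W) :=
  \sum_(j <- l) lam j * (xi j x ^+ 2 - 1).

Lemma measurable_sqr1 (c : R) : measurable_fun [set: R] (fun x : R => c * (x ^+ 2 - 1)).
Proof. by apply: cont_meas; contder. Qed.

Lemma measurable_diag_sum l lam : measurable_fun setT (diag_sum l lam).
Proof.
apply: measurable_sum => j.
exact: (measurableT_comp (measurable_sqr1 (lam j)) (mxi j)).
Qed.

Section one_coordinate.
Variables (i : 'I_n) (l : seq 'I_n) (lam : 'I_n -> R).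
Hypothesis il : i \notin l.
Notation S := (diag_sum l lam).

Let mphi j : measurable_fun [set: R] (fun x : R => lam j * (x ^+ 2 - 1)).
Proof. exact: measurable_sqr1. Qed.

(** The i-th coordinate can be integrated out first, being independent of S. *)
Lemma indep_Rint (f : R * R -> R) : measurable_fun setT f ->
  (forall s, intble gam (fun x => f (x, s))) ->
  intble P (fun w => f (xi i w, S w)) ->
  \int[P]_w f (xi i w, S w) = \int[P]_w \int[gam]_x f (x, S w).
Proof.
move=> mf fs fi.
rewrite (gaussian_pair_Rint mxi xi_cos mphi il mf) Rint_prod21//.
  exact/(gaussian_pair_intble mxi xi_cos mphi il mf).
by move=> y; exact: (fs (S y)).
Qed.

Lemma indep_mul (a b : R -> R) : measurable_fun [set: R] a ->
  measurable_fun [set: R] b -> intble gam a -> intble P (b \o S) ->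
  intble P (fun w => a (xi i w) * b (S w)) /\
  \int[P]_w (a (xi i w) * b (S w)) = \int[gam]_x a x * \int[P]_w b (S w).
Proof.
move=> ma mb ia ib.
pose f (v : R * R) := a v.1 * b v.2.
have mf : measurable_fun setT f.
  by apply: measurable_funM; exact: measurableT_comp.
have mS := measurable_diag_sum l lam.
have fi : intble P (fun w => f (xi i w, S w)).
  apply/(gaussian_pair_intble mxi xi_cos mphi il mf).
  apply: (@prod_intble _ (measurableTypeR R) _ W R gam P _
    (fun x => `|a x|) (fun w => `|b (S w)|)).
  - rewrite /f/=; apply: measurable_funM.
      exact: (measurableT_comp ma measurable_fst).
    apply: (measurableT_comp mb).
    exact: (measurableT_comp mS measurable_snd).
  - exact: intble_norm.
  - exact: (intble_norm ib).
  - by move=> x w; rewrite normrM.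
split => //; rewrite (indep_Rint mf _ fi); last first.
  by move=> s; exact: (intbleZr (b s) ia).
rewrite -RintZ//; apply: eq_Rint => w; exact: (RintZr (b (S w)) ia).
Qed.

End one_coordinate.

Definition psum (l : seq 'I_n) lam k : R := \sum_(j <- l) lam j ^+ k.

(** The cumulants of xi^2 - 1 are 0, 2, 8, 48, and cumulants add up over independent
    coordinates; the fourth moment is the fourth cumulant plus three times the
    square of the second. *)
Lemma diag_moments l lam : uniq l ->
  (forall k, (k <= 4)%N -> intble P (fun w => diag_sum l lam w ^+ k)) /\
  [/\ \int[P]_w diag_sum l lam w = 0,
      \int[P]_w (diag_sum l lam w ^+ 2) = 2 * psum l lam 2,
      \int[P]_w (diag_sum l lam w ^+ 3) = 8 * psum l lam 3 &
      \int[P]_w (diag_sum l lam w ^+ 4) =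
        48 * psum l lam 4 + 12 * psum l lam 2 ^+ 2].
Proof.
elim: l => [_|i l IH /= /andP[il ul]].
  have e w : diag_sum [::] lam w = 0 by rewrite /diag_sum big_nil.
  split=> [k _|].
    apply: (eq_intble (f := fun=> 0 ^+ k)); last exact: intble_cst.
    by move=> w; rewrite e.
  have E k : \int[P]_w (diag_sum [::] lam w ^+ k.+1) = 0.
    by rewrite -[RHS](Rint_cst P); apply: eq_Rint => w; rewrite e expr0n.
  rewrite /psum !big_nil !E expr0n !mulr0 addr0; split => //.
  by rewrite -[RHS](Rint_cst P); apply: eq_Rint => w; rewrite e.
have [IHi [I1 I2 I3 I4]] := IH ul.
set S := diag_sum l lam in IHi I1 I2 I3 I4 *.
pose y (x : R) := x ^+ 2 - 1.
pose a k (x : R) := y x ^+ k; pose b k (x : R) := x ^+ k.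
have ma k : measurable_fun [set: R] (a k) by apply: cont_meas; rewrite /a /y; contder.
have mb k : measurable_fun [set: R] (b k) by apply: cont_meas; rewrite /b; contder.
have ia k : intble gam (a k).
  apply: gauss_intble => //; apply: egrowthX; apply: egrowthD.
    by apply: egrowthX; exact: egrowth_id.
  exact: egrowth_cst.
have ib k : (k <= 4)%N -> intble P (b k \o S) by exact: IHi.
have ab p q : (q <= 4)%N -> intble P (fun w => a p (xi i w) * b q (S w)).
  by move=> q4; have [] := indep_mul il (ma p) (mb q) (ia p) (ib q q4).
have Eab p q : (q <= 4)%N -> \int[P]_w (a p (xi i w) * b q (S w)) =
    \int[gam]_x a p x * \int[P]_w b q (S w).
  by move=> q4; have [] := indep_mul il (ma p) (mb q) (ia p) (ib q q4).
have [A1 A2 A3 A4] := gauss_sqr_moments R.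
have A0 : \int[gam]_x a 0%N x = 1 by rewrite -[RHS](Rint_cst gam); apply: eq_Rint => x; rewrite /a expr0.
have A1' : \int[gam]_x a 1%N x = 0 by rewrite -[RHS]A1.
have B0 : \int[P]_w b 0%N (S w) = 1 by rewrite -[RHS](Rint_cst P); apply: eq_Rint => x; rewrite /b expr0.
have B1 : \int[P]_w b 1%N (S w) = 0 by rewrite -[RHS]I1.
have Se w : diag_sum (i :: l) lam w = lam i * y (xi i w) + S w.
  by rewrite /diag_sum big_cons.
have psE k : psum (i :: l) lam k = lam i ^+ k + psum l lam k by rewrite /psum big_cons.
pose L := lam i.
have binom k w : diag_sum (i :: l) lam w ^+ k =
    \sum_(p < k.+1) ('C(k, p)%:R * L ^+ (k - p)) * (a (k - p)%N (xi i w) * b p (S w)).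
  rewrite Se exprDn; apply: eq_bigr => p _; rewrite exprMn /a /b /L -mulr_natl.
  by ring.
have icomp k p : (p <= 4)%N -> intble P (fun w =>
    ('C(k, p)%:R * L ^+ (k - p)) * (a (k - p)%N (xi i w) * b p (S w))).
  by move=> p4; apply: intbleZ; exact: ab.
have int k : (k <= 4)%N -> intble P (fun w => diag_sum (i :: l) lam w ^+ k).
  move=> k4; apply: (eq_intble (fun w => esym (binom k w))).
  apply: (@intble_sum _ _ _ P 'I_k.+1) => p; apply: icomp.
  by rewrite (leq_trans _ k4)// -ltnS.
have E k : (k <= 4)%N -> \int[P]_w (diag_sum (i :: l) lam w ^+ k) =
    \sum_(p < k.+1) ('C(k, p)%:R * L ^+ (k - p)) *
      (\int[gam]_x a (k - p)%N x * \int[P]_w b p (S w)).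
  move=> k4; rewrite (eq_Rint _ (binom k)).
  have p4 (p : 'I_k.+1) : (p <= 4)%N by rewrite (leq_trans _ k4)// -ltnS.
  rewrite (@Rint_sum _ _ _ P 'I_k.+1); last by move=> p; exact: icomp.
  by apply: eq_bigr => p _; rewrite RintZ ?Eab//; exact: ab.
split => //; rewrite !psE -/L; split.
- have := E 1%N isT; rewrite !big_ord_recr big_ord0/=.
  rewrite (_ : \int[P]_w _ = \int[P]_w (diag_sum (i :: l) lam w))//.
  by rewrite A0 A1' B0 B1 => ->; ring.
- rewrite E// !big_ord_recr big_ord0/= !subnn ?subn0 /= A0 A1' A2 B0 B1 I2.
  by rewrite /= bin0 binn; ring.
- rewrite E// !big_ord_recr big_ord0/= !subnn ?subn0 /= A0 A1' A2 A3 B0 B1 I2 I3.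
  by rewrite /= bin0 binn; ring.
- rewrite E// !big_ord_recr big_ord0/= !subnn ?subn0 /= A0 A1' A2 A3 A4 B0 B1 I2 I3 I4.
  have -> : 'C(4, 2) = 6%N by [].
  by rewrite /= bin0 binn; ring.
Qed.

Variable lam : 'I_n -> R.
Notation Z := (diag_sum (index_enum 'I_n) lam).
Notation p k := (psum (index_enum 'I_n) lam k).

(** In Malliavin calculus this is half the squared norm of the derivative of Z. It
    plays the part of a random variance: Z satisfies the integration by parts
    formula of a normal variable whose variance is this function. *)
Definition carre_du_champ w := 2 * \sum_(j < n) lam j ^+ 2 * xi j w ^+ 2.
Notation Gam := carre_du_champ.

Lemma diag_intbleX k : (k <= 4)%N -> intble P (fun w => Z w ^+ k).
Proof. by have [+ _] := diag_moments lam (index_enum_uniq _); exact. Qed.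

Lemma diag_affine (a b : R) w : a * Z w + b - Gam w =
  diag_sum (index_enum 'I_n) (fun j => a * lam j - 2 * lam j ^+ 2) w +
  (b - 2 * p 2).
Proof.
have -> : diag_sum (index_enum 'I_n) (fun j => a * lam j - 2 * lam j ^+ 2) w =
    a * Z w - Gam w + 2 * p 2.
  rewrite /carre_du_champ /diag_sum /psum !mulr_sumr -sumrB -big_split/=.
  by apply: eq_bigr => j _; ring.
by ring.
Qed.

(** The discrepancy being diagonal up to a constant, only power sums of order 2, 3 and
    4 occur, which the moments of these orders determine: the reason why the
    convergence of a few moments suffices. *)
Lemma diag_discrepancy (a b : R) :
  intble P (fun w => (a * Z w + b - Gam w) ^+ 2) /\
  \int[P]_w ((a * Z w + b - Gam w) ^+ 2) =
    (b - 2 * p 2) ^+ 2 + 2 * a ^+ 2 * p 2 - 8 * a * p 3 + 8 * p 4.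
Proof.
pose mu j := a * lam j - 2 * lam j ^+ 2.
have [mi [m1 m2 _ _]] := diag_moments mu (index_enum_uniq _).
set c := b - 2 * p 2; set D := diag_sum (index_enum 'I_n) mu in mi m1 m2.
have E w : (a * Z w + b - Gam w) ^+ 2 = D w ^+ 2 + (2 * c * D w + c ^+ 2).
  by rewrite diag_affine -/D -/c; ring.
have i2 : intble P (fun w => D w ^+ 2) by exact: mi.
have i1 : intble P D by apply: (eq_intble _ (mi 1%N isT)) => w; rewrite expr1.
have j1 : intble P (fun w => 2 * c * D w) by exact: intbleZ.
have j2 := intbleD j1 (intble_cst P (c ^+ 2)).
split; first by apply: (eq_intble (fun w => esym (E w))); exact: intbleD.
rewrite (eq_Rint _ E) RintD// RintD//; last exact: intble_cst.
rewrite RintZ// Rint_cst m1 m2 mulr0 add0r.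
have -> : psum (index_enum 'I_n) mu 2 = a ^+ 2 * p 2 - 4 * a * p 3 + 4 * p 4.
  rewrite /psum !mulr_sumr -sumrB -big_split/=.
  by apply: eq_bigr => j _; rewrite /mu; ring.
by rewrite /c; ring.
Qed.

Let Y i w := xi i w ^+ 2 - 1.

Let Ysqr_intble i : intble P (fun w => Y i w ^+ 2).
Proof.
have [mi _] := @diag_moments [:: i] (fun=> 1) isT.
apply: (eq_intble _ (mi 2%N isT)) => w.
by rewrite /diag_sum big_seq1 mul1r.
Qed.

Let mY i : measurable_fun setT (Y i).
Proof.
by apply: measurable_funB => //; exact: measurable_funX.
Qed.

Let mZ : measurable_fun setT Z. Proof. exact: measurable_diag_sum. Qed.

Variables (f f' : R -> R) (M : R).
Hypotheses (df : forall x : R, is_derive x 1 f (f' x)) (cf' : continuous f')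
  (f'M : forall x, `|f' x| <= M).

Let cf : continuous f. Proof. by move=> x; exact: der_cvg. Qed.
Let mf : measurable_fun [set: R] f. Proof. exact: cont_meas. Qed.
Let mf' : measurable_fun [set: R] f'. Proof. exact: cont_meas. Qed.

Let f_lin x : `|f x| <= `|f 0| + `|M| * `|x|.
Proof. exact: lipschitz_affine (mvt_lip df f'M) x. Qed.

Let Yf_intble i : intble P (fun w => Y i w * f (Z w)).
Proof.
have m1 : measurable_fun setT (fun w => Y i w * f (Z w)).
  by apply: measurable_funM => //; exact: measurableT_comp.
have i1 : intble P (fun w => Y i w ^+ 2 + (2 * `|f 0| ^+ 2 + 2 * M ^+ 2 * Z w ^+ 2)).
  apply: intbleD; first exact: Ysqr_intble.
  apply: intbleD; first exact: intble_cst.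
  by apply: intbleZ; exact: diag_intbleX.
apply: (intble_le m1 _ i1) => w; rewrite normrM.
have := f_lin (Z w); rewrite -(real_normK (num_real (Y i w))).
rewrite -(real_normK (num_real (Z w))) -(real_normK (num_real M)).
move: (`|Y i w|) (`|f (Z w)|) (normr_ge0 (Y i w)) (normr_ge0 (f (Z w))).
move: `|f 0| (`|M|) (`|Z w|) (normr_ge0 (f 0)) (normr_ge0 M) (normr_ge0 (Z w)).
move=> A B C A0 B0 C0 y g y0 g0 h.
have h2 : g ^+ 2 <= (A + B * C) ^+ 2 by rewrite ler_pXn2r ?nnegrE// addr_ge0// mulr_ge0.
have := sqr_ge0 (A - B * C); have := sqr_ge0 (y - g).
have -> : 2 * B ^+ 2 * C ^+ 2 = 2 * (B * C) ^+ 2 by ring.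
by move: (B * C) h2 => D; nra.
Qed.

Let xf_intble i : intble P (fun w => 2 * lam i * xi i w ^+ 2 * f' (Z w)).
Proof.
have i0 : intble P (fun w => M * (2 * `|lam i| * (Y i w ^+ 2 + 2))).
  by do 2 apply: intbleZ; apply: intbleD => //; exact: intble_cst.
have m1 : measurable_fun setT (fun w => 2 * lam i * xi i w ^+ 2 * f' (Z w)).
  apply: measurable_funM; last exact: measurableT_comp.
  by apply: measurable_funM => //; exact: measurable_funX.
apply: (intble_le m1 _ i0) => w.
rewrite normrM mulrC; apply: ler_pM => //.
rewrite normrM; apply: ler_pM => //; first by rewrite normrM normr_nat.
rewrite ger0_norm ?sqr_ge0// /Y.
by have := sqr_ge0 (xi i w ^+ 2 - 1 - 2^-1); nra.
Qed.

Let YfE i : \int[P]_w (Y i w * f (Z w)) =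
  \int[P]_w (2 * lam i * xi i w ^+ 2 * f' (Z w)).
Proof.
pose l := rem i (index_enum 'I_n).
have il : i \notin l by rewrite /l mem_rem_uniq ?index_enum_uniq// inE eqxx.
have ZE w : Z w = lam i * (xi i w ^+ 2 - 1) + diag_sum l lam w.
  by rewrite /diag_sum /l (big_rem i (mem_index_enum i)).
pose g (v : R * R) := (v.1 ^+ 2 - 1) * f (lam i * (v.1 ^+ 2 - 1) + v.2).
pose g' (v : R * R) := 2 * lam i * v.1 ^+ 2 * f' (lam i * (v.1 ^+ 2 - 1) + v.2).
have mq : measurable_fun setT (fun v : R * R => lam i * (v.1 ^+ 2 - 1) + v.2).
  apply: measurable_funD => //.
  exact: (measurableT_comp (measurable_sqr1 (lam i)) measurable_fst).
have mg : measurable_fun setT g.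
  apply: measurable_funM; last exact: measurableT_comp.
  by apply: measurable_funB => //; exact: measurable_funX.
have mg' : measurable_fun setT g'.
  apply: measurable_funM; last exact: measurableT_comp.
  by apply: measurable_funM => //; exact: measurable_funX.
have gE w : Y i w * f (Z w) = g (xi i w, diag_sum l lam w) by rewrite /g ZE.
have g'E w : 2 * lam i * xi i w ^+ 2 * f' (Z w) = g' (xi i w, diag_sum l lam w).
  by rewrite /g' ZE.
rewrite (eq_Rint _ gE) (eq_Rint _ g'E).
have cq s : continuous (fun x : R => lam i * (x ^+ 2 - 1) + s) by contder.
have X2 : egrowth (fun x : R => x ^+ 2) by apply: egrowthX; exact: egrowth_id.
have qg s : egrowth (fun x : R => lam i * (x ^+ 2 - 1) + s).
  apply: egrowthD; last exact: egrowth_cst.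
  apply: egrowthM; first exact: egrowth_cst.
  by apply: egrowthD => //; exact: egrowth_cst.
have gsec s : intble gam (fun x => g (x, s)).
  apply: gauss_intble; first exact: (measurableT_comp mg (pair2_measurable s)).
  apply: egrowthM; first by apply: egrowthD => //; exact: egrowth_cst.
  exact: (egrowth_lip_comp (mvt_lip df f'M) (qg s)).
have g'sec s : intble gam (fun x => g' (x, s)).
  apply: gauss_intble; first exact: (measurableT_comp mg' (pair2_measurable s)).
  apply: egrowthM; first by apply: egrowthM => //; exact: egrowth_cst.
  by apply: (@egrowth_bounded _ _ M) => x.
have ig : intble P (fun w => g (xi i w, diag_sum l lam w)).
  exact: (eq_intble gE (Yf_intble i)).
have ig' : intble P (fun w => g' (xi i w, diag_sum l lam w)).
  exact: (eq_intble g'E (xf_intble i)).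
rewrite (indep_Rint il mg gsec ig) (indep_Rint il mg' g'sec ig').
by apply: eq_Rint => w; exact: (gauss_stein_sqr _ _ df cf' f'M).
Qed.

(** Gaussian integration by parts in each coordinate, the others being frozen by
    independence; the i-th coordinate contributes 2 (lam i)^2 xi_i^2 f'(Z). *)
Lemma diag_stein : intble P (fun w => Z w * f (Z w)) /\
  \int[P]_w (Z w * f (Z w)) = \int[P]_w (Gam w * f' (Z w)).
Proof.
have E1 w : Z w * f (Z w) = \sum_(i < n) lam i * (Y i w * f (Z w)).
  by rewrite {1}/diag_sum mulr_suml; apply: eq_bigr => i _; rewrite mulrA.
have i1 : intble P (fun w => \sum_(i < n) lam i * (Y i w * f (Z w))).
  by apply: (@intble_sum _ _ _ P 'I_n) => i; exact: intbleZ.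
split; first by apply: (eq_intble (fun w => esym (E1 w))).
have E2 w : Gam w * f' (Z w) =
    \sum_(i < n) lam i * (2 * lam i * xi i w ^+ 2 * f' (Z w)).
  by rewrite /carre_du_champ mulr_sumr mulr_suml; apply: eq_bigr => i _; ring.
rewrite (eq_Rint _ E1) (eq_Rint _ E2).
have i2 := xf_intble.
rewrite (@Rint_sum _ _ _ P 'I_n); last by move=> i; exact: intbleZ.
rewrite (@Rint_sum _ _ _ P 'I_n); last by move=> i; exact: intbleZ.
by apply: eq_bigr => i _; rewrite !RintZ// YfE.
Qed.

(** By diag_stein the left-hand side is the integral of (a Z + b - Gam) f'(Z), and the
    radicand is the second moment of a Z + b - Gam expressed through the moments of
    Z. *)
Lemma diag_stein_bound (a b : R) (m2 := \int[P]_w (Z w ^+ 2))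
    (m3 := \int[P]_w (Z w ^+ 3)) (m4 := \int[P]_w (Z w ^+ 4)) :
  `|\int[P]_w ((a * Z w + b) * f' (Z w) - Z w * f (Z w))| <=
  M * Num.sqrt ((b - m2) ^+ 2 + a ^+ 2 * m2 - a * m3 + (m4 - 3 * m2 ^+ 2) / 6).
Proof.
have [Zi [_ Z2 Z3 Z4]] := diag_moments lam (index_enum_uniq _).
have [Di DE] := diag_discrepancy a b.
have [ZfE_i ZfE] := diag_stein.
rewrite (_ : (b - m2) ^+ 2 + _ - _ + _ = \int[P]_w ((a * Z w + b - Gam w) ^+ 2)); last first.
  by rewrite DE /m2 /m3 /m4 Z2 Z3 Z4; field.
have mG : measurable_fun setT Gam.
  apply: measurable_funM => //; apply: measurable_sum => j.
  by apply: measurable_funM => //; exact: measurable_funX.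
have mD : measurable_fun setT (fun w => a * Z w + b - Gam w).
  apply: measurable_funB => //; apply: measurable_funD => //.
  exact: measurable_funM.
have mfZ : measurable_fun setT (fun w => f' (Z w)) by exact: measurableT_comp.
have D1 : intble P (fun w => a * Z w + b - Gam w).
  apply: (intble_le mD _ (intbleD (intble_cst P 1) Di)) => w.
  rewrite -(real_normK (num_real (a * Z w + b - Gam w))); set A := `|_|.
  by have := sqr_ge0 (A - 1); rewrite sqrrB1; nra.
have Df : intble P (fun w => (a * Z w + b - Gam w) * f' (Z w)).
  have := intbleZr M (intble_norm D1); apply: intble_le.
    exact: measurable_funM.
  by move=> w; rewrite normrM ler_wpM2l.
have Zai : intble P (fun w => a * Z w + b).
  apply: intbleD; last exact: intble_cst.
  by apply: intbleZ; apply: (eq_intble _ (Zi 1%N isT)) => w; rewrite expr1.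
have mZa : measurable_fun setT (fun w => a * Z w + b).
  by apply: measurable_funD => //; exact: measurable_funM.
have Zaf : intble P (fun w => (a * Z w + b) * f' (Z w)).
  have := intbleZr M (intble_norm Zai); apply: intble_le.
    exact: measurable_funM.
  by move=> w; rewrite normrM ler_wpM2l.
have Gf : intble P (fun w => Gam w * f' (Z w)).
  by apply: (eq_intble _ (intbleB Zaf Df)) => w; ring.
have M0 : 0 <= M by apply: le_trans (f'M 0).
rewrite RintB// ZfE -RintB//.
rewrite (eq_Rint _ (g := fun w => (a * Z w + b - Gam w) * f' (Z w))); last first.
  by move=> w; ring.
apply: (@le_trans _ _ (\int[P]_w (M * `|a * Z w + b - Gam w|))).
  apply: Rint_abs_le; [exact: intbleZ (intble_norm D1)|exact: measurable_funM|].
  by move=> w; rewrite normrM mulrC ler_wpM2r.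
rewrite RintZ; last exact: intble_norm.
by rewrite ler_wpM2l//; exact: Rint_abs_le_sqrt.
Qed.

End diagonal_chaos.

(** * Diagonalization of symmetric tensors *)

Section real_spectral.
Import complex.
Context (R : realType).

(** The characteristic polynomial of a real symmetric matrix has a complex root,
    which is real because the matrix is Hermitian. *)
Lemma symmetric_eigenvalue n (A : 'M[R]_n.+1) : A^T = A ->
  exists a : R, eigenvalue A a.
Proof.
move=> symA; pose C : numClosedFieldType := R[i].
pose io : {rmorphism R -> C} := real_complex R.
pose A' : 'M[C]_n.+1 := map_mx io A.
have hA' : A' \is hermsymmx.
  apply: realsym_hermsym.
    apply/is_hermitianmxP; rewrite expr0 scale1r map_mx_id//.
    by apply/matrixP => i j; rewrite !mxE -{1}symA mxE.
  apply/mxOverP => i j; rewrite mxE; apply/complex_realP; by exists (A i j).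
have /hermitian_normalmx /orthomx_spectralP := hA'.
set U := spectralmx A'; set D := spectral_diag A' => E.
have Uu : U \in unitmx by exact: spectral_unit.
have rD : D 0 0 \is Num.real.
  by have /mxOverP := hermitian_spectral_diag_real hA'; apply.
have [a aE] : exists k : R, D 0 0 = io k by apply/complex_realP.
exists a; rewrite eigenvalue_root_char -(fmorph_root io) map_char_poly -aE.
rewrite -eigenvalue_root_char; apply/eigenvalueP; exists (row 0 U).
  rewrite -row_mul -/A' E !mulmxA mulmxV// mul1mx row_mul.
  by rewrite row_diag_mx -scalemxAl -rowE.
by rewrite rowE; apply/eqP => h; have := row_free_unit U; rewrite Uu => /row_free_inj;
  move=> /(_ 1%N (delta_mx 0 0) 0); rewrite h mul0mx => /(_ erefl) /matrixP /(_ 0 0);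
  rewrite !mxE !eqxx => /eqP; rewrite oner_eq0.
Qed.

End real_spectral.

Section orthogonal_diagonalization.
Context (R : realType).

Lemma mx11_ext (A B : 'M[R]_1) : A 0 0 = B 0 0 -> A = B.
Proof. by move=> h; apply/matrixP => i j; rewrite !ord1. Qed.

Lemma rV_sqr_gt0 n (v : 'rV[R]_n) : v != 0 -> 0 < (v *m v^T) 0 0.
Proof.
move=> v0; rewrite mxE lt_neqAle; apply/andP; split; last first.
  by apply: sumr_ge0 => j _; rewrite mxE -expr2 sqr_ge0.
rewrite eq_sym; apply: contra v0 => /eqP h; apply/eqP/rowP => j.
have pos i : true -> 0 <= v 0 i * v^T i 0 by move=> _; rewrite mxE -expr2 sqr_ge0.
have := psumr_eq0P pos h; move=> /(_ j isT)/eqP.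
by rewrite mxE mulf_eq0 orbb mxE => /eqP.
Qed.

(** The reflection exchanging v and the first basis vector e, that is, the one in
    the hyperplane orthogonal to v - e. *)
Lemma householder n (v : 'rV[R]_n.+1) : v *m v^T = 1%:M ->
  exists Q : 'M[R]_n.+1, [/\ Q^T = Q, Q *m Q = 1%:M & delta_mx 0 0 *m Q = v].
Proof.
move=> v1; pose e : 'rV[R]_n.+1 := delta_mx 0 0; pose u := v - e.
have e1 : e *m e^T = 1%:M.
  by apply: mx11_ext; rewrite trmx_delta mul_delta_mx !mxE.
have ev : e *m v^T = (v 0 0)%:M.
  by apply: mx11_ext; rewrite -rowE !mxE mulr1n.
have ve : v *m e^T = (v 0 0)%:M by rewrite -[LHS]trmxK trmx_mul trmxK ev tr_scalar_mx.
have [u0|u0] := eqVneq u 0.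
  exists 1%:M; rewrite trmx1 !mulmx1; split => //.
  by apply/esym/eqP; rewrite -subr_eq0 -/u u0.
pose c := 2 - 2 * v 0 0.
have uu : u *m u^T = c%:M.
  rewrite /u linearB/= mulmxBl !mulmxBr v1 ve ev e1.
  by apply: mx11_ext; rewrite !mxE /= !mulr1n /c; ring.
have c0 : c != 0.
  by have := rV_sqr_gt0 u0; rewrite uu mxE eqxx mulr1n => /lt0r_neq0.
exists (1%:M - (2 / c) *: (u^T *m u)); split.
- by rewrite linearB/= trmx1 linearZ/= trmx_mul trmxK.
- pose N := (2 / c) *: (u^T *m u).
  have NN : N *m N = N + N.
    rewrite /N -scalemxAl -scalemxAr mulmxA -(mulmxA _ u) uu mul_mx_scalar.
    rewrite -scalemxAl !scalerA -scalerDl; congr (_ *: _); by field.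
  rewrite -/N mulmxBl mul1mx (mulmxBr N) mulmx1 NN.
  by apply/matrixP => i j; rewrite !mxE; ring.
rewrite -/e mulmxBr mulmx1 -scalemxAr mulmxA.
have -> : e *m u^T = (v 0 0 - 1)%:M.
  rewrite /u linearB/= mulmxBr ev e1.
  by apply: mx11_ext; rewrite !mxE /= !mulr1n.
rewrite mul_scalar_mx scalerA (_ : 2 / c * _ = -1); last by rewrite /c; field.
by rewrite scaleN1r opprK /u addrC subrK.
Qed.

Lemma symmetric_unit_eigenvector n (A : 'M[R]_n.+1) : A^T = A ->
  exists (a : R) (v : 'rV[R]_n.+1), v *m A = a *: v /\ v *m v^T = 1%:M.
Proof.
move=> /symmetric_eigenvalue[a /eigenvalueP[v vA v0]].
have p := rV_sqr_gt0 v0; set s := (v *m v^T) 0 0 in p.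
exists a, ((Num.sqrt s)^-1 *: v); split.
  by rewrite -scalemxAl vA !scalerA mulrC.
rewrite linearZ/= -scalemxAl -scalemxAr scalerA; apply: mx11_ext.
rewrite mxE -/s -invfM -expr2 sqr_sqrtr; last exact: ltW.
by rewrite mulVf ?mxE// gt_eqF.
Qed.

(** A reflection maps a unit eigenvector to the first basis vector; by symmetry the
    conjugated matrix is block diagonal, and the second block is handled by
    induction. The spectral theorem over the complex numbers only provides unitary
    matrices, whereas tensors over a real space need orthogonal ones. *)
Lemma symmetric_diagonalizable n (A : 'M[R]_n) : A^T = A ->
  exists (Q : 'M[R]_n) (l : 'rV[R]_n), Q *m Q^T = 1%:M /\ A = Q^T *m diag_mx l *m Q.
Proof.
elim: n A => [|n IH] A symA.
  by exists 1%:M, 0; split; [rewrite trmx1 mulmx1|rewrite [LHS]flatmx0 [RHS]flatmx0].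
have [a [v [vA v1]]] := symmetric_unit_eigenvector symA.
have [Q [Qs QQ eQ]] := householder v1.
have [B BQ] : exists B : 'M[R]_(1 + n), B = Q *m A *m Q by eexists.
have Bs : B^T = B by rewrite BQ !trmx_mul Qs symA mulmxA.
have eB : delta_mx 0 0 *m B = a *: delta_mx 0 0 :> 'rV[R]_(1 + n).
  rewrite BQ !mulmxA eQ vA -scalemxAl -eQ -mulmxA QQ mulmx1//.
have row0B : row 0 B = a *: delta_mx 0 0 by rewrite rowE.
have ul : ulsubmx B = a%:M.
  apply: mx11_ext; rewrite !mxE; move/rowP/(_ 0): row0B; rewrite !mxE.
  rewrite !eqxx mulr1n mulr1 => <-; congr (B _ _); exact: val_inj.
have ur : ursubmx B = 0.
  apply/matrixP => i j; rewrite !mxE; move/rowP/(_ (rshift 1 j)): row0B.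
  by rewrite !mxE eqxx/= mulr0 => <-; congr (B _ _); apply: val_inj; rewrite /= ord1.
have dl : dlsubmx B = 0 by rewrite -[B]Bs -trmx_ursub ur trmx0.
have [K0 [l [OO dE]]] : exists (K0 : 'M[R]_n) (l : 'rV[R]_n),
    K0 *m K0^T = 1%:M /\ drsubmx B = K0^T *m diag_mx l *m K0.
  by apply: IH; rewrite trmx_drsub Bs.
have BE : B = block_mx a%:M 0 0 (K0^T *m diag_mx l *m K0).
  by rewrite -[LHS]submxK ul ur dl dE.
pose K : 'M[R]_(1 + n) := block_mx 1%:M 0 0 K0.
pose L : 'rV[R]_(1 + n) := row_mx a%:M l.
have KK : K *m K^T = 1%:M.
  rewrite /K tr_block_mx !trmx0 trmx1 mulmx_block !mulmx0 !mul0mx mulmx1 OO.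
  by rewrite !addr0 add0r -scalar_mx_block.
have KB : B = K^T *m diag_mx L *m K.
  rewrite BE /K /L tr_block_mx !trmx0 trmx1 diag_mx_row.
  rewrite !mulmx_block ?(mulmx0, mul0mx, addr0, add0r, mulmx1, mul1mx).
  rewrite ?(mulmx0, mul0mx, addr0, add0r, mulmx1, mul1mx).
  by congr block_mx; apply: mx11_ext; rewrite !mxE.
exists (K *m Q), L; split.
  by rewrite trmx_mul Qs mulmxA -(mulmxA K) QQ mulmx1.
transitivity (Q *m B *m Q).
  by rewrite BQ !mulmxA QQ mul1mx -mulmxA QQ mulmx1.
by rewrite KB trmx_mul Qs !mulmxA.
Qed.

End orthogonal_diagonalization.

Section orthonormal_families.
Context (R : realType) (H : completeNormedModType R).
Variable dotH : {dot H for @idfun R}.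
Hypothesis dotHP : hilbert_dot dotH.

Definition orthonormal_family n (e : 'I_n -> H) :=
  forall i j, dotH (e i) (e j) = (i == j)%:R.

Lemma dot_sym x y : dotH x y = dotH y x.
Proof. by rewrite hermC/= expr0 mul1r. Qed.

Lemma dot_suml (I : Type) (r : seq I) (F : I -> H) y :
  dotH (\sum_(i <- r) F i) y = \sum_(i <- r) dotH (F i) y.
Proof.
elim: r => [|i r IH]; first by rewrite !big_nil linear0l.
by rewrite !big_cons -IH; exact: linearDl.
Qed.

Lemma dotZl a x y : dotH (a *: x) y = a * dotH x y.
Proof. by rewrite linearZl_LR. Qed.

Lemma dotZr a x y : dotH x (a *: y) = a * dotH x y.
Proof. by rewrite dot_sym dotZl dot_sym. Qed.

Lemma dot_sumr (I : Type) (r : seq I) (F : I -> H) y :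
  dotH y (\sum_(i <- r) F i) = \sum_(i <- r) dotH y (F i).
Proof. by rewrite dot_sym dot_suml; apply: eq_bigr => i _; rewrite dot_sym. Qed.

Lemma orthonormal_combination n m (e : 'I_n -> H) (Q : 'M[R]_(m, n)) :
  orthonormal_family e -> Q *m Q^T = 1%:M ->
  orthonormal_family (fun r : 'I_m => \sum_(p < n) Q r p *: e p).
Proof.
move=> oe QQ r s; rewrite dot_suml.
have /matrixP/(_ r s) := QQ; rewrite !mxE => <-; apply: eq_bigr => p _.
rewrite dotZl dot_sumr (bigD1 p)//= big1 => [|q qp].
  by rewrite addr0 dotZr oe eqxx mulr1 mxE.
by rewrite dotZr oe eq_sym (negbTE qp) mulr0.
Qed.

Lemma gram_schmidt (s : seq H) : exists (m : nat) (e : 'I_m -> H),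
  orthonormal_family e /\ forall g, g \in s -> exists c : 'I_m -> R, g = \sum_(i < m) c i *: e i.
Proof.
elim: s => [|g s [m [e [oe es]]]].
  by exists 0%N, (fun=> 0); split => // -[].
pose r := g - \sum_(i < m) dotH g (e i) *: e i.
have re j : dotH r (e j) = 0.
  rewrite /r linearBl/= dot_suml (bigD1 j)//= big1 => [|i ij].
    by rewrite dotZl oe eqxx mulr1 addr0 subrr.
  by rewrite dotZl oe (negbTE ij) mulr0.
have gE : g = r + \sum_(i < m) dotH g (e i) *: e i by rewrite /r subrK.
have [r0|r0] := eqVneq r 0.
  exists m, e; split => // h; rewrite inE => /predU1P[->|]; last exact: es.
  by exists (fun i => dotH g (e i)); rewrite {1}gE r0 add0r.
pose u := `|r|^-1 *: r.
have nr0 : `|r| != 0 by rewrite normr_eq0.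
have uu : dotH u u = 1.
  by rewrite /u dotZl dotZr dotHP; field.
have ue j : dotH u (e j) = 0 by rewrite /u dotZl re mulr0.
pose e' (k : 'I_m.+1) : H := if unlift ord_max k is Some i then e i else u.
have e'l i : e' (widen_ord (leqnSn m) i) = e i.
  rewrite /e' (_ : widen_ord _ _ = lift ord_max i) ?liftK//.
  by apply: val_inj => /=; rewrite /bump leqNgt ltn_ord.
have e'm : e' ord_max = u by rewrite /e' unlift_none.
exists m.+1, e'; split.
  move=> i j; rewrite /e'.
  case: (unliftP ord_max i) => [i'|] ->; case: (unliftP ord_max j) => [j'|] ->.
  - by rewrite oe (inj_eq lift_inj).
  - by rewrite dot_sym ue eq_sym (negbTE (neq_lift _ _)).
  - by rewrite ue (negbTE (neq_lift _ _)).
  - by rewrite uu eqxx.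
move=> h; rewrite inE => /predU1P[->|hs].
  exists (fun k => if unlift ord_max k is Some i then dotH g (e i) else `|r|).
  rewrite big_ord_recr/= e'm unlift_none {1}gE [RHS]addrC; congr (_ + _).
    by rewrite /u scalerA mulfV ?scale1r.
  apply: eq_bigr => i _; rewrite e'l; congr (_ *: _).
  rewrite (_ : widen_ord _ _ = lift ord_max i) ?liftK//.
  by apply: val_inj => /=; rewrite /bump leqNgt ltn_ord.
have [c ->] := es h hs.
exists (fun k => if unlift ord_max k is Some i then c i else 0).
rewrite big_ord_recr/= unlift_none scale0r addr0; apply: eq_bigr => i _.
rewrite e'l (_ : widen_ord _ _ = lift ord_max i) ?liftK//.
by apply: val_inj => /=; rewrite /bump leqNgt ltn_ord.
Qed.

Variables (T : completeNormedModType R) (tens : {bilinear H -> H -> T}).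

Lemma tens_suml (I : Type) (r : seq I) (F : I -> H) y :
  tens (\sum_(i <- r) F i) y = \sum_(i <- r) tens (F i) y.
Proof.
elim: r => [|i r IH]; first by rewrite !big_nil linear0l.
by rewrite !big_cons linearDl IH.
Qed.

Lemma tens_sumr (I : Type) (r : seq I) (F : I -> H) y :
  tens y (\sum_(i <- r) F i) = \sum_(i <- r) tens y (F i).
Proof. by rewrite linear_sumr. Qed.

Lemma tens_combination n (e : 'I_n -> H) (c c' : 'I_n -> R) :
  tens (\sum_(i < n) c i *: e i) (\sum_(i < n) c' i *: e i) =
  \sum_(i < n) \sum_(j < n) (c i * c' j) *: tens (e i) (e j).
Proof.
rewrite tens_suml; apply: eq_bigr => i _; rewrite tens_sumr.
by apply: eq_bigr => j _; rewrite linearZl_LR linearZr_LR/= scalerA.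
Qed.

(** A finite sum of symmetrized elementary tensors is a quadratic form in a finite
    orthonormal family, hence diagonal in another one. *)
Lemma diagonal_tensor n (h k : 'I_n -> H) :
  exists (m : nat) (e : 'I_m -> H) (l : 'I_m -> R), orthonormal_family e /\
    \sum_(i < n) (tens (h i) (k i) + tens (k i) (h i)) =
    \sum_(r < m) l r *: tens (e r) (e r).
Proof.
have [m [e [oe es]]] := gram_schmidt (codom h ++ codom k).
have hB i : exists c : 'I_m -> R, h i = \sum_(p < m) c p *: e p.
  by apply: es; rewrite mem_cat codom_f.
have kB i : exists c : 'I_m -> R, k i = \sum_(p < m) c p *: e p.
  by apply: es; rewrite mem_cat codom_f orbT.
have [B BE] := choice hB; have [C CE] := choice kB.
pose A : 'M[R]_m := \matrix_(p, q) \sum_(i < n) (B i p * C i q + C i p * B i q).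
have symA : A^T = A.
  by apply/matrixP => p q; rewrite !mxE; apply: eq_bigr => i _; ring.
(* A is the matrix of the quadratic form in the family e. *)
have [Q [l [QQ AE]]] := symmetric_diagonalizable symA.
exists m, (fun r => \sum_(p < m) Q r p *: e p), (fun r => l 0 r); split.
  exact: orthonormal_combination.
transitivity (\sum_(p < m) \sum_(q < m) A p q *: tens (e p) (e q)).
  transitivity (\sum_(i < n) \sum_(p < m) \sum_(q < m)
      (B i p * C i q + C i p * B i q) *: tens (e p) (e q)).
    apply: eq_bigr => i _; rewrite BE CE !tens_combination -big_split/=.
    apply: eq_bigr => p _; rewrite -big_split/=; apply: eq_bigr => q _.
    by rewrite scalerDl.
  rewrite exchange_big/=; apply: eq_bigr => p _; rewrite exchange_big/=.
  by apply: eq_bigr => q _; rewrite -scaler_suml mxE.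
transitivity (\sum_(r < m) \sum_(p < m) \sum_(q < m)
    (l 0 r * (Q r p * Q r q)) *: tens (e p) (e q)).
  rewrite [RHS]exchange_big/=; apply: eq_bigr => p _; rewrite [RHS]exchange_big/=.
  apply: eq_bigr => q _; rewrite -scaler_suml; congr (_ *: _).
  rewrite AE mxE; apply: eq_bigr => r _.
  rewrite mul_mx_diag !mxE; ring.
apply: eq_bigr => r _; rewrite tens_combination scaler_sumr; apply: eq_bigr => p _.
by rewrite scaler_sumr; apply: eq_bigr => q _; rewrite scalerA.
Qed.

End orthonormal_families.

(** * Gaussian coordinates of an isonormal process *)

Section law_transfer.
Context (R : realType) d (W : measurableType d) (P : probability W R).
Variables (U : W -> R) (m : {measure set (measurableTypeR R) -> \bar R}).
Hypotheses (mU : measurable_fun setT U) (lawU : has_law P U m).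

Lemma law_Rint (f : R -> R) : measurable_fun [set: R] f ->
  \int[P]_w f (U w) = \int[m]_x f x.
Proof.
move=> mf; apply: (@same_law_Rint _ W _ (measurableTypeR R) _ (measurableTypeR R)
  R P m U idfun mU _ lawU f mf).
exact: measurable_id.
Qed.

Lemma law_intble (f : R -> R) : measurable_fun [set: R] f ->
  intble m f -> intble P (fun w => f (U w)).
Proof.
move=> mf; apply: (@same_law_intble _ (measurableTypeR R) _ W _ (measurableTypeR R)
  R m P idfun U _ mU _ f mf).
  exact: measurable_id.
by move=> B mB; exact/esym/lawU.
Qed.

End law_transfer.

Section gaussian_coordinates.
Context (R : realType) d (W : measurableType d) (P : probability W R).

Lemma measurable_shift_cos (t c : R) : measurable_fun [set: R] (fun x : R => cos (t * x + c)).
Proof. by apply: cont_meas; contder. Qed.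

Lemma measurable_sqr : measurable_fun [set: R] (fun x : R => x ^+ 2).
Proof. by apply: cont_meas; contder. Qed.

(** The degenerate law s = 0, a Dirac mass, obeys the same formulas. *)
Lemma gaussian_sqr_cos (U : W -> R) (s : R) : measurable_fun setT U ->
  has_law P U (centered_gaussian s) ->
  [/\ intble P (fun w => U w ^+ 2), \int[P]_w (U w ^+ 2) = s ^+ 2 &
   forall c, \int[P]_w cos (U w + c) = expR (- s ^+ 2 / 2) * cos c].
Proof.
move=> mU; rewrite /centered_gaussian; case: ifPn => [/eqP s0|s0] lawU.
  pose D : {measure set (measurableTypeR R) -> \bar R} := @dirac _ (measurableTypeR R) 0 R.
  have lD : has_law P U D by exact: lawU.
  have DR (f : R -> R) : measurable_fun [set: R] f -> \int[D]_x f x = f 0.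
    move=> mf; rewrite /Rintegral integral_dirac//; last exact/measurable_EFinP.
    by rewrite diracT mul1e.
  split.
  - apply: (law_intble mU lD measurable_sqr).
    apply: ge0_intble => [|x|]; [exact: measurable_sqr|exact: sqr_ge0|].
    rewrite integral_dirac//; last by apply/measurable_EFinP; exact: measurable_sqr.
    by rewrite diracT mul1e ltry.
  - by rewrite (law_Rint mU lD measurable_sqr) DR ?s0//; exact: measurable_sqr.
  - move=> c; have h : \int[P]_w cos (U w + c) = \int[P]_w cos (1 * U w + c).
      by apply: eq_Rint => w; rewrite mul1r.
    rewrite h (law_Rint mU lD (measurable_shift_cos 1 c)) DR; last exact: measurable_shift_cos.
    by rewrite s0 expr0n/= mulr0 oppr0 mul0r expR0 mul1r add0r.
pose N : {measure set (measurableTypeR R) -> \bar R} := normal_prob (0 : R) s.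
have lN : has_law P U N by exact: lawU.
split.
- apply: (law_intble mU lN measurable_sqr).
  apply: (@egrowth_intble R 0 s s0 _ measurable_sqr).
  by apply: egrowthX; exact: egrowth_id.
- rewrite (law_Rint mU lN measurable_sqr) -(normal_mean_sqr 0 s0).
  by apply: eq_Rint => x; rewrite subr0.
- move=> c; have h : \int[P]_w cos (U w + c) = \int[P]_w cos (1 * U w + c).
    by apply: eq_Rint => w; rewrite mul1r.
  by rewrite h (law_Rint mU lN (measurable_shift_cos 1 c)) normal_cos// mulr1.
Qed.

Context (H : completeNormedModType R) (dotH : {dot H for @idfun R}).
Variable X : H -> {RV P >-> R}.
Hypothesis XP : isonormal dotH X.

Lemma isonormal_intble_prod (h g : H) : intble P (fun w => X h w * X g w).
Proof.
have sq k : intble P (fun w => X k w ^+ 2).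
  have [s hs] := XP.1 1%N (fun=> 1) (fun=> k).
  have hs' : has_law P (X k) (centered_gaussian s).
    move=> B mB; rewrite -(hs B mB); congr (P _); apply/seteqP; split => w /=;
    by rewrite big_ord1 mul1r.
  by have [] := gaussian_sqr_cos (measurable_funPT (X k)) hs'.
apply: (intble_le _ _ (intbleD (sq h) (sq g))).
  exact: measurable_funM.
move=> w; rewrite normrM -(real_normK (num_real (X h w))).
rewrite -(real_normK (num_real (X g w))).
have := sqr_ge0 (`|X h w| - `|X g w|); have := normr_ge0 (X h w).
have := normr_ge0 (X g w); nra.
Qed.

Lemma isonormal_cov (h g : H) : \int[P]_w (X h w * X g w) = dotH h g.
Proof.
have /(congr1 fine) /= <- := XP.2 h g.
by rewrite unlock.
Qed.

(** Along an orthonormal family the process is a standard normal vector: every linear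
    combination is centered normal, and the covariances compute its variance. *)
Lemma isonormal_cos n (e : 'I_n -> H) : orthonormal_family dotH e ->
  forall (t : 'I_n -> R) (c : R),
  \int[P]_w cos (\sum_(j < n) t j * X (e j) w + c) =
  expR (- (\sum_(j < n) t j ^+ 2) / 2) * cos c.
Proof.
move=> oe t c; have [s hs] := XP.1 n t e.
have mU : measurable_fun setT (fun w => \sum_(j < n) t j * X (e j) w).
  by apply: measurable_sum => j; exact: measurable_funM.
have [_ + ->] := gaussian_sqr_cos mU hs; move=> <-.
congr (expR (- _ / 2) * _).
have E w : (\sum_(j < n) t j * X (e j) w) ^+ 2 =
    \sum_(i < n) \sum_(j < n) (t i * t j) * (X (e i) w * X (e j) w).
  rewrite expr2 mulr_suml; apply: eq_bigr => i _; rewrite mulr_sumr.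
  by apply: eq_bigr => j _; ring.
transitivity (\int[P]_w (\sum_(i < n) \sum_(j < n) (t i * t j) * (X (e i) w * X (e j) w))).
  by apply: eq_Rint => w; exact: E.
rewrite (@Rint_sum _ _ _ P 'I_n); last first.
  move=> i; apply: (@intble_sum _ _ _ P 'I_n) => j; apply: intbleZ.
  exact: isonormal_intble_prod.
apply: eq_bigr => i _; rewrite (@Rint_sum _ _ _ P 'I_n); last first.
  by move=> j; apply: intbleZ; exact: isonormal_intble_prod.
rewrite (bigD1 i)//= big1 => [|j ji].
  rewrite RintZ; last exact: isonormal_intble_prod.
  by rewrite isonormal_cov oe eqxx addr0 mulr1 expr2.
rewrite RintZ; last exact: isonormal_intble_prod.
by rewrite isonormal_cov oe eq_sym (negbTE ji) mulr0.
Qed.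

End gaussian_coordinates.

(** * Elements of the second chaos *)

Section fourth_moment_convergence.
Context (R : realType) d (W : measurableType d) (P : probability W R).

Lemma cvg_pow (u : nat -> R) (l : R) n : u k @[k --> \oo] --> l ->
  u k ^+ n @[k --> \oo] --> l ^+ n.
Proof.
by move=> ul; exact: (cvg_comp u (fun x : R => x ^+ n) ul (@exprn_continuous R n l)).
Qed.

Lemma pow4_1D (a b : R) : (1 + `|a| + `|b|) ^+ 4 <= 27 * (1 + a ^+ 4 + b ^+ 4).
Proof.
have E (c : R) : c ^+ 4 = `|c| ^+ 4 by rewrite -normrX ger0_norm// exprn_even_ge0.
rewrite (E a) (E b); move: (normr_ge0 a) (normr_ge0 b).
move: `|a| `|b| => x y x0 y0.
have sq (u v : R) : 0 <= (u - v) ^+ 2 by exact: sqr_ge0.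
have h1 : (1 + x + y) ^+ 2 <= 3 * (1 + x ^+ 2 + y ^+ 2).
  by have := sq x y; have := sq 1 x; have := sq 1 y; nra.
have h2 : (1 + x ^+ 2 + y ^+ 2) ^+ 2 <= 3 * (1 + x ^+ 4 + y ^+ 4).
  have := sq (x ^+ 2) (y ^+ 2); have := sq 1 (x ^+ 2); have := sq 1 (y ^+ 2).
  by rewrite !sqrrB -!exprM; nra.
have -> : (1 + x + y) ^+ 4 = ((1 + x + y) ^+ 2) ^+ 2 by rewrite -exprM.
apply: (@le_trans _ _ ((3 * (1 + x ^+ 2 + y ^+ 2)) ^+ 2)).
  by rewrite ler_sqr// ?nnegrE; [exact: sqr_ge0|nra].
by rewrite exprMn; lra.
Qed.

(** Distinguish whether |a - b| is at most eta S or S is at most |a - b| / eta. *)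
Lemma pow4_young (eta a b : R) (S := 1 + `|a| + `|b|) : 0 < eta ->
  `|a - b| * S ^+ 3 <= 27 * eta * (1 + a ^+ 4 + b ^+ 4) + eta ^- 3 * (a - b) ^+ 4.
Proof.
move=> e0; have S0 : 0 < S by rewrite /S -addrA ltr_wpDr// addr_ge0.
have D4 : (a - b) ^+ 4 = `|a - b| ^+ 4.
  by rewrite -normrX ger0_norm// exprn_even_ge0.
have S4 := pow4_1D a b; rewrite -/S in S4.
have i3 : 0 < eta ^- 3 by rewrite invr_gt0 exprn_gt0.
rewrite D4; have D0 := normr_ge0 (a - b); move: `|a - b| D0 => D D0.
have [le|lt] := leP D (eta * S).
  apply: (@le_trans _ _ (eta * S ^+ 4)).
    have -> : eta * S ^+ 4 = (eta * S) * S ^+ 3 by ring.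
    by rewrite ler_wpM2r// exprn_ge0// ltW.
  apply: ler_wpDr; first by rewrite mulr_ge0 ?exprn_ge0// ltW.
  rewrite [leRHS](_ : _ = eta * (27 * (1 + a ^+ 4 + b ^+ 4))); last by ring.
  by rewrite ler_wpM2l// ltW.
apply: ler_wpDl.
  by rewrite !mulr_ge0// ?(ltW e0)// !addr_ge0// exprn_even_ge0.
rewrite [leRHS](_ : _ = D * (eta^-1 * D) ^+ 3); last by rewrite exprMn exprVn; ring.
rewrite ler_wpM2l// lerXn2r ?nnegrE//.
- exact: ltW.
- by rewrite mulr_ge0// invr_ge0 ltW.
- by rewrite mulrC ler_pdivlMr// mulrC ltW.
Qed.

Variables (Y : W -> R) (Y_ : nat -> W -> R) (K : R).
Hypotheses (mY : measurable_fun setT Y) (mY_ : forall k, measurable_fun setT (Y_ k)).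
Hypotheses (iY : intble P (fun w => Y w ^+ 4))
  (iY_ : forall k, intble P (fun w => Y_ k w ^+ 4)).
Hypothesis Y_K : forall k, \int[P]_w (Y_ k w ^+ 4) <= K.
Hypothesis iD : forall k, intble P (fun w => (Y_ k w - Y w) ^+ 4).
Hypothesis cvgD4 : \int[P]_w ((Y_ k w - Y w) ^+ 4) @[k --> \oo] --> (0 : R).

Section test_function.
Variables (phi : R -> R) (C : R).
Hypothesis mphi : measurable_fun [set: R] phi.
Hypothesis phiC : forall a b : R,
  `|phi a - phi b| <= C * (`|a - b| * (1 + `|a| + `|b|) ^+ 3).

Let C0 : 0 <= C.
Proof.
have := le_trans (normr_ge0 _) (phiC 1 0).
by rewrite subr0 normr0 normr1 addr0 mul1r pmulr_lge0// exprn_gt0.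
Qed.

Lemma pow4_growth_intble (V : W -> R) : measurable_fun setT V ->
  intble P (fun w => V w ^+ 4) -> intble P (fun w => phi (V w)).
Proof.
move=> mV iV.
apply: (intble_le (g := fun w => (`|phi 0| + C * 27) + (C * 28) * V w ^+ 4)).
- exact: measurableT_comp mphi mV.
- move=> w; have := phiC (V w) 0; have := @pow4_young 1 (V w) 0 ltr01.
  rewrite !subr0 expr0n/= expr1n invr1 !mul1r !mulr1 !addr0.
  move=> h1 h2; have := ler_wpM2l C0 h1; have := ler_normD (phi (V w) - phi 0) (phi 0).
  rewrite subrK; lra.
- by apply: intbleD; [exact: intble_cst|exact: intbleZ].
Qed.

(** Convergence in L^4 gives convergence of the integrals of every phi whose local
    Lipschitz constant grows at most cubically. By pow4_young the error is at most
    eta times a bound on fourth moments plus a constant times the fourth moment of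
    the difference; eta is chosen first. *)
Lemma cvg_Rint_pow4_growth :
  \int[P]_w phi (Y_ k w) @[k --> \oo] --> \int[P]_w phi (Y w).
Proof.
pose A := C * 27 * (1 + K + \int[P]_w (Y w ^+ 4)).
have K0 : 0 <= K by apply: le_trans (Y_K 0%N); apply: Rint_ge0 => w; exact: exprn_even_ge0.
have A0 : 0 <= A.
  rewrite /A !mulr_ge0// !addr_ge0//; apply: Rint_ge0 => w; exact: exprn_even_ge0.
have main eta k : 0 < eta -> `|\int[P]_w phi (Y w) - \int[P]_w phi (Y_ k w)| <=
    eta * A + C * eta ^- 3 * \int[P]_w ((Y_ k w - Y w) ^+ 4).
  move=> eta0; rewrite distrC.
  have ib : intble P (fun w => C * (27 * eta) * (1 + Y_ k w ^+ 4 + Y w ^+ 4)).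
    by apply: intbleZ; apply: intbleD => //; apply: intbleD => //; exact: intble_cst.
  have id4 : intble P (fun w => C * eta ^- 3 * (Y_ k w - Y w) ^+ 4) by exact: intbleZ.
  rewrite -RintB; [|exact: pow4_growth_intble|exact: pow4_growth_intble].
  apply: (le_trans (Rint_abs_le (intbleD ib id4) _ _)).
  - apply: measurable_funB; exact: measurableT_comp.
  - move=> w; apply: (le_trans (phiC _ _)).
    have := ler_wpM2l C0 (pow4_young (Y_ k w) (Y w) eta0).
    rewrite [X in _ <= X -> _](_ : _ = C * (27 * eta) * (1 + Y_ k w ^+ 4 + Y w ^+ 4) +
      C * eta ^- 3 * (Y_ k w - Y w) ^+ 4) //; ring.
  rewrite RintD// RintZ; last first.
    by apply: intbleD => //; apply: intbleD => //; exact: intble_cst.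
  rewrite RintD; [|by apply: intbleD => //; exact: intble_cst|by []].
  rewrite RintD//; last exact: intble_cst.
  rewrite Rint_cst RintZ// lerD2r /A.
  have e0 := mulr_ge0 C0 (ltW eta0).
  by have := Y_K k; nra.
apply/cvgrPdist_le => e e0.
pose eta := e / (2 * (A + 1)).
have A1 : 0 < A + 1 by rewrite ltr_wpDl.
have eta0 : 0 < eta by rewrite divr_gt0// mulr_gt0.
have h1 : eta * A <= e / 2.
  have -> : eta * A = e / 2 * (A / (A + 1)) by rewrite /eta; field; exact: lt0r_neq0.
  by rewrite ler_piMr ?divr_ge0 ?(ltW e0)// ler_pdivrMr// mul1r lerDl.
have : C * eta ^- 3 * \int[P]_w ((Y_ k w - Y w) ^+ 4) @[k --> \oo] --> (0 : R).
  by rewrite -[X in _ --> X](mulr0 (C * eta ^- 3)); apply: cvgMr.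
have e20 : 0 < e / 2 by rewrite divr_gt0.
move/cvgrPdist_le => /(_ _ e20) h2.
near=> k; apply: (le_trans (main eta k eta0)).
have : `|0 - C * eta ^- 3 * \int[P]_w ((Y_ k w - Y w) ^+ 4)| <= e / 2.
  by near: k; exact: h2.
rewrite sub0r normrN => /(le_trans (ler_norm _)); lra.
Unshelve. all: by end_near.
Qed.

End test_function.

Lemma pow_pow4_growth j (a b : R) : (j <= 4)%N ->
  `|a ^+ j - b ^+ j| <= 4 * (`|a - b| * (1 + `|a| + `|b|) ^+ 3).
Proof.
move=> j4; set S := 1 + `|a| + `|b|.
have S1 : 1 <= S by rewrite /S -addrA lerDl addr_ge0.
have aS : `|a| <= S by rewrite /S addrAC lerDr addr_ge0.
have bS : `|b| <= S by rewrite /S lerDr addr_ge0.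
rewrite subrXX normrM mulrCA; apply: ler_wpM2l => //.
apply: (le_trans (ler_norm_sum _ _ _)).
apply: (@le_trans _ _ (\sum_(i < j) S ^+ 3)).
  apply: ler_sum => i _; rewrite normrM !normrX.
  apply: (@le_trans _ _ (S ^+ (j.-1 - i) * S ^+ i)).
    by apply: ler_pM; rewrite ?exprn_ge0// lerXn2r// nnegrE (le_trans ler01).
  rewrite -exprD; apply: ler_weXn2l => //.
  by case: j j4 i => [|j] j4 [i ij]//=; rewrite subnK.
rewrite sumr_const card_ord -[leLHS]mulr_natl; apply: ler_wpM2r.
  by rewrite exprn_ge0// (le_trans ler01).
by rewrite ler_nat.
Qed.

Lemma lipschitz_pow4_growth (h : R -> R) (L : R) : 0 <= L ->
  (forall a b, `|h a - h b| <= L * `|a - b|) ->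
  forall a b, `|h a - h b| <= L * (`|a - b| * (1 + `|a| + `|b|) ^+ 3).
Proof.
move=> L0 hL a b; apply: (le_trans (hL a b)); apply: ler_wpM2l => //.
by apply: ler_peMr => //; rewrite exprn_ege1// -addrA lerDl addr_ge0.
Qed.

Lemma cvg_moment j : (j <= 4)%N ->
  \int[P]_w (Y_ k w ^+ j) @[k --> \oo] --> \int[P]_w (Y w ^+ j).
Proof.
move=> j4; apply: (@cvg_Rint_pow4_growth (fun x : R => x ^+ j) 4).
  by apply: cont_meas => x; exact: exprn_continuous.
by move=> a b; exact: pow_pow4_growth.
Qed.

End fourth_moment_convergence.

Section clipped_fourth_power.
Context (R : realType).

(** A bounded Lipschitz truncation of x^4: its integrals are continuous for
    convergence in L^2, and increase to the fourth moment as N grows. *)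
Definition clip_pow4 (N x : R) : R := (Num.min `|x| N) ^+ 4.

Lemma clip_pow4_lip N (x y : R) : 0 <= N ->
  `|clip_pow4 N x - clip_pow4 N y| <= 4 * N ^+ 3 * `|x - y|.
Proof.
move=> N0; rewrite /clip_pow4; set a := Num.min `|x| N; set b := Num.min `|y| N.
have a0 : 0 <= a by rewrite le_min normr_ge0.
have b0 : 0 <= b by rewrite le_min normr_ge0.
have aN : a <= N by rewrite ge_min lexx orbT.
have bN : b <= N by rewrite ge_min lexx orbT.
have ab : `|a - b| <= `|x - y|.
  apply: le_trans (ler_dist_dist x y); rewrite /a /b.
  by rewrite /Num.min; case: ltP => ?; case: ltP => ?; rewrite ler_norml; apply/andP; split;
    (case: (ler0P (`|x| - `|y|)) => ?); lra.
have -> : a ^+ 4 - b ^+ 4 = (a - b) * ((a + b) * (a ^+ 2 + b ^+ 2)) by ring.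
rewrite normrM mulrC; apply: ler_pM => //.
rewrite ger0_norm; last by rewrite mulr_ge0 ?addr_ge0 ?sqr_ge0.
have a2 : a ^+ 2 <= N ^+ 2 by rewrite lerXn2r.
have b2 : b ^+ 2 <= N ^+ 2 by rewrite lerXn2r.
rewrite (_ : 4 * N ^+ 3 = (N + N) * (N ^+ 2 + N ^+ 2)); last by ring.
by apply: ler_pM; rewrite ?addr_ge0 ?sqr_ge0//; apply: lerD.
Qed.

Lemma measurable_clip_pow4 N : measurable_fun [set: R] (clip_pow4 N).
Proof.
apply: measurable_funX; apply: measurable_minr; last exact: measurable_cst.
by apply: cont_meas => x; exact: norm_continuous.
Qed.

Lemma clip_pow4_le N x : 0 <= N -> 0 <= clip_pow4 N x <= N ^+ 4.
Proof.
move=> N0; have a0 : 0 <= Num.min `|x| N by rewrite le_min normr_ge0.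
by rewrite exprn_ge0//= lerXn2r// ge_min lexx orbT.
Qed.

Lemma psum_sqr_ge n (lam : 'I_n -> R) (r : seq 'I_n) :
  psum r lam 4 <= psum r lam 2 ^+ 2.
Proof.
rewrite /psum; elim: r => [|i r IH]; first by rewrite !big_nil expr0n.
rewrite !big_cons sqrrD -exprM; have := sqr_ge0 (lam i).
have : 0 <= \sum_(j <- r) lam j ^+ 2 by apply: sumr_ge0 => j _; exact: sqr_ge0.
by move: IH; nra.
Qed.

End clipped_fourth_power.

Section second_chaos_elements.
Context (R : realType) (d : measure_display) (W : measurableType d)
  (P : probability W R) (H T : completeNormedModType R).
Variables (dotH : {dot H for @idfun R}) (tens : {bilinear H -> H -> T}).
Variables (X : H -> {RV P >-> R}) (I2 : T -> {RV P >-> R}).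
Hypotheses (dotHP : hilbert_dot dotH) (XP : isonormal dotH X)
  (I2P : double_wiener_ito tens X I2).
Notation Sym := (symmetric_tensors tens).

Definition finite_symmetric : set T :=
  [set f : T | exists (n : nat) (h k : 'I_n -> H),
     f = \sum_(i < n) (tens (h i) (k i) + tens (k i) (h i))].

Lemma finite_symmetric_lin a f g : finite_symmetric f -> finite_symmetric g ->
  finite_symmetric (a *: f + g).
Proof.
move=> [n [h [k ->]]] [m [h' [k' ->]]].
exists (n + m)%N, (fun i => match fintype.split i with inl i => a *: h i | inr i => h' i end),
  (fun i => match fintype.split i with inl i => k i | inr i => k' i end).
rewrite big_split_ord/= scaler_sumr; congr (_ + _); apply: eq_bigr => i _.
  by rewrite (unsplitK (inl i)) linearZl_LR linearZr_LR/= scalerDr.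
by rewrite (unsplitK (inr i)).
Qed.

Lemma finite_symmetric_sub f : finite_symmetric f -> Sym f.
Proof. by move=> ?; apply: subset_closure. Qed.

Lemma finite_symmetric_square h : finite_symmetric (tens h h).
Proof.
exists 1%N, (fun=> 2^-1 *: h), (fun=> h); rewrite big_ord1 linearZl_LR linearZr_LR/=.
by rewrite -scalerDl -[LHS]scale1r; congr (_ *: _); field.
Qed.

Lemma symmetric_approx f : Sym f -> forall e, 0 < e ->
  exists2 g, finite_symmetric g & `|f - g| < e.
Proof.
move=> /= cf e e0; have [g [fg gB]] := cf _ (nbhsx_ballx f e e0).
by exists g => //; move: gB; rewrite -ball_normE.
Qed.

Lemma approx_symmetric f : (forall e, 0 < e ->
  exists2 g, finite_symmetric g & `|f - g| < e) -> Sym f.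
Proof.
move=> h B /nbhs_ballP[e /= e0 eB]; have [g gf ge] := h e e0.
by exists g; split => //; apply: eB; rewrite -ball_normE.
Qed.

Lemma symmetric_lin a f g : Sym f -> Sym g -> Sym (a *: f + g).
Proof.
move=> sf sg; apply: approx_symmetric => e e0.
have a1 : 0 < `|a| + 1 by rewrite ltr_wpDl.
have [f' f'f f'e] := symmetric_approx sf (divr_gt0 (divr_gt0 e0 (ltr0n _ 2)) a1).
have [g' g'f g'e] := symmetric_approx sg (divr_gt0 e0 (ltr0n _ 2)).
exists (a *: f' + g'); first exact: finite_symmetric_lin.
have -> : a *: f + g - (a *: f' + g') = a *: (f - f') + (g - g').
  by rewrite scalerBr opprD addrACA.
apply: (le_lt_trans (ler_normD _ _)); rewrite [ltRHS](splitr e) normrZ.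
apply: ler_ltD => //; move: f'e; rewrite ltr_pdivlMr// => /ltW; apply: le_trans.
by rewrite mulrC ler_wpM2l// lerDl.
Qed.

Lemma symmetric_sub f g : Sym f -> Sym g -> Sym (f - g).
Proof. by move=> sf sg; rewrite addrC -scaleN1r; exact: symmetric_lin. Qed.

Lemma finite_symmetric_sum n (e : 'I_n -> H) (l : 'I_n -> R) (r : seq 'I_n) :
  finite_symmetric (\sum_(i <- r) l i *: tens (e i) (e i)).
Proof.
elim: r => [|i r IH].
  by rewrite big_nil; exists 0%N, (fun=> 0), (fun=> 0); rewrite big_ord0.
by rewrite big_cons; apply: finite_symmetric_lin => //; exact: finite_symmetric_square.
Qed.

Lemma I2_diagonal n (e : 'I_n -> H) (l : 'I_n -> R) (r : seq 'I_n) :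
  orthonormal_family dotH e ->
  {ae P, forall w, I2 (\sum_(i <- r) l i *: tens (e i) (e i)) w =
    diag_sum (fun i => X (e i)) r l w}.
Proof.
move=> oe; have [lin _ sqr] := I2P; elim: r => [|i r IH].
  have s0 : Sym 0.
    by have := @finite_symmetric_sum n e l [::]; rewrite big_nil => /finite_symmetric_sub.
  move: (lin 1 0 0 s0 s0); apply: filterS => w; rewrite scaler0 addr0 mul1r => h.
  rewrite /diag_sum !big_nil; apply: (addrI (I2 0 w)).
  by rewrite -h addr0.
have e1 : `|e i| = 1.
  by apply/eqP; rewrite -sqrp_eq1// -dotHP oe eqxx.
have si := finite_symmetric_sub (finite_symmetric_square (e i)).
have sr := finite_symmetric_sub (finite_symmetric_sum e l r).
move: (lin (l i) _ _ si sr) (sqr _ e1) IH; apply: filterS3 => w h1 h2 h3.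
by rewrite big_cons h1 h2 h3 /diag_sum big_cons.
Qed.

(** By diagonal_tensor and isonormal_cos, the double integral of a finite tensor is a
    diagonal form in independent standard normal variables, here described by
    their joint cosine transform. *)
Lemma I2_finite f : finite_symmetric f ->
  exists (n : nat) (xi : 'I_n -> W -> R) (lam : 'I_n -> R),
  [/\ forall j, measurable_fun setT (xi j),
      forall (t : 'I_n -> R) (c : R),
        \int[P]_x cos (\sum_(j < n) t j * xi j x + c) =
        expR (- (\sum_(j < n) t j ^+ 2) / 2) * cos c &
      {ae P, forall w, I2 f w = diag_sum xi (index_enum 'I_n) lam w}].
Proof.
move=> [n [h [k ->]]]; have [m [e [l [oe ->]]]] := diagonal_tensor dotHP tens h k.
exists m, (fun j => X (e j)), l; split => [j|t c|]; first exact: measurable_funPT.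
- exact: (isonormal_cos XP).
- exact: I2_diagonal.
Qed.

Lemma I2_sub f g : Sym f -> Sym g ->
  {ae P, forall w, I2 (f - g) w = I2 f w - I2 g w}.
Proof.
move=> sf sg; have [lin _ _] := I2P; move: (lin (-1) g f sg sf).
by apply: filterS => w; rewrite scaleN1r addrC => ->; rewrite mulN1r addrC.
Qed.

Lemma I2_isometry f : Sym f ->
  intble P (fun w => I2 f w ^+ 2) /\ \int[P]_w (I2 f w ^+ 2) = 2 * `|f| ^+ 2.
Proof.
move=> sf; have [_ iso _] := I2P.
have h : (\int[P]_w (I2 f w ^+ 2)%:E)%E = (2 * `|f| ^+ 2)%:E.
  have /(congr1 (fun x => poweR x 2)) := iso f sf.
  rewrite poweR_Lnorm ?pnatr_eq0// poweR_EFin powR_mulrn; last by rewrite mulr_ge0 ?sqrtr_ge0.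
  rewrite exprMn sqr_sqrtr// => <-; apply: eq_integral => w _ /=.
  by rewrite powR_mulrn// real_normK// num_real.
split; last by rewrite /Rintegral h.
apply: ge0_intble => [|w|]; [|exact: sqr_ge0|by rewrite h ltry].
exact: measurable_funX.
Qed.

Lemma I2_finite_intbleX f k : finite_symmetric f -> (k <= 4)%N ->
  intble P (fun w => I2 f w ^+ k).
Proof.
move=> /I2_finite[n [xi [lam [mxi xi_cos fE]]]] k4.
apply: (ae_intble _ _ (diag_intbleX mxi xi_cos lam k4)).
  exact: measurable_funX.
by move: fE; apply: filterS => w ->.
Qed.

Lemma I2_finite_fourth f : finite_symmetric f ->
  \int[P]_w (I2 f w ^+ 4) <= 60 * `|f| ^+ 4.
Proof.
move=> ff; have [_ f2] := I2_isometry (finite_symmetric_sub ff).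
have [n [xi [lam [mxi xi_cos fE]]]] := I2_finite ff.
have mZ := measurable_diag_sum mxi (index_enum 'I_n) lam.
have aeX k : \int[P]_w (I2 f w ^+ k) =
    \int[P]_w (diag_sum xi (index_enum 'I_n) lam w ^+ k).
  apply: ae_Rint; [exact: measurable_funX|exact: measurable_funX|].
  by move: fE; apply: filterS => w ->.
have [_ [_ m2 _ m4]] := diag_moments mxi xi_cos lam (index_enum_uniq _).
have p2 : psum (index_enum 'I_n) lam 2 = `|f| ^+ 2.
  by move: f2; rewrite aeX m2; lra.
rewrite aeX m4; have := psum_sqr_ge lam (index_enum 'I_n).
by rewrite p2 -exprM; lra.
Qed.

Lemma symmetric_seq f : Sym f -> exists g : nat -> T,
  [/\ forall k, finite_symmetric (g k), forall k, `|f - g k| <= 1 &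
      `|f - g k| @[k --> \oo] --> (0 : R)].
Proof.
move=> sf.
have gk k : exists g, finite_symmetric g /\ `|f - g| < k.+1%:R^-1.
  have [|g ? ?] := @symmetric_approx f sf k.+1%:R^-1.
    by rewrite invr_gt0.
  by exists g.
have [g gP] := choice gk.
exists g; split => [k|k|]; first exact: (gP k).1.
  by apply: (le_trans (ltW (gP k).2)); rewrite invf_le1// ler1n.
apply: (@squeeze_cvgr _ _ _ _ (fun=> 0) (fun k => k.+1%:R^-1)).
- by apply: nearW => k; rewrite normr_ge0 ltW// (gP k).2.
- exact: cvg_cst.
- exact: (@cvg_harmonic R).
Qed.

(** The isometry only controls L^2 distances, so the fourth moment bound is first
    carried to the limit for the truncated power. *)
Lemma I2_clip_fourth f N : Sym f -> 0 <= N ->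
  \int[P]_w clip_pow4 N (I2 f w) <= 60 * `|f| ^+ 4.
Proof.
move=> sf N0; have [g [gf _ g0]] := symmetric_seq sf.
have ic V : measurable_fun setT V -> intble P (fun w => clip_pow4 N (V w)).
  move=> mV; apply: (@bounded_intble _ _ _ P _ (N ^+ 4)).
    exact: measurableT_comp (measurable_clip_pow4 N) mV.
  by move=> w; have /andP[h1 h2] := clip_pow4_le (V w) N0; rewrite ger0_norm.
have step k : \int[P]_w clip_pow4 N (I2 f w) <=
    60 * `|g k| ^+ 4 + 4 * N ^+ 3 * (Num.sqrt 2 * `|f - g k|).
  have sg := finite_symmetric_sub (gf k).
  have [i2 e2] := I2_isometry (symmetric_sub sf sg).
  have ic4 : \int[P]_w clip_pow4 N (I2 (g k) w) <= 60 * `|g k| ^+ 4.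
    apply: le_trans (I2_finite_fourth (gf k)); apply: Rint_le.
    - exact: ic.
    - exact: I2_finite_intbleX.
    - move=> w; rewrite /clip_pow4 -[in leRHS](ger0_norm (exprn_even_ge0 _ _))//.
      rewrite normrX lerXn2r// ?nnegrE ?le_min ?normr_ge0//.
      by rewrite ge_min lexx.
  have mD : measurable_fun setT (I2 (f - g k)) by [].
  have L1 : \int[P]_w `|I2 (f - g k) w| <= Num.sqrt 2 * `|f - g k|.
    apply: (le_trans (Rint_abs_le_sqrt mD i2)).
    by rewrite e2 sqrtrM// sqrtr_sqr normr_id.
  have iD : intble P (I2 (f - g k)).
    apply: (intble_le mD _ (intbleD (intble_cst P 1) i2)) => w.
    rewrite -(real_normK (num_real (I2 (f - g k) w))).
    by have := sqr_ge0 (`|I2 (f - g k) w| - 1); nra.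
  have D : \int[P]_w clip_pow4 N (I2 f w) - \int[P]_w clip_pow4 N (I2 (g k) w) <=
      4 * N ^+ 3 * \int[P]_w `|I2 (f - g k) w|.
    rewrite -RintB; [|exact: ic|exact: ic].
    have -> : \int[P]_w `|I2 (f - g k) w| = \int[P]_w `|I2 f w - I2 (g k) w|.
      apply: ae_Rint; [exact: measurableT_comp| |].
        by apply: measurableT_comp => //; exact: measurable_funB.
      by move: (I2_sub sf sg); apply: filterS => w ->.
    have iD' : intble P (fun w => `|I2 f w - I2 (g k) w|).
      apply: (ae_intble _ _ (intble_norm iD)).
        by apply: measurableT_comp => //; exact: measurable_funB.
      by move: (I2_sub sf sg); apply: filterS => w ->.
    rewrite -RintZ//; apply: Rint_le.
    - by apply: intbleB; exact: ic.
    - exact: intbleZ.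
    - by move=> w; apply: (le_trans (ler_norm _)); exact: clip_pow4_lip.
  have := ler_wpM2l (mulr_ge0 (ler0n _ 4) (exprn_ge0 3 N0)) L1; lra.
have gn : `|g k| @[k --> \oo] --> `|f|.
  apply: cvg_norm; apply/cvgrPdist_le => e e0.
  by move/cvgrPdist_le: g0 => /(_ e e0); apply: filterS => k; rewrite sub0r normrN normr_id.
have L : 60 * `|g k| ^+ 4 + 4 * N ^+ 3 * (Num.sqrt 2 * `|f - g k|) @[k --> \oo] -->
    60 * `|f| ^+ 4 + 4 * N ^+ 3 * (Num.sqrt 2 * 0).
  apply: cvgD; first by apply: cvgMr; exact: cvg_pow.
  by apply: cvgMr; apply: cvgMr.
move: L; rewrite !mulr0 addr0 => L.
by apply: (cvgr_to_ge L); apply: nearW => k; exact: step.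
Qed.

(** Hypercontractivity: the second chaos embeds in L^4. For a diagonal form the fourth
    moment is 48 p_4 + 12 p_2^2 with p_4 <= p_2^2, whence the constant 60; monotone
    convergence removes the truncation. *)
Lemma I2_fourth f : Sym f ->
  intble P (fun w => I2 f w ^+ 4) /\ \int[P]_w (I2 f w ^+ 4) <= 60 * `|f| ^+ 4.
Proof.
move=> sf.
have h : (\int[P]_w (I2 f w ^+ 4)%:E <= (60 * `|f| ^+ 4)%:E)%E.
  have cl w : (clip_pow4 n%:R (I2 f w))%:E @[n --> \oo] --> (I2 f w ^+ 4)%:E.
    apply/cvg_EFin; first exact: nearW.
    apply: cvg_near_cst; near=> n; rewrite /= /clip_pow4 min_l.
      by rewrite -normrX ger0_norm// exprn_even_ge0.
    near: n; exact: nbhs_infty_ger.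
  have -> : (\int[P]_w (I2 f w ^+ 4)%:E = limn (fun n => \int[P]_w (clip_pow4 n%:R (I2 f w))%:E))%E.
    rewrite -monotone_convergence//.
    - by apply: eq_integral => w _; apply/esym/cvg_lim.
    - move=> n; apply/measurable_EFinP.
      exact: measurableT_comp (measurable_clip_pow4 _) _.
    - by move=> n w _; rewrite lee_fin; have /andP[] := clip_pow4_le (I2 f w) (ler0n R n).
    - move=> w _ m n mn; rewrite lee_fin lerXn2r ?nnegrE ?le_min ?normr_ge0 ?ler0n//.
      by rewrite ge_min lexx/= ge_min ler_nat mn orbT.
  apply: lime_le.
    apply: ereal_nondecreasing_is_cvgn => m n mn; apply: ge0_le_integral => //.
    - by move=> w _; rewrite lee_fin; have /andP[] := clip_pow4_le (I2 f w) (ler0n R m).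
    - by apply/measurable_EFinP; exact: measurableT_comp (measurable_clip_pow4 _) _.
    - by apply/measurable_EFinP; exact: measurableT_comp (measurable_clip_pow4 _) _.
    - move=> w _; rewrite lee_fin lerXn2r ?nnegrE ?le_min ?normr_ge0 ?ler0n//.
      by rewrite ge_min lexx/= ge_min ler_nat mn orbT.
  apply: nearW => n; rewrite intE; first by rewrite lee_fin I2_clip_fourth.
  apply: (@bounded_intble _ _ _ P _ (n%:R ^+ 4)).
    exact: measurableT_comp (measurable_clip_pow4 _) _.
  by move=> w; have /andP[h1 h2] := clip_pow4_le (I2 f w) (ler0n R n); rewrite ger0_norm.
have i4 : intble P (fun w => I2 f w ^+ 4).
  apply: ge0_intble => [|w|]; first exact: measurable_funX.
    exact: exprn_even_ge0.
  exact: le_lt_trans h (ltry _).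
by split => //; move: h; rewrite intE.
Unshelve. all: by end_near.
Qed.

Section stein_bound.
Variables (f f' h : R -> R) (M L a b c : R).
Hypotheses (df : forall x : R, is_derive x 1 f (f' x)) (cf' : continuous f')
  (f'M : forall x, `|f' x| <= M).
Hypothesis hL : forall x y, `|h x - h y| <= L * `|x - y|.
Hypothesis stein_eq : forall x, (a * x + b) * f' x - x * f x = h x - c.

(** The bound for diagonal forms passes to the limit: approximation by finite tensors
    holds in L^4 by I2_fourth, along which the moments up to the fourth and the
    integrals of h are continuous. *)
Lemma I2_stein_bound g (m : nat -> R := fun k => \int[P]_w (I2 g w ^+ k)) : Sym g ->
  intble P (fun w => h (I2 g w)) /\
  `|\int[P]_w h (I2 g w) - c| <= M * Num.sqrt
     ((b - m 2%N) ^+ 2 + a ^+ 2 * m 2%N - a * m 3%N + (m 4%N - 3 * m 2%N ^+ 2) / 6).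
Proof.
move=> sg; have [u [uf u1 u0]] := symmetric_seq sg.
have L0 : 0 <= L.
  by have := le_trans (normr_ge0 _) (hL 1 0); rewrite subr0 normr1 mulr1.
have mh : measurable_fun [set: R] h by exact: cont_meas (lipschitz_cont hL).
have [i4 _] := I2_fourth sg.
have su k := finite_symmetric_sub (uf k).
have iu k : intble P (fun w => I2 (u k) w ^+ 4) := (I2_fourth (su k)).1.
have K k : \int[P]_w (I2 (u k) w ^+ 4) <= 60 * (1 + `|g|) ^+ 4.
  apply: (le_trans (I2_fourth (su k)).2); rewrite ler_wpM2l// lerXn2r ?nnegrE ?addr_ge0//.
  have -> : u k = g - (g - u k) by rewrite subKr.
  by rewrite (le_trans (ler_normB _ _))// addrC lerD2r.
have aeD k : {ae P, forall w, I2 (g - u k) w ^+ 4 = (I2 (u k) w - I2 g w) ^+ 4}.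
  move: (I2_sub sg (su k)); apply: filterS => w ->.
  by rewrite -opprB; ring.
have mD k : measurable_fun setT (fun w => (I2 (u k) w - I2 g w) ^+ 4).
  by apply: measurable_funX; exact: measurable_funB.
have iD k : intble P (fun w => (I2 (u k) w - I2 g w) ^+ 4).
  exact: ae_intble (mD k) (aeD k) (I2_fourth (symmetric_sub sg (su k))).1.
have cD : \int[P]_w ((I2 (u k) w - I2 g w) ^+ 4) @[k --> \oo] --> (0 : R).
  apply: (@squeeze_cvgr _ _ _ _ (fun=> 0) (fun k => 60 * `|g - u k| ^+ 4)).
  - apply: nearW => k; rewrite Rint_ge0 => [|w]; last exact: exprn_even_ge0.
    rewrite -(ae_Rint _ (mD k) (aeD k)); last exact: measurable_funX.
    exact: (I2_fourth (symmetric_sub sg (su k))).2.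
  - exact: cvg_cst.
  - rewrite -[X in _ --> X](mulr0 60); apply: cvgMr.
    by rewrite -[X in _ --> X](expr0n R 4); exact: cvg_pow.
have gh := lipschitz_pow4_growth L0 hL.
have hi : intble P (fun w => h (I2 g w)) by exact: (pow4_growth_intble mh gh).
split => //.
have cm j : (j <= 4)%N -> \int[P]_w (I2 (u k) w ^+ j) @[k --> \oo] --> m j.
  by move=> j4; apply: (cvg_moment (K := 60 * (1 + `|g|) ^+ 4)).
have ch : \int[P]_w h (I2 (u k) w) @[k --> \oo] --> \int[P]_w h (I2 g w).
  exact: (cvg_Rint_pow4_growth _ _ i4 iu K iD cD mh gh).
pose mk j k := \int[P]_w (I2 (u k) w ^+ j).
have bd k : `|\int[P]_w h (I2 (u k) w) - c| <= M * Num.sqrt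
    ((b - mk 2%N k) ^+ 2 + a ^+ 2 * mk 2%N k - a * mk 3%N k + (mk 4%N k - 3 * mk 2%N k ^+ 2) / 6).
  have [n [xi [lam [mxi xi_cos fE]]]] := I2_finite (uf k).
  have mZ := measurable_diag_sum mxi (index_enum 'I_n) lam.
  have aeX j : mk j k = \int[P]_w (diag_sum xi (index_enum 'I_n) lam w ^+ j).
    apply: ae_Rint; [exact: measurable_funX|exact: measurable_funX|].
    by move: fE; apply: filterS => w ->.
  have := diag_stein_bound mxi xi_cos lam df cf' f'M a b.
  rewrite -!aeX; apply: le_trans; rewrite le_eqVlt; apply/orP; left; apply/eqP; congr `|_|.
  have hui : intble P (fun w => h (I2 (u k) w)) by exact: (pow4_growth_intble mh gh).
  rewrite -[X in _ - X](Rint_cst P) -RintB//; last exact: intble_cst.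
  apply: ae_Rint.
  - by apply: measurable_funB => //; exact: measurableT_comp.
  - apply: measurable_funB; apply: measurable_funM => //.
    + by apply: measurable_funD => //; exact: measurable_funM.
    + exact: measurableT_comp (cont_meas cf') mZ.
    + by apply: measurableT_comp mZ; apply: cont_meas => x; exact: der_cvg.
  - by move: fE; apply: filterS => w ->; rewrite stein_eq.
have c1 : `|\int[P]_w h (I2 (u k) w) - c| @[k --> \oo] --> `|\int[P]_w h (I2 g w) - c|.
  by apply: cvg_norm; apply: cvgB => //; exact: cvg_cst.
have c2 : M * Num.sqrt
    ((b - mk 2%N k) ^+ 2 + a ^+ 2 * mk 2%N k - a * mk 3%N k + (mk 4%N k - 3 * mk 2%N k ^+ 2) / 6)
    @[k --> \oo] --> M * Num.sqrt
     ((b - m 2%N) ^+ 2 + a ^+ 2 * m 2%N - a * m 3%N + (m 4%N - 3 * m 2%N ^+ 2) / 6).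
  apply: cvgMr; apply: (@cvg_comp _ _ _ _ Num.sqrt _ _ _ _ (@sqrt_continuous R _)).
  apply: cvgD; first apply: cvgB; first apply: cvgD.
  - by apply: cvg_pow; apply: cvgB; [exact: cvg_cst|exact: cm].
  - by apply: cvgMr; exact: cm.
  - by apply: cvgMr; exact: cm.
  - apply: cvgMl; apply: cvgB; first exact: cm.
    by apply: cvgMr; apply: cvg_pow; exact: cm.
by apply: (ler_cvg_to c1 c2); apply: nearW => k; exact: bd.
Qed.

End stein_bound.

End second_chaos_elements.

(** * Primitives, and the Stein equation of the normal law *)

Section primitives.
Context (R : realType).
Notation lam := (@lebesgue_measure R).

Section whole_line.
Variable f : R -> R.
Hypothesis fi : @intble _ (measurableTypeR R) R lam f.
Let F x := \int[lam]_(t in `]-oo, x]) f t.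

Lemma primitive_der (x : R) : {for x, continuous f} -> is_derive x 1 F (f x).
Proof.
move=> cf.
have fi' : lam.-integrable [set` Interval -oo%O (BRight (x + 1))] (EFin \o f).
  by apply: integrableS fi.
have [dF <-] : derivable F x 1 /\ F^`()%classic x = f x.
  have xx1 : x < x + 1 by rewrite ltrDl.
  by apply: (continuous_FTC1 xx1 fi' _ cf); rewrite ltNyr.
exact: derivable_der.
Qed.

Let mF (x : R) : @measurable_fun _ _ (measurableTypeR R) R setT
  (fun t => f t * \1_(`]-oo, x]%classic) t).
Proof.
apply: measurable_funM; first exact: (intble_meas fi).
exact: measurable_indic.
Qed.

Let F_dom (x t : R) : `|f t * \1_(`]-oo, x]%classic) t| <= `|f t|.
Proof.
by rewrite normrM ler_piMr// indic_norm_le1.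
Qed.

Lemma primitive_cvgy : F n%:R @[n --> \oo] --> \int[lam]_t f t.
Proof.
rewrite (_ : (fun n => _) = (fun n => \int[lam]_t (f t * \1_(`]-oo, n%:R]%classic) t))); last first.
  by apply/funext => n; exact: Rint_set.
apply: (@Rint_dct _ (measurableTypeR R) R lam _ _ (fun t => `|f t|)) => //.
- exact: (intble_meas fi).
- move=> t; apply: cvg_near_cst; near=> n.
  rewrite indicE mem_set ?mulr1//= in_itv/=.
  by near: n; exact: nbhs_infty_ger.
- exact: intble_norm.
Unshelve. all: by end_near. Qed.

Lemma primitive_cvgNy : F (- n%:R) @[n --> \oo] --> (0 : R).
Proof.
rewrite (_ : (fun n => _) = (fun n => \int[lam]_t (f t * \1_(`]-oo, - n%:R]%classic) t))); last first.
  by apply/funext => n; exact: Rint_set.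
rewrite -(@Rint0 _ (measurableTypeR R) R lam).
apply: (@Rint_dct _ (measurableTypeR R) R lam _ _ (fun t => `|f t|)) => //.
- move=> t; apply: cvg_near_cst; near=> n.
  rewrite indicE memNset ?mulr0//= in_itv/=; apply/negP; rewrite -ltNge ltrNl.
  by near: n; exact: nbhs_infty_gtr.
- exact: intble_norm.
Unshelve. all: by end_near. Qed.

End whole_line.
End primitives.

Section normal_stein_equation.
Context (R : realType).
Notation lam := (@lebesgue_measure R).
Notation gam := (normal_prob (0 : R) 1).
Notation p := (normal_pdf (0 : R) 1).

Let s1 : (1 : R) != 0. Proof. exact: oner_neq0. Qed.

Let dp (x : R) : is_derive x 1 p (- x * p x).
Proof. by eapply der_eq; [exact: (normal_pdf_der 0 s1)|rewrite subr0 expr1n divr1]. Qed.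

Let p0 (x : R) : 0 < p x.
Proof. by rewrite normal_pdfE// mulr_gt0 ?normal_peak_gt0// expR_gt0. Qed.

(** Mills ratio: p / x dominates any integral over ]x, +oo[ of a function bounded
    by p, since it decreases to 0 with a slope at most - p. *)
Lemma mills_bound (F g : R -> R) : (forall x : R, is_derive x 1 F (g x * p x)) ->
  (forall x, `|g x| <= 1) -> F n%:R @[n --> \oo] --> (0 : R) ->
  forall x, 0 < x -> `|x * F x| <= p x.
Proof.
move=> dF g1 F0 x x0.
(* The sign s = 1 or -1 turns the bound on the absolute value into two one-sided
   bounds; K decreases because -K' = p (1 + 1 / y^2 - s g) is nonnegative. *)
suff key (s : R) : `|s| <= 1 -> 0 <= p x / x + s * F x.
  have h1 := key 1; have h2 := key (-1).
  rewrite normrM (gtr0_norm x0) mulrC -ler_pdivlMr// ler_norml.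
  have := h1 _; rewrite normr1 mul1r => /(_ (lexx _)); have := h2 _.
  by rewrite normrN1 mulN1r => /(_ (lexx _)) ? ?; apply/andP; split; lra.
move=> s1'; pose K y := p y / y + s * F y.
have dK (y : R) : x <= y -> is_derive y 1 (fun y => - K y)
    (p y * (1 + y ^- 2 - s * g y)).
  move=> xy; have y0 : y != 0 by rewrite gt_eqF// (lt_le_trans x0).
  rewrite /K; eapply der_eq.
    eapply derN; eapply derD; last by eapply derM; [apply: derC|apply: dF].
    by eapply derM; [apply: dp|eapply (@derV R (fun y : R => y) y _ y0); exact: derid].
  by rewrite /=; field.
have Kx n : x <= n%:R -> K n%:R <= K x.
  move=> xn; rewrite -lerN2.
  apply: (@der_nondecreasing R (fun y => - K y) (fun y => p y * (1 + y ^- 2 - s * g y))) => //.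
    by move=> y /andP[xy _]; exact: dK.
  move=> y /andP[xy _]; rewrite mulr_ge0 ?(ltW (p0 y))//.
  have sg : s * g y <= 1.
    by rewrite (le_trans (ler_norm _))// normrM mulr_ile1.
  have : 0 <= y ^- 2 by rewrite invr_ge0 sqr_ge0.
  lra.
have K0 : K n%:R @[n --> \oo] --> (0 : R).
  rewrite -[X in _ --> X](addr0 0) -{2}(mulr0 s); apply: cvgD; last exact: cvgMr.
  rewrite -(cvg_shiftS (fun n : nat => p n%:R / n%:R))/=; apply: (@squeeze_cvgr _ _ _ _ (fun=> 0) (fun n => normal_peak 1 * n.+1%:R^-1)).
  - apply: nearW => n; rewrite divr_ge0 ?(ltW (p0 _))//=.
    by rewrite ler_wpM2r// normal_pdf_ub.
  - exact: cvg_cst.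
  - by rewrite -[X in _ --> X](mulr0 (normal_peak 1)); apply: cvgMr; exact: cvg_harmonic.
apply: (cvgr_to_le K0); near=> n; apply: Kx; near: n; exact: nbhs_infty_ger.
Unshelve. all: by end_near. Qed.

Variable h : R -> R.
Hypotheses (ch : continuous h) (h01 : forall x, 0 <= h x <= 1).
Notation c := (\int[gam]_x h x).

(** The solution is f = F / p, where F is the primitive of (h - c) p vanishing at -oo.
    Since c is the mean of h, F vanishes at +oo as well, and the Mills ratio bound
    from both sides gives |x f x| <= 1; hence |f' x| = |x f x + h x - c| <= 2. *)
Lemma normal_stein_solution : exists f f' : R -> R,
  [/\ forall x : R, is_derive x 1 f (f' x), continuous f',
      forall x, `|f' x| <= 2 & forall x, (0 * x + 1) * f' x - x * f x = h x - c].
Proof.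
have mh := cont_meas ch.
have hb x : `|h x| <= 1 by have /andP[? ?] := h01 x; rewrite ger0_norm.
have hi : intble gam h by exact: (@bounded_intble _ _ _ gam _ 1 mh hb).
have c01 : 0 <= c <= 1.
  rewrite Rint_ge0/=; last by move=> x; have /andP[] := h01 x.
  have := @Rint_abs_bound _ _ _ gam _ _ mh hb; exact: le_trans (ler_norm _).
pose g x := h x - c.
have cg : continuous g by move=> x; apply: cvgB; [exact: ch|exact: cvg_cst].
have g1 x : `|g x| <= 1.
  have /andP[? ?] := h01 x; move: c01; rewrite /g; move: c => c' /andP[? ?].
  by rewrite ler_norml; apply/andP; split; lra.
have mg := cont_meas cg.
have gi : intble gam g by exact: (@bounded_intble _ _ _ gam _ 1 mg g1).
pose u x := g x * p x.
have ui : @intble _ (measurableTypeR R) R lam u by exact/(normal_intble 0 1 mg).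
have u0 : \int[lam]_x u x = 0.
  rewrite /u -(normal_Rint 0 1 mg) /g RintB//; last exact: intble_cst.
  by rewrite Rint_cst subrr.
pose F x := \int[lam]_(t in `]-oo, x]) u t.
have cp : continuous p by move=> x; exact: der_cvg.
have cu : continuous u by move=> x; apply: cvgM; [exact: cg|exact: cp].
have dF (x : R) : is_derive x 1 F (g x * p x) by exact: (primitive_der ui (cu x)).
have Fy : F n%:R @[n --> \oo] --> (0 : R) by rewrite -u0; exact: primitive_cvgy.
have FNy : F (- n%:R) @[n --> \oo] --> (0 : R) by exact: primitive_cvgNy.
have pN x : p (- x) = p x.
  by rewrite !normal_pdfE// /normal_fun !subr0 sqrrN.
have xF x : `|x * F x| <= p x.
  have [x0|x0|x0] := ltgtP 0 x; last by rewrite -x0 mul0r normr0 ltW.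
    exact: (mills_bound dF g1 Fy x0).
  (* For x < 0, the reflected primitive F (- y) reduces the bound to the case x > 0. *)
  have := @mills_bound (fun y => F (- y)) (fun y => - g (- y)) _ _ FNy (- x).
  rewrite opprK pN mulNr normrN; apply; last by rewrite oppr_gt0.
    move=> y; eapply der_eq.
      by eapply (@der_comp _ F (fun y => - y)); [apply: dF|apply: derN; apply: derid].
    by rewrite pN; ring.
  by move=> y; rewrite normrN.
pose f x := F x / p x.
have df (x : R) : is_derive x 1 f (x * f x + g x).
  have px := lt0r_neq0 (p0 x).
  rewrite /f; eapply der_eq.
    by eapply derM; [apply: dF|eapply (@derV R p x _ px); apply: dp].
  by rewrite /=; field.
exists f, (fun x => x * f x + g x); split => //.
- move=> x; apply: cvgD; last exact: cg.
  by apply: cvgM; [exact: cvg_id|exact: der_cvg].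
- move=> x; apply: (le_trans (ler_normD _ _)); apply: (@le_trans _ _ (1 + 1)); last by lra.
  apply: lerD => //; rewrite /f mulrA normrM normfV (gtr0_norm (p0 x)).
  by rewrite ler_pdivrMr// mul1r.
- by move=> x; rewrite mul0r add0r mul1r /g; ring.
Qed.

End normal_stein_equation.

(** * The Stein equation of the gamma law *)

Section singular_primitives.
Context (R : realType).
Notation lam := (@lebesgue_measure R).

Lemma cvg_inv_succ : (n.+1%:R^-1 : R) @[n --> \oo] --> (0 : R).
Proof. exact: (@cvg_harmonic R). Qed.

(** On ]0, b] the function U differs from the primitive of u by a constant, and both
    tend to 0 at 0: integrability and a boundary value replace continuity at 0. *)
Lemma FTC_from_zero (u U : R -> R) (b : R) : 0 < b ->
  @intble _ (measurableTypeR R) R lam u -> (forall t, t <= 0 -> u t = 0) ->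
  (forall t, 0 < t <= b -> {for t, continuous u}) ->
  (forall t : R, 0 < t <= b -> is_derive t 1 U (u t)) ->
  U n.+1%:R^-1 @[n --> \oo] --> (0 : R) ->
  \int[lam]_(t in `]-oo, b]) u t = U b.
Proof.
move=> b0 ui u0 cu dU U0.
pose F x := \int[lam]_(t in `]-oo, x]) u t.
have dD (t : R) : 0 < t <= b -> is_derive t 1 (fun x => F x - U x) 0.
  move=> tb; have dF := primitive_der ui (cu t tb); have dUt := dU t tb.
  by eapply der_eq; [eapply derD; [exact: dF|eapply derN; exact: dUt]|rewrite subrr].
have cst (t : R) : 0 < t <= b -> F b - U b = F t - U t.
  move=> /andP[t0 tb]; have sub x : t <= x <= b -> 0 < x <= b.
    by move=> /andP[tx ->]; rewrite (lt_le_trans t0).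
  apply/esym/(@der0_cst R (fun x => F x - U x)) => // x /sub.
  exact: dD.
have F0 : F n.+1%:R^-1 @[n --> \oo] --> (0 : R).
  rewrite (_ : (fun n => _) =
    (fun n => \int[lam]_t (u t * \1_(`]-oo, n.+1%:R^-1]%classic) t))); last first.
    by apply/funext => n; exact: Rint_set.
  rewrite -(@Rint0 _ (measurableTypeR R) R lam).
  apply: (@Rint_dct _ (measurableTypeR R) R lam _ _ (fun t => `|u t|)) => //.
  - move=> n; apply: measurable_funM; first exact: (intble_meas ui).
    exact: measurable_indic.
  - move=> t; have [t0|t0] := leP t 0.
      by apply: cvg_near_cst; apply: nearW => n; rewrite u0// mul0r.
    apply: cvg_near_cst; near=> n.
    rewrite indicE memNset ?mulr0//= in_itv/=; apply/negP; rewrite -ltNge.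
    by near: n; exact: (cvgr_lt _ cvg_inv_succ).
  - exact: intble_norm.
  - by move=> n t; rewrite normrM ler_piMr// indic_norm_le1.
have L : F n.+1%:R^-1 - U n.+1%:R^-1 @[n --> \oo] --> (0 - 0 : R) by exact: cvgB.
apply/eqP; rewrite -subr_eq0 -/(F b); apply/eqP.
rewrite subr0 in L; apply: (cvg_unique _ _ L) => //.
apply: cvg_near_cst; near=> n; rewrite -cst//; apply/andP; split.
  by rewrite invr_gt0.
by near: n; exact: (cvgr_le _ cvg_inv_succ).
Unshelve. all: by end_near. Qed.

End singular_primitives.

Section gamma_weights.
Context (R : realType) (alpha : R).
Hypothesis alpha0 : 0 < alpha.
Notation lam := (@lebesgue_measure R).
Notation p := (gamma_pdf alpha).
Hypothesis mass1 : (\int[lam]_x (p x)%:E = 1)%E.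

(** A vanishing Gamma alpha would make the density vanish, against its total mass. *)
Lemma Gamma_gt0 : 0 < Gamma alpha.
Proof.
have G0 : 0 <= Gamma alpha.
  by apply: Rintegral_ge0 => x _; rewrite mulr_ge0 ?powR_ge0 ?expR_ge0.
rewrite lt0r G0 andbT; apply/eqP => GE; move: mass1.
rewrite (eq_integral (fun=> 0%E)); last first.
  by move=> x _; rewrite /gamma_pdf GE invr0 mulr0; case: ifP.
by rewrite integral0 => /eqP; rewrite eq_sym onee_eq0.
Qed.

Lemma measurable_pos_powR (a : R) (q : R -> bool) (f : R -> R) :
  measurable [set x | q x] -> measurable_fun [set: R] f ->
  measurable_fun [set: R] (fun x => if q x then x `^ a * f x else 0).
Proof.
move=> mq mf; apply: measurable_fun_ifT => //.
  by apply: (measurable_fun_bool true); rewrite setTI.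
by apply: measurable_funM => //; exact: measurable_powR.
Qed.

Lemma measurable_gamma_pdf : measurable_fun [set: R] p.
Proof.
rewrite (_ : p = fun x => if 0 < x then x `^ (alpha - 1) * (expR (- x) / Gamma alpha) else 0).
  apply: measurable_pos_powR; last by apply: cont_meas; contder.
  rewrite (_ : [set x | _] = `]0, +oo[%classic)//.
  by apply/seteqP; split => x /=; rewrite in_itv/= andbT.
by apply/funext => x; rewrite /gamma_pdf mulrA.
Qed.

Lemma gamma_pdf_ge0 x : 0 <= p x.
Proof.
rewrite /gamma_pdf; case: ifP => // _.
by rewrite mulr_ge0 ?invr_ge0 ?(ltW Gamma_gt0)// mulr_ge0 ?powR_ge0 ?expR_ge0.
Qed.

Lemma gamma_pdf_intble : @intble _ (measurableTypeR R) R lam p.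
Proof.
apply: ge0_intble; [exact: measurable_gamma_pdf|exact: gamma_pdf_ge0|].
by rewrite mass1 ltry.
Qed.

(** The weight t^(alpha - 1) on ]0, b]. The factor 1 makes the body an instance of
    measurable_pos_powR. *)
Definition cut_power (b t : R) := if 0 < t <= b then t `^ (alpha - 1) * 1 else 0.

Lemma cut_powerE b t : 0 < t <= b -> cut_power b t = t `^ (alpha - 1).
Proof. by rewrite /cut_power => ->; rewrite mulr1. Qed.

Lemma cut_power_ge0 b t : 0 <= cut_power b t.
Proof. by rewrite /cut_power; case: ifP => // _; rewrite mulr1 powR_ge0. Qed.

Lemma measurable_cut_power b : measurable_fun [set: R] (cut_power b).
Proof.
apply: measurable_pos_powR => //.
by rewrite (_ : [set x | _] = `]0, b]%classic).
Qed.

(** On ]0, b] the gamma density dominates a constant multiple of the weight. *)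
Lemma cut_power_intble b (phi : R -> R) (C : R) : measurable_fun [set: R] phi ->
  (forall t, 0 < t <= b -> `|phi t| <= C) ->
  @intble _ (measurableTypeR R) R lam (fun t => cut_power b t * phi t).
Proof.
move=> mphi phiC.
apply: (@intble_le _ (measurableTypeR R) R lam _
  (fun t => (`|C| * expR b * Gamma alpha) * p t)).
- by apply: measurable_funM => //; exact: measurable_cut_power.
- move=> t; have p0 := gamma_pdf_ge0 t; have G0 := Gamma_gt0.
  case: (boolP (0 < t <= b)) => [tb|/negbTE tb]; last first.
    by rewrite /cut_power tb mul0r normr0 !mulr_ge0 ?expR_ge0 ?(ltW G0).
  rewrite normrM ger0_norm ?cut_power_ge0// cut_powerE//.
  have /andP[t0 tb'] := tb.
  rewrite /gamma_pdf t0.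
  rewrite [leRHS](_ : _ = t `^ (alpha - 1) * (`|C| * (expR b * expR (- t)))); last first.
    by field; rewrite lt0r_neq0.
  apply: ler_wpM2l; first exact: powR_ge0.
  apply: (le_trans (phiC t tb)); apply: (le_trans (ler_norm C)).
  by rewrite ler_peMr// -expRD -[X in X <= _]expR0 ler_expR subr_ge0.
- apply: intbleZ; exact: gamma_pdf_intble.
Qed.

Lemma cut_power_cont (t : R) : 0 < t <= 1 -> {for t, continuous (cut_power 2)}.
Proof.
move=> /andP[t0 t1].
have cp : x `^ (alpha - 1) @[x --> t] --> t `^ (alpha - 1).
  by apply: der_cvg; exact: is_derive1_powR.
rewrite /prop_for /continuous_at cut_powerE; last by rewrite t0; lra.
apply: cvg_trans cp; apply: near_eq_cvg; near=> x; rewrite cut_powerE//.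
apply/andP; split; near: x.
  exact: lt_nbhsr.
by apply: filterS (@lt_nbhsl R t 2 _) => [x /ltW//|]; lra.
Unshelve. all: by end_near. Qed.

(** The fundamental theorem needs continuity at the right endpoint, so the weight cut
    at 2 is integrated up to 1. *)
Lemma cut_power_segment (phi : R -> R) :
  \int[lam]_(t in `]-oo, 1]) (cut_power 2 t * phi t) =
  \int[lam]_t (cut_power 1 t * phi t).
Proof.
rewrite Rintegral_mkcond; apply: eq_Rint => t; rewrite /restrict.
case: ifPn => [|]; rewrite ?inE ?notin_setE/= in_itv/= => t1.
  by rewrite /cut_power t1 (_ : t <= 2)//; lra.
by rewrite /cut_power (negbTE (introN idP t1)) andbF mul0r.
Qed.

Lemma inv_succ_powR a : 0 < a -> (n.+1%:R^-1 : R) `^ a @[n --> \oo] --> (0 : R).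
Proof.
move=> a0; have /cvg_at_rightP := powR_cvg0 a0.
by apply; split => [n|]; [rewrite invr_gt0|exact: cvg_inv_succ].
Qed.

Lemma cut_power_mass : \int[lam]_t cut_power 1 t = alpha^-1.
Proof.
transitivity (\int[lam]_(t in `]-oo, 1]) (cut_power 2 t * 1)).
  by rewrite cut_power_segment; apply: eq_Rint => t; rewrite mulr1.
transitivity (alpha^-1 * 1 `^ alpha); last by rewrite powR1 mulr1.
apply: (@FTC_from_zero R _ (fun t => alpha^-1 * t `^ alpha) 1) => //.
- apply: (@cut_power_intble _ (fun=> 1) 1); first exact: measurable_cst.
  by move=> t _; rewrite normr1.
- by move=> t t0; rewrite /cut_power ltNge t0 mul0r.
- by move=> t t1; apply: cvgM; [exact: cut_power_cont|exact: cvg_cst].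
- move=> t /andP[t0 t1]; eapply der_eq.
    by eapply derM; [apply: derC|exact: is_derive1_powR].
  rewrite cut_powerE; last by rewrite t0; lra.
  by rewrite mulr0 addr0 mulr1 mulrA mulVf ?mul1r// lt0r_neq0.
- rewrite -[X in _ --> X](mulr0 alpha^-1); apply: cvgMr; exact: inv_succ_powR.
Qed.

End gamma_weights.

Section gamma_kernel.
Context (R : realType) (alpha : R).
Hypothesis alpha0 : 0 < alpha.
Notation lam := (@lebesgue_measure R).
Notation p := (gamma_pdf alpha).
Hypothesis mass1 : (\int[lam]_x (p x)%:E = 1)%E.
Variables g g' : R -> R.
Hypotheses (dg : forall x : R, is_derive x 1 g (g' x)) (g2 : forall x, `|g x| <= 2)
  (g'2 : forall x, `|g' x| <= 2) (g'4 : forall x y, `|g' x - g' y| <= 4 * `|x - y|).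

Let w := cut_power alpha 1.
Let E (y t : R) := expR (y * (1 - t)) * g (y * t).
Let E' (y t : R) := expR (y * (1 - t)) * ((1 - t) * g (y * t) + t * g' (y * t)).

(** The solution of y psi' + (alpha - y) psi = g that is differentiable at 0. For y > 0
    it is y^(-alpha) e^y times the integral of g against x^(alpha - 1) e^(-x) over
    ]0, y]; the substitution x = y t removes the singularity at 0 and gives a formula
    that makes sense for y <= 0 as well. *)
Definition gamma_kernel (y : R) : R := \int[lam]_t (w t * E y t).
Definition gamma_kernel' (y : R) : R := \int[lam]_t (w t * E' y t).
Notation psi := gamma_kernel.
Notation psi' := gamma_kernel'.

Let cg : continuous g. Proof. by move=> x; exact: der_cvg. Qed.

Let cg' : continuous g'. Proof. exact: lipschitz_cont g'4. Qed.

Let cexpt (y : R) : continuous (fun t : R => expR (y * (1 - t))).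
Proof. contder. Qed.

Let cgt (f : R -> R) (y : R) : continuous f -> continuous (fun t : R => f (y * t)).
Proof.
move=> cf t; apply: (cvg_comp (fun t : R => y * t) f _ (cf (y * t))).
by apply: cvgM; [exact: cvg_cst|exact: cvg_id].
Qed.

Let cE y : continuous (E y).
Proof. by move=> t; apply: cvgM; [exact: cexpt|exact: cgt]. Qed.

Let c1B : continuous (fun t : R => 1 - t).
Proof. by move=> t; apply: cvgB; [exact: cvg_cst|exact: cvg_id]. Qed.

Let cE' y : continuous (E' y).
Proof.
move=> t; apply: cvgM; first exact: cexpt.
by apply: cvgD; apply: cvgM; [exact: c1B|exact: cgt|exact: cvg_id|exact: cgt].
Qed.

Let E_le (Y y t : R) : `|y| <= Y -> 0 < t <= 1 -> `|E y t| <= expR Y * 2.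
Proof.
move=> yY /andP[t0 t1]; rewrite normrM; apply: ler_pM => //.
rewrite ger0_norm ?expR_ge0// ler_expR (le_trans (ler_norm _))// normrM.
by rewrite (ger0_norm (_ : 0 <= 1 - t)) ?subr_ge0//; have := normr_ge0 y; nra.
Qed.

Let E'_le (y t : R) (Y : R) : `|y| <= Y -> 0 < t <= 1 -> `|E' y t| <= expR Y * 2.
Proof.
move=> yY /andP[t0 t1]; rewrite normrM; apply: ler_pM => //.
  rewrite ger0_norm ?expR_ge0// ler_expR (le_trans (ler_norm _))// normrM.
  by rewrite (ger0_norm (_ : 0 <= 1 - t)) ?subr_ge0//; have := normr_ge0 y; nra.
rewrite (le_trans (ler_normD _ _))// !normrM (ger0_norm (ltW t0)).
rewrite (ger0_norm (_ : 0 <= 1 - t)) ?subr_ge0//.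
by have := g2 (y * t); have := g'2 (y * t); nra.
Qed.

Let iE y : @intble _ (measurableTypeR R) R lam (fun t => w t * E y t).
Proof.
apply: (cut_power_intble mass1 (C := expR `|y| * 2)); first exact: cont_meas.
by move=> t t1; exact: E_le.
Qed.

Let iE' y : @intble _ (measurableTypeR R) R lam (fun t => w t * E' y t).
Proof.
apply: (cut_power_intble mass1 (C := expR `|y| * 2)); first exact: cont_meas.
by move=> t t1; exact: E'_le.
Qed.

Let w_le (phi : R -> R) (C t : R) : (0 < t <= 1 -> `|phi t| <= C) ->
  `|w t * phi t| <= w t * C.
Proof.
move=> h; rewrite normrM ger0_norm ?cut_power_ge0//.
case: (boolP (0 < t <= 1)) => t1; first by rewrite ler_wpM2l ?cut_power_ge0// h.
by rewrite /w /cut_power (negbTE t1) !mul0r.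
Qed.

Let iw C : @intble _ (measurableTypeR R) R lam (fun t => w t * C).
Proof.
apply: (cut_power_intble mass1 (C := `|C|)); first exact: measurable_cst.
by move=> t _.
Qed.

Let dE (t y : R) : is_derive y 1 (fun z => w t * E z t) (w t * E' y t).
Proof.
have d1 : is_derive y 1 (fun z : R => z * (1 - t)) (1 - t).
  by eapply der_eq; [dertac|rewrite /=; ring].
have d2 : is_derive y 1 (fun z : R => g (z * t)) (g' (y * t) * t).
  eapply (@der_comp R g (fun z => z * t)); first by apply: dg.
  by eapply der_eq; [dertac|rewrite /=; ring].
rewrite /E; eapply der_eq.
  eapply derM; [apply: derC|eapply derM; [eapply der_exp; exact: d1|exact: d2]].
by rewrite /E' /=; ring.
Qed.

Let Iy (y : R) : `]y - 1, y + 1[%classic y.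
Proof. by rewrite /= in_itv/= ltrBlDr ltrDl ltr01. Qed.

Let near_le (y z : R) : `]y - 1, y + 1[%classic z -> `|z| <= `|y| + 1.
Proof.
rewrite /= in_itv/= => /andP[h1 h2]; rewrite ler_norml.
by have := ler_norm y; have := ler_norm (- y); rewrite normrN => ? ?; apply/andP; split; lra.
Qed.

Lemma gamma_kernel_der (y : R) : is_derive y 1 psi (psi' y).
Proof.
pose f (z : R) (t : measurableTypeR R) : R := w t * E z t.
pose C := expR (`|y| + 1) * 2.
have ub (z : R) (t : measurableTypeR R) : `]y - 1, y + 1[%classic z -> setT t ->
    `|partial1of2 f z t| <= w t * C.
  move=> zI _; rewrite /partial1of2 (der_derive1 (dE t z)).
  by apply: w_le => t1; apply: E'_le => //; exact: near_le.
have wC (t : measurableTypeR R) : 0 <= w t * C.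
  by rewrite mulr_ge0 ?cut_power_ge0// mulr_ge0 ?expR_ge0.
have h1 := @differentiation_under_integral R _ (measurableTypeR R) lam f setT
  measurableT y (y - 1) (y + 1) (Iy y) (fun z _ => iE z)
  (fun z t _ _ => der_derivable (dE t z)) (fun t => w t * C) wC (iw C) ub.
have h2 := @derivable_under_integral R _ (measurableTypeR R) lam f setT
  measurableT y (y - 1) (y + 1) (Iy y) (fun z _ => iE z)
  (fun z t _ _ => der_derivable (dE t z)) (fun t => w t * C) wC (iw C) ub.
have := derivable_der h2; rewrite h1; move=> h; apply: der_eq h _.
by apply: eq_Rint => t; rewrite /partial1of2 (der_derive1 (dE t y)).
Qed.

Lemma gamma_kernel'_cont : continuous psi'.
Proof.
move=> y; pose f (z : R) (t : measurableTypeR R) : R := w t * E' z t.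
pose C := expR (`|y| + 1) * 2.
have ub (z : R) : `]y - 1, y + 1[%classic z ->
    {ae lam, forall t : measurableTypeR R, setT t -> `|f z t| <= w t * C}.
  by move=> zI; apply: aeW => t _; apply: w_le => t1; apply: E'_le => //; exact: near_le.
have cf : {ae lam, forall t : measurableTypeR R, setT t ->
    {in `]y - 1, y + 1[%classic, continuous (f ^~ t)}}.
  apply: aeW => t _ z _; apply: cvgM; first exact: cvg_cst.
  have cz (h : R -> R) : continuous h -> {for z, continuous (fun x : R => h (x * t))}.
    move=> ch; apply: (cvg_comp (fun x : R => x * t) h _ (ch (z * t))).
    by apply: cvgM; [exact: cvg_id|exact: cvg_cst].
  apply: cvgM.
    apply: (cvg_comp (fun x : R => x * (1 - t)) expR _ (@continuous_expR R _)).
    by apply: cvgM; [exact: cvg_id|exact: cvg_cst].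
  apply: cvgD; apply: cvgM; [exact: cvg_cst|exact: cz|exact: cvg_cst|exact: cz].
have := @continuity_under_integral R _ (measurableTypeR R) lam f setT measurableT
  (y - 1) (y + 1) (fun z _ => iE' z) cf (fun t => w t * C) (iw C) ub.
by move=> /(_ y); apply; rewrite inE.
Qed.

(** The integrand of y psi' + (alpha - y) psi is the derivative in t of
    t^alpha e^{y (1 - t)} g (y t). *)
Lemma gamma_kernel_eq (y : R) : y * psi' y + (alpha - y) * psi y = g y.
Proof.
pose phi t := expR (y * (1 - t)) * (alpha * g (y * t) - t * y * g (y * t) + t * y * g' (y * t)).
have cphi : continuous phi.
  have ct : continuous (fun t : R => t * y).
    by move=> t; apply: cvgM; [exact: cvg_id|exact: cvg_cst].
  move=> t; apply: cvgM; first exact: cexpt.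
  apply: cvgD; last by apply: cvgM; [exact: ct|exact: cgt].
  apply: cvgB; apply: cvgM; [exact: cvg_cst|exact: cgt|exact: ct|exact: cgt].
transitivity (\int[lam]_t (w t * phi t)).
  have h1 := @RintZ _ (measurableTypeR R) R lam y _ (iE' y).
  have h2 := @RintZ _ (measurableTypeR R) R lam (alpha - y) _ (iE y).
  rewrite /psi /psi' -h1 -h2 -(@RintD _ (measurableTypeR R) R lam).
  - by apply: eq_Rint => t; rewrite /phi /E /E'; ring.
  - exact: (intbleZ y (iE' y)).
  - exact: (intbleZ (alpha - y) (iE y)).
rewrite -cut_power_segment.
transitivity (1 `^ alpha * (expR (y * (1 - 1)) * g (y * 1))); last first.
  by rewrite powR1 subrr mulr0 expR0 !mul1r mulr1.
apply: (@FTC_from_zero R _ (fun t => t `^ alpha * E y t) 1) => //.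
- apply: (cut_power_intble mass1 (C := expR (`|y| * 1) * ((alpha + 4 * `|y|) * 2)));
    first exact: cont_meas.
  move=> t /andP[t0 t2]; rewrite normrM; apply: ler_pM => //.
    rewrite ger0_norm ?expR_ge0// ler_expR (le_trans (ler_norm _))// normrM.
    by rewrite ler_wpM2l// ler_norml; apply/andP; split; lra.
  have ht (z : R) : `|z| <= 2 -> `|t * y * z| <= 4 * `|y|.
    move=> z2; rewrite !normrM (gtr0_norm t0) mulrAC; apply: ler_wpM2r => //.
    by rewrite (_ : 4 = 2 * 2); [apply: ler_pM => //; exact: ltW|ring].
  have h1 := ht _ (g2 (y * t)); have h2 := ht _ (g'2 (y * t)).
  apply: (le_trans (ler_normD _ _)); apply: (le_trans (lerD (ler_normB _ _) (lexx _))).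
  have : `|alpha * g (y * t)| <= alpha * 2.
    by rewrite normrM (gtr0_norm alpha0) ler_pM2l.
  lra.
- by move=> t t0; rewrite /cut_power ltNge t0 mul0r.
- by move=> t t1; apply: cvgM; [exact: cut_power_cont|exact: cphi].
- move=> t /andP[t0 t1].
  have d1 : is_derive t 1 (fun t : R => y * (1 - t)) (- y).
    by eapply der_eq; [dertac|rewrite /=; ring].
  have d2 : is_derive t 1 (fun t : R => g (y * t)) (g' (y * t) * y).
    eapply (@der_comp R g (fun t => y * t)); first by apply: dg.
    by eapply der_eq; [dertac|rewrite /=; ring].
  rewrite /E; eapply der_eq.
    eapply derM; [exact: is_derive1_powR|eapply derM; [eapply der_exp; exact: d1|exact: d2]].
  rewrite cut_powerE; last by rewrite t0; lra.
  by rewrite /= -(mulr_powRB1 (ltW t0) alpha0) /phi; ring.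
- rewrite -[X in _ --> X](mul0r (E y 0)); apply: cvgM; first exact: inv_succ_powR.
  apply: (cvg_comp (fun n : nat => n.+1%:R^-1 : R) (E y)); first exact: cvg_inv_succ.
  exact: cE.
Qed.

(** On the negative half-line the exponential factor is at most 1. *)
Lemma gamma_kernel'_neg (y : R) : y <= 0 -> `|psi' y| <= 2 / alpha.
Proof.
move=> y0; have h := @Rint_abs_le _ (measurableTypeR R) R lam _ _ (iw 2) (intble_meas (iE' y)) _.
apply: (le_trans (h _)).
  move=> t; apply: w_le => /andP[t0 t1]; rewrite normrM -[leRHS]mul1r; apply: ler_pM => //.
    rewrite ger0_norm ?expR_ge0// -[leRHS]expR0 ler_expR; nra.
  rewrite (le_trans (ler_normD _ _))// !normrM (ger0_norm (ltW t0)).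
  rewrite (ger0_norm (_ : 0 <= 1 - t)) ?subr_ge0//.
  by have := g2 (y * t); have := g'2 (y * t); nra.
have -> : \int[lam]_t (w t * 2) = 2 * \int[lam]_t w t.
  rewrite -(@RintZ _ (measurableTypeR R) R lam 2 w); last first.
    by have := iw 1; apply: eq_intble => t; rewrite mulr1.
  by apply: eq_Rint => t; rewrite mulrC.
by rewrite /w cut_power_mass.
Qed.

Hypothesis centered : \int[lam]_x (g x * p x) = 0.

(** Both sides vanish at 0 and have the same derivative, by gamma_kernel_eq. *)
Lemma gamma_kernel_scaled (y : R) : 0 < y ->
  y `^ alpha * expR (- y) * psi y = Gamma alpha * \int[lam]_(x in `]-oo, y]) (g x * p x).
Proof.
move=> y0; have G0 := Gamma_gt0 mass1.
apply: (mulfI (lt0r_neq0 (_ : 0 < (Gamma alpha)^-1))); rewrite ?invr_gt0//.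
rewrite mulrA [RHS]mulrA mulVf ?lt0r_neq0// mul1r.
apply/esym; transitivity ((fun t => (Gamma alpha)^-1 * (t `^ alpha * expR (- t)) * psi t) y);
  last by rewrite !mulrA.
apply: (@FTC_from_zero R (fun x => g x * p x)
  (fun t => (Gamma alpha)^-1 * (t `^ alpha * expR (- t)) * psi t) y) => //.
- apply: (@intble_le _ (measurableTypeR R) R lam _ (fun t => 2 * p t)).
  + apply: measurable_funM; [exact: cont_meas|exact: measurable_gamma_pdf].
  + move=> t; have p0 := gamma_pdf_ge0 mass1 t; rewrite normrM (ger0_norm p0).
    by rewrite ler_wpM2r.
  + by apply: intbleZ; exact: gamma_pdf_intble.
- by move=> t t0; rewrite /gamma_pdf ltNge t0 mulr0.
- move=> t /andP[t0 _]; apply: cvgM; first exact: cg.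
  have cp : (x `^ (alpha - 1) * expR (- x) / Gamma alpha) @[x --> t] -->
      t `^ (alpha - 1) * expR (- t) / Gamma alpha.
    apply: cvgM; last exact: cvg_cst.
    apply: cvgM; first by apply: der_cvg; exact: is_derive1_powR.
    by apply: (cvg_comp _ expR (cvgN cvg_id)); exact: continuous_expR.
  rewrite {2}/gamma_pdf t0; apply: cvg_trans cp; apply: near_eq_cvg; near=> x.
  rewrite /gamma_pdf ifT//; near: x; exact: lt_nbhsr.
- move=> t /andP[t0 _]; eapply der_eq.
    eapply derM; last exact: gamma_kernel_der.
    eapply derM; [apply: derC|eapply derM; [exact: is_derive1_powR|]].
    by eapply der_exp; eapply derN; apply: derid.
  rewrite /gamma_pdf t0 -(gamma_kernel_eq t) /= -(mulr_powRB1 (ltW t0) alpha0); ring.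
- have -> : 0 = (Gamma alpha)^-1 * (0 * expR (- 0)) * psi 0 by rewrite mul0r mulr0 mul0r.
  apply: cvgM; last first.
    apply: (cvg_comp (fun n : nat => n.+1%:R^-1) psi (@cvg_inv_succ R)).
    exact: der_cvg (gamma_kernel_der 0).
  apply: cvgMr; apply: cvgM; first exact: inv_succ_powR.
  apply: (cvg_comp _ (fun x : R => expR (- x)) (@cvg_inv_succ R)).
  by apply: (cvg_comp _ expR (cvgN cvg_id)); exact: continuous_expR.
Unshelve. all: by end_near. Qed.

(** This is where the centering of g enters: the scaled kernel also vanishes at +oo. *)
Lemma gamma_kernel_scaled_cvg :
  n.+1%:R `^ alpha * expR (- n.+1%:R) * psi n.+1%:R @[n --> \oo] --> (0 : R).
Proof.
rewrite (_ : (fun n => _) = fun n : nat =>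
    Gamma alpha * \int[lam]_(x in `]-oo, n.+1%:R]) (g x * p x)); last first.
  by apply/funext => n; rewrite gamma_kernel_scaled.
rewrite -(mulr0 (Gamma alpha)) -centered; apply: cvgMr.
rewrite (cvg_shiftS (fun n : nat => \int[lam]_(x in `]-oo, n%:R]) (g x * p x))).
apply: primitive_cvgy.
apply: (@intble_le _ (measurableTypeR R) R lam _ (fun t => 2 * p t)).
- apply: measurable_funM; [exact: cont_meas|exact: measurable_gamma_pdf].
- move=> t; have p0 := gamma_pdf_ge0 mass1 t; rewrite normrM (ger0_norm p0).
  by rewrite ler_wpM2r.
- by apply: intbleZ; exact: gamma_pdf_intble.
Qed.

End gamma_kernel.

Section gamma_maximum_principles.
Context (R : realType).

Lemma near_succ_gt (x : R) : \forall n \near \oo, x < n.+1%:R.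
Proof.
by apply: filterS (nbhs_infty_gtr x) => n /lt_le_trans; apply; rewrite ler_nat.
Qed.

Lemma powR_expR_cvg (a : R) : 0 < a ->
  n.+1%:R `^ a * expR (- n.+1%:R) @[n --> \oo] --> (0 : R).
Proof.
move=> a0; pose C := expR (a * ln (2 * a)) : R.
apply: (@squeeze_cvgr _ _ _ _ (fun=> 0) (fun n => (C * 2) * n.+1%:R^-1)).
- apply: nearW => n; rewrite mulr_ge0 ?powR_ge0 ?expR_ge0//=.
  have n0 : 0 < n.+1%:R :> R by [].
  move: n.+1%:R n0 => x x0.
  have a20 : 0 < 2 * a by rewrite mulr_gt0.
  (* ln z <= z at z = x / (2 a) gives x^a <= (2 a)^a e^(x / 2). *)
  have h1 : x `^ a <= C * expR (x / 2).
    rewrite /powR gt_eqF// /C -expRD ler_expR.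
    have xa : 0 < x / (2 * a) by rewrite divr_gt0.
    have := ltW (ln_sublinear xa); rewrite ln_div ?posrE// => h.
    have := ler_wpM2l (ltW a0) h.
    have -> : a * (x / (2 * a)) = x / 2 by field; rewrite lt0r_neq0.
    lra.
  have h2 : expR (x / 2) * expR (- x) <= 2 / x.
    rewrite -expRD (_ : x / 2 - x = - (x / 2)); last by field.
    rewrite expRN -[leRHS]invrK invf_div lef_pV2 ?posrE ?expR_gt0 ?divr_gt0//.
    by have := expR_ge1Dx (x / 2); lra.
  apply: (@le_trans _ _ (C * expR (x / 2) * expR (- x))); first by rewrite ler_wpM2r ?expR_ge0.
  by rewrite -mulrA -mulrA ler_wpM2l ?expR_ge0.
- exact: cvg_cst.
- rewrite -[X in _ --> X](mulr0 (C * 2)); apply: cvgMr; exact: cvg_inv_succ.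
Qed.

Lemma scaled_cvg0 (a : R) (chi : R -> R) : 0 < a -> {for 0, continuous chi} ->
  n.+1%:R^-1 `^ a * expR (- n.+1%:R^-1) * chi n.+1%:R^-1 @[n --> \oo] --> (0 : R).
Proof.
move=> a0 cchi; have -> : 0 = 0 * expR (- 0) * chi 0 by rewrite !mul0r.
apply: cvgM; last exact: (cvg_comp (fun n : nat => n.+1%:R^-1) chi (@cvg_inv_succ R)).
apply: cvgM; first exact: inv_succ_powR.
apply: (cvg_comp _ (fun x : R => expR (- x)) (@cvg_inv_succ R)).
by apply: (cvg_comp _ expR (cvgN cvg_id)); exact: continuous_expR.
Qed.

(** Solutions chi of y chi' + (a - y) chi = q are studied through their scaling
    m = y^a e^(-y) chi, whose derivative y^(a - 1) e^(-y) q has the sign of q, and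
    which vanishes at both ends of ]0, +oo[. *)
Variables (a : R) (chi chi' q : R -> R).
Hypothesis a0 : 0 < a.
Hypothesis dchi : forall y : R, 0 < y -> is_derive y 1 chi (chi' y).
Hypothesis eq_chi : forall y, 0 < y -> y * chi' y + (a - y) * chi y = q y.
Let m (y : R) := y `^ a * expR (- y) * chi y.
Hypotheses (m0 : m n.+1%:R^-1 @[n --> \oo] --> (0 : R))
  (moo : m n.+1%:R @[n --> \oo] --> (0 : R)).

Let e0 (y : R) b : 0 < y -> 0 < y `^ b * expR (- y).
Proof. by move=> y0; rewrite mulr_gt0 ?powR_gt0 ?expR_gt0. Qed.

Let dm (y : R) : 0 < y -> is_derive y 1 m (y `^ (a - 1) * expR (- y) * q y).
Proof.
move=> y0; rewrite /m; eapply der_eq.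
  eapply derM; last by apply: dchi.
  eapply derM; first exact: is_derive1_powR.
  by eapply der_exp; eapply derN; apply: derid.
by rewrite /= -(eq_chi y0) -(mulr_powRB1 (ltW y0) a0); ring.
Qed.

(** Where q <= 0 the scaled function has decreased from 0; where q >= 0 it is about to
    increase to 0. *)
Lemma nondecreasing_source_nonpos : (forall y z, 0 < y -> y <= z -> q y <= q z) ->
  forall y, 0 < y -> chi y <= 0.
Proof.
move=> qmono y y0; rewrite -(pmulr_rle0 _ (e0 a y0)) -/(m y).
have [qy|/ltW qy] := leP (q y) 0.
  apply: (cvgr_to_ge m0); near=> n.
  have n0 : 0 < n.+1%:R^-1 :> R by rewrite invr_gt0.
  have ny : n.+1%:R^-1 <= y by near: n; exact: (cvgr_le _ (@cvg_inv_succ R)).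
  rewrite -lerN2.
  apply: (@der_nondecreasing R (fun x => - m x)
    (fun x => - (x `^ (a - 1) * expR (- x) * q x))) => // x /andP[nx xy].
    by have x0 := lt_le_trans n0 nx; eapply derN; exact: dm.
  have x0 := lt_le_trans n0 nx.
  by rewrite oppr_ge0 pmulr_rle0 ?e0// (le_trans _ qy)// qmono.
apply: (cvgr_to_ge moo); near=> n.
have yn : y <= n.+1%:R by apply: ltW; near: n; exact: near_succ_gt.
apply: (@der_nondecreasing R m (fun x => x `^ (a - 1) * expR (- x) * q x)) => // x /andP[yx xn].
  by apply: dm; exact: lt_le_trans yx.
have x0 := lt_le_trans y0 yx.
by rewrite mulr_ge0 ?(ltW (e0 _ _))// (le_trans qy)// qmono.
Unshelve. all: by end_near. Qed.

(** At a positive maximum of the scaled function the source vanishes and, growing at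
    least as fast as the primitive G of chi > 0, is positive just after, so that the
    scaled function would increase further. *)
Lemma growing_source_nonpos (G : R -> R) :
  (forall y : R, 0 < y -> is_derive y 1 G (chi y)) ->
  (forall y z, 0 < y -> y <= z -> G z - G y <= q z - q y) ->
  forall y, 0 < y -> chi y <= 0.
Proof.
move=> dG grow y0 y00; rewrite leNgt; apply/negP => chi0.
have my0 : 0 < m y0 by rewrite mulr_gt0 ?e0.
(* m vanishes at both ends, so on a large enough segment its maximum is interior. *)
have [n1 [mx0 xy0]] : exists n : nat, m n.+1%:R^-1 < m y0 /\ n.+1%:R^-1 < y0.
  apply: (@filter_ex _ \oo); apply: filterI; first exact: (cvgr_lt _ m0).
  exact: (cvgr_lt _ (@cvg_inv_succ R)).
have [n2 [mz0 yz0]] : exists n : nat, m n.+1%:R < m y0 /\ y0 < n.+1%:R.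
  apply: (@filter_ex _ \oo); apply: filterI; first exact: (cvgr_lt _ moo).
  exact: near_succ_gt.
set x0 := n1.+1%:R^-1 in mx0 xy0; set z0 := n2.+1%:R in mz0 yz0.
have x00 : 0 < x0 by rewrite invr_gt0.
have cm : {within `[x0, z0], continuous m}.
  apply: derivable_within_continuous => x; rewrite in_itv/= => /andP[xx _].
  exact: der_derivable (dm (lt_le_trans x00 xx)).
have [c] := EVT_max (ltW (lt_trans xy0 yz0)) cm.
rewrite in_itv/= => /andP[xc cz] cmax.
have mc : m y0 <= m c by apply: cmax; rewrite in_itv/= !ltW.
have {}xc : x0 < c.
  rewrite lt_neqAle xc andbT; apply/eqP => E; move: mc; rewrite -E leNgt mx0//.
have {}cz : c < z0.
  rewrite lt_neqAle cz andbT; apply/eqP => E; move: mc; rewrite E leNgt mz0//.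
have c0 := lt_trans x00 xc.
have cI : c \in `]x0, z0[ by rewrite in_itv/= xc.
have d0 : is_derive c 1 m 0.
  apply: (derive1_at_max (ltW (lt_trans xy0 yz0))) => // t; rewrite in_itv/= => /andP[xt tz].
    exact: der_derivable (dm (lt_trans x00 xt)).
  by apply: cmax; rewrite in_itv/= !ltW.
have qc : q c = 0.
  have := der_derive1 d0; rewrite (der_derive1 (dm c0)) => /eqP.
  by rewrite mulf_eq0 (gt_eqF (e0 _ c0))/= => /eqP.
have chic : 0 < chi c.
  by rewrite -(pmulr_rgt0 _ (e0 a c0)) (lt_le_trans my0).
have : \forall x \near c, 0 < chi x /\ x < z0.
  apply: filterI; last exact: lt_nbhsl.
  exact: (cvgr_gt _ (der_cvg (dchi c0))).
move=> /nbhs_ballP[e /= e_gt0 eP].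
pose z := c + e / 2.
have cz1 : c < z by rewrite ltrDl divr_gt0.
have inB x : c <= x <= z -> 0 < chi x /\ x < z0.
  move=> /andP[cx xz]; apply: eP; rewrite -ball_normE/= ltr_norml; rewrite /z in xz.
  by apply/andP; split; lra.
have pos x : c <= x -> 0 < x by exact: lt_le_trans.
have cont_on (f f' : R -> R) (x y : R) : c <= x ->
    (forall t : R, 0 < t -> is_derive t 1 f (f' t)) -> {within `[x, y], continuous f}.
  move=> cx df; apply: derivable_within_continuous => t; rewrite in_itv/= => /andP[xt _].
  by apply: (der_derivable (df t _)); apply: pos; exact: le_trans xt.
have qpos x : c < x <= z -> 0 < q x.
  move=> /andP[cx xz].
  have [t|t] := @MVT R G chi c x cx _ (cont_on _ _ _ _ (lexx c) dG).
    by rewrite in_itv/= => /andP[ct _]; apply: dG; apply: pos; exact: ltW.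
  rewrite in_itv/= => /andP[ct tx] Gt.
  have := grow c x c0 (ltW cx); rewrite qc subr0; apply: lt_le_trans.
  rewrite Gt mulr_gt0 ?subr_gt0//.
  by apply: (inB t _).1; rewrite !ltW// (lt_le_trans tx).
have [t|t] := @MVT R m (fun y => y `^ (a - 1) * expR (- y) * q y) c z cz1 _
    (cont_on _ _ _ _ (lexx c) dm).
  by rewrite in_itv/= => /andP[ct _]; apply: dm; apply: pos; exact: ltW.
rewrite in_itv/= => /andP[ct tz] mt.
have : m z <= m c.
  apply: cmax; rewrite in_itv/=; apply/andP; split; first exact/ltW/(lt_trans xc).
  by apply/ltW/(inB z _).2; rewrite lexx ltW.
rewrite leNgt -subr_gt0 mt mulr_gt0 ?subr_gt0//.
rewrite mulr_gt0 ?e0 ?(lt_trans c0 ct)//.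
by apply: qpos; rewrite ct ltW.
Qed.

End gamma_maximum_principles.

Section gamma_kernel_bounds.
Context (R : realType) (alpha : R).
Hypothesis alpha0 : 0 < alpha.
Notation lam := (@lebesgue_measure R).
Notation p := (gamma_pdf alpha).
Hypothesis mass1 : (\int[lam]_x (p x)%:E = 1)%E.
Variables g g' : R -> R.
Hypotheses (dg : forall x : R, is_derive x 1 g (g' x)) (g2 : forall x, `|g x| <= 2)
  (g'2 : forall x, `|g' x| <= 2) (g'4 : forall x y, `|g' x - g' y| <= 4 * `|x - y|).
Hypothesis centered : \int[lam]_x (g x * p x) = 0.
Notation psi := (gamma_kernel alpha g).
Notation psi' := (gamma_kernel' alpha g g').

Let dpsi (y : R) : is_derive y 1 psi (psi' y).
Proof. exact: gamma_kernel_der. Qed.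

Let psi_eq y : y * psi' y + (alpha - y) * psi y = g y.
Proof. exact: gamma_kernel_eq. Qed.

Let cpsi' : continuous psi'. Proof. exact: (gamma_kernel'_cont mass1 dg g2 g'2 g'4). Qed.

Let psi_oo : n.+1%:R `^ alpha * expR (- n.+1%:R) * psi n.+1%:R @[n --> \oo] --> (0 : R).
Proof. exact: (gamma_kernel_scaled_cvg alpha0 mass1 dg g2 g'2 g'4 centered). Qed.

(** The maximum principle for s psi - 2, with s = 1 or -1: as g is 2-Lipschitz, the
    source s g - 2 (alpha - y) is nondecreasing. *)
Lemma gamma_kernel_le2 y : 0 < y -> `|psi y| <= 2.
Proof.
move=> y0; have key (s : R) : `|s| = 1 -> s * psi y - 2 <= 0.
  move=> s1; apply: (@nondecreasing_source_nonpos R alpha (fun y => s * psi y - 2)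
    (fun y => s * psi' y) (fun y => s * g y - 2 * (alpha - y))) => //.
  - move=> z z0; eapply der_eq.
      by eapply derD; [eapply derM; [apply: derC|exact: dpsi]|apply: derC].
    by rewrite /=; ring.
  - by move=> z z0; rewrite -psi_eq; ring.
  - apply: (@scaled_cvg0 R alpha (fun y => s * psi y - 2)) => //.
    apply: cvgB; last exact: cvg_cst.
    by apply: cvgM; [exact: cvg_cst|exact: der_cvg (dpsi 0)].
  - rewrite (_ : (fun n => _) = fun n : nat =>
        s * (n.+1%:R `^ alpha * expR (- n.+1%:R) * psi n.+1%:R) -
        2 * (n.+1%:R `^ alpha * expR (- n.+1%:R))); last by apply/funext => n; ring.
    rewrite -[X in _ --> X](subr0 0) -{1}(mulr0 s) -[X in _ --> _ - X](mulr0 2).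
    by apply: cvgB; apply: cvgMr => //; exact: powR_expR_cvg.
  - move=> x z x0 xz; have := mvt_lip dg g'2 x z.
    rewrite (distrC x) (ger0_norm (_ : 0 <= z - x)) ?subr_ge0// => h.
    have : `|s * (g x - g z)| <= 2 * (z - x) by rewrite normrM s1 mul1r.
    by move/(le_trans (ler_norm _)); lra.
have h1 := key 1 (normr1 _); have h2 := key (-1) (normrN1 _).
by rewrite ler_norml; apply/andP; split; lra.
Qed.

Let psi'' (y : R) := (g' y + psi y - (alpha + 1 - y) * psi' y) / y.

Let dpsi' (y : R) : 0 < y -> is_derive y 1 psi' (psi'' y).
Proof.
move=> y0; pose F (z : R) := (g z - (alpha - z) * psi z) / z.
have dF : is_derive y 1 F (psi'' y).
  have yN0 : y != 0 by rewrite gt_eqF.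
  rewrite /F; eapply der_eq.
    eapply derM; last by eapply (@derV R (fun z : R => z) y _ yN0); exact: derid.
    eapply derD; first by apply: dg.
    eapply derN; eapply derM; last by apply: dpsi.
    by eapply derD; [apply: derC|eapply derN; apply: derid].
  rewrite /psi'' /= -(psi_eq y); field.
  by [].
apply: near_eq_is_derive dF.
near=> z; have z0 : 0 < z by near: z; exact: lt_nbhsr.
by rewrite /F -(psi_eq z) addrK mulrC mulKf// gt_eqF.
Unshelve. all: by end_near. Qed.

(** Differentiating the equation shows that psi' solves an equation of the same form,
    with alpha + 1 in place of alpha and source g' + psi. Hence s psi' - 2 has source
    s (g' + psi) - 2 (alpha + 1 - y), which grows at least as fast as the primitive
    s psi - 2 y of s psi' - 2: their difference s g' + 4 y - 2 (alpha + 1) is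
    nondecreasing because g' is 4-Lipschitz. *)
Lemma gamma_kernel'_pos y : 0 < y -> `|psi' y| <= 2.
Proof.
move=> y0; have key (s : R) : `|s| = 1 -> s * psi' y - 2 <= 0.
  move=> s1; apply: (@growing_source_nonpos R (alpha + 1) (fun y => s * psi' y - 2)
    (fun y => s * psi'' y)
    (fun y => s * (g' y + psi y) - 2 * (alpha + 1 - y)) _ _ _ _ _
    (fun y => s * psi y - 2 * y)) => //.
  - by rewrite addr_gt0.
  - move=> z z0; have dz := dpsi' z0; eapply der_eq.
      by eapply derD; [eapply derM; [apply: derC|exact: dz]|apply: derC].
    by rewrite /=; ring.
  - move=> z z0; rewrite /psi''; field.
    by rewrite gt_eqF.
  - apply: (@scaled_cvg0 R (alpha + 1) (fun y => s * psi' y - 2)); first by rewrite addr_gt0.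
    apply: cvgB; last exact: cvg_cst.
    by apply: cvgM; [exact: cvg_cst|exact: cpsi'].
  - pose e b (n : nat) : R := n.+1%:R `^ b * expR (- n.+1%:R).
    have a10 : 0 < alpha + 1 by rewrite addr_gt0.
    have L : (2 + 2 * alpha) * e alpha n + 4 * e (alpha + 1) n @[n --> \oo] --> (0 : R).
      rewrite -[X in _ --> X](addr0 0) -{1}(mulr0 (2 + 2 * alpha)) -[X in _ --> _ + X](mulr0 4).
      by apply: cvgD; apply: cvgMr; exact: powR_expR_cvg.
    apply/norm_cvg0P; apply: (@squeeze_cvgr _ _ _ _ (fun=> 0) (fun n => (2 + 2 * alpha) * e alpha n + 4 * e (alpha + 1) n)); [|exact: cvg_cst|exact: L].
    apply: nearW => n; rewrite normr_ge0/=.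
    have x0 : 0 < n.+1%:R :> R by [].
    rewrite /e; move: n.+1%:R x0 => x x0.
    have xa : x `^ (alpha + 1) = x * x `^ alpha.
      by rewrite powRD ?powRr1 1?mulrC// ?ltW// (gt_eqF x0) implybT.
    have E0 : 0 <= x `^ alpha * expR (- x) by rewrite mulr_ge0 ?powR_ge0 ?expR_ge0.
    rewrite xa.
    (* The equation expresses x psi' x through psi x, which is bounded by 2. *)
    have -> : x * x `^ alpha * expR (- x) * (s * psi' x - 2) =
      x `^ alpha * expR (- x) * (s * (g x - (alpha - x) * psi x) - 2 * x).
      by rewrite -psi_eq; ring.
    rewrite normrM (ger0_norm E0).
    have -> : (2 + 2 * alpha) * (x `^ alpha * expR (- x)) + 4 * (x * x `^ alpha * expR (- x)) =
      x `^ alpha * expR (- x) * (2 + 2 * alpha + 4 * x) by ring.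
    apply: ler_wpM2l => //.
    apply: (le_trans (ler_normB _ _)); rewrite normrM s1 mul1r (ger0_norm (_ : 0 <= 2 * x)); last first.
      by rewrite mulr_ge0// ltW.
    have h := ler_normB (g x) ((alpha - x) * psi x).
    have : `|(alpha - x) * psi x| <= (alpha + x) * 2.
      rewrite normrM; apply: ler_pM => //; last exact: gamma_kernel_le2.
      by rewrite (le_trans (ler_normB _ _))// (gtr0_norm alpha0) (gtr0_norm x0).
    have := g2 x; lra.
  - move=> z z0; eapply der_eq.
      by eapply derD; [eapply derM; [apply: derC|exact: dpsi]|eapply derN; eapply derM; [apply: derC|apply: derid]].
    by rewrite /=; ring.
  - move=> x z x0 xz.
    have : `|s * (g' x - g' z)| <= 4 * (z - x).
      by rewrite normrM s1 mul1r (le_trans (g'4 _ _))// distrC ger0_norm// subr_ge0.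
    by move/(le_trans (ler_norm _)); lra.
have h1 := key 1 (normr1 _); have h2 := key (-1) (normrN1 _).
by rewrite ler_norml; apply/andP; split; lra.
Qed.

Lemma gamma_kernel'_bound y : `|psi' y| <= Num.max 2 (2 / alpha).
Proof.
rewrite le_max; have [y0|y0] := leP y 0; apply/orP; [right|left].
  exact: (gamma_kernel'_neg alpha0 mass1 dg g2 g'2 g'4).
exact: gamma_kernel'_pos.
Qed.

End gamma_kernel_bounds.

Section gamma_stein_equation.
Context (R : realType) (nu : R).
Hypothesis nu0 : 0 < nu.
Notation lam := (@lebesgue_measure R).
Notation p := (gamma_pdf (nu / 2)).
Hypothesis mass1 : (\int[lam]_x (p x)%:E = 1)%E.
Variables h h' : R -> R.
Hypotheses (dh : forall x : R, is_derive x 1 h (h' x)) (h1 : forall x, `|h x| <= 1)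
  (h'1 : forall x, `|h' x| <= 1) (h'L : forall x y, `|h' x - h' y| <= `|x - y|).
Notation c := (\int[lam]_x (h (2 * x - nu) * p x)).

(** The affine map x = 2 y - nu relates the centered gamma law to the gamma law of
    parameter nu / 2, whose kernel psi gives the solution f x = psi (y) / 2. The
    chain rule yields f' x = psi' (y) / 4, bounded by max (2, 4 / nu) / 4. *)
Lemma gamma_stein_solution : exists f f' : R -> R,
  [/\ forall x : R, is_derive x 1 f (f' x), continuous f',
      forall x, `|f' x| <= Num.max 1 (nu^-1) &
      forall x, (2 * x + 2 * nu) * f' x - x * f x = h x - c].
Proof.
have a0 : 0 < nu / 2 by rewrite divr_gt0.
have pi := gamma_pdf_intble mass1; have mp := measurable_gamma_pdf (nu / 2).
have p1 : \int[lam]_x p x = 1 by rewrite /Rintegral mass1.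
have dk (x : R) : is_derive x 1 (fun x => h (2 * x - nu)) (2 * h' (2 * x - nu)).
  eapply der_eq.
    eapply (@der_comp R h (fun x => 2 * x - nu)); first by apply: dh.
    by dertac.
  by rewrite /=; ring.
have mk : measurable_fun [set: R] (fun x => h (2 * x - nu)).
  by apply: cont_meas => x; exact: der_cvg.
have kpi : @intble _ (measurableTypeR R) R lam (fun x => h (2 * x - nu) * p x).
  apply: (@intble_le _ (measurableTypeR R) R lam _ p) => //; first exact: measurable_funM.
  move=> x; rewrite normrM (ger0_norm (gamma_pdf_ge0 mass1 x)).
  by rewrite ler_piMl// (gamma_pdf_ge0 mass1).
have c1 : `|c| <= 1.
  rewrite -[leRHS]p1; apply: (@Rint_abs_le _ (measurableTypeR R) R lam) => //; first exact: (intble_meas kpi).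
  move=> x; rewrite normrM (ger0_norm (gamma_pdf_ge0 mass1 x)).
  by rewrite ler_piMl// (gamma_pdf_ge0 mass1).
pose g x := h (2 * x - nu) - c; pose g' x := 2 * h' (2 * x - nu).
have dg (x : R) : is_derive x 1 g (g' x).
  by rewrite /g; eapply der_eq; [eapply derD; [exact: dk|apply: derC]|rewrite addr0].
have g2 x : `|g x| <= 2.
  by rewrite (le_trans (ler_normB _ _))// (_ : 2 = 1 + 1)// lerD.
have g'2 x : `|g' x| <= 2 by rewrite normrM (ger0_norm (ler0n R 2)) ler_piMr.
have g'4 x y : `|g' x - g' y| <= 4 * `|x - y|.
  rewrite -mulrBr normrM (ger0_norm (ler0n R 2)) (_ : 4 = 2 * 2); last by ring.
  rewrite -mulrA ler_wpM2l//; apply: (le_trans (h'L _ _)).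
  rewrite (_ : _ - _ = 2 * (x - y)); last by ring.
  by rewrite normrM (ger0_norm (ler0n R 2)).
have centered : \int[lam]_x (g x * p x) = 0.
  transitivity (\int[lam]_x (h (2 * x - nu) * p x - c * p x)).
    by apply: eq_Rint => x; rewrite /g mulrBl.
  rewrite (@RintB _ (measurableTypeR R) R lam)//; last exact: (intbleZ c pi).
  by rewrite (@RintZ _ (measurableTypeR R) R lam)// p1 mulr1 subrr.
pose s (x : R) := 2^-1 * (x + nu).
have ds (x : R) : is_derive x 1 s 2^-1.
  by rewrite /s; eapply der_eq; [dertac|rewrite /=; ring].
have sE x : 2 * s x - nu = x by rewrite /s; field.
exists (fun x => gamma_kernel (nu / 2) g (s x) / 2),
  (fun x => gamma_kernel' (nu / 2) g g' (s x) / 4); split.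
- move=> x; eapply der_eq.
    eapply derM; last by apply: derC.
    eapply (@der_comp R _ s); last by apply: ds.
    by apply: (gamma_kernel_der mass1 dg g2 g'2).
  by rewrite /=; field.
- move=> x; apply: cvgM; last exact: cvg_cst.
  apply: (cvg_comp s (gamma_kernel' (nu / 2) g g') (der_cvg (ds x))).
  exact: (gamma_kernel'_cont mass1 dg g2 g'2 g'4).
- move=> x; rewrite normrM (ger0_norm (_ : 0 <= 4^-1)) ?invr_ge0//.
  rewrite ler_pdivrMr//; apply: (le_trans (gamma_kernel'_bound a0 mass1 dg g2 g'2 g'4 centered _)).
  rewrite ge_max; apply/andP; split.
    have : 1 <= Num.max 1 nu^-1 by rewrite le_max lexx.
    lra.
  have : nu^-1 <= Num.max 1 nu^-1 by rewrite le_max lexx orbT.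
  rewrite invf_div mulrA -natrM; lra.
- move=> x; have := gamma_kernel_eq a0 mass1 dg g2 g'2 g'4 (s x).
  rewrite /g sE => <-; rewrite -/g.
  rewrite (_ : nu / 2 - s x = - (x / 2)); last by rewrite /s; field.
  by rewrite /s; field.
Qed.

End gamma_stein_equation.

(** * Convergence in law and total variation from smooth test functions *)

Section primitives_of_continuous_functions.
Context (R : realType).
Notation lam := (@lebesgue_measure R).

(** Integrals are taken over the whole line, so phi is cut to [-N, N]; the primitives
    normalized at 0 do not depend on N. *)
Lemma continuous_primitive (phi : R -> R) : continuous phi ->
  exists F : R -> R, forall x : R, is_derive x 1 F (phi x).
Proof.
move=> cphi; pose u (N t : R) := phi t * \1_(`[- N, N]%classic) t.
have ui N : @intble _ (measurableTypeR R) R lam (u N).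
  have h : lam.-integrable `[- N, N] (EFin \o phi).
    by apply: continuous_compact_integrable; [exact: segment_compact|exact: cont_within].
  have : lam.-integrable setT (EFin \o (phi \_ `[- N, N])).
    by rewrite -restrict_EFin; apply/integrable_restrict => //=; rewrite setTI.
  apply: eq_intble => t; rewrite /u /restrict indicE.
  by case: ifPn => _; rewrite ?mulr1 ?mulr0.
pose G N x := \int[lam]_(t in `]-oo, x]) u N t.
have dG (N x : R) : `|x| < N -> is_derive x 1 (G N) (phi x).
  rewrite ltr_norml => /andP[Nx xN].
  have uE t : - N <= t <= N -> u N t = phi t.
    by move=> tN; rewrite /u indicE mem_set ?mulr1//= in_itv.
  have <- : u N x = phi x by rewrite uE// !ltW.
  apply: primitive_der => //.
  rewrite /prop_for /continuous_at uE ?(ltW Nx) ?(ltW xN)//.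
  apply: cvg_trans (cphi x); apply: near_eq_cvg; near=> t; rewrite uE//.
  by apply/andP; split; apply: ltW; near: t; [exact: lt_nbhsr|exact: lt_nbhsl].
have indep (N M x : R) : `|x| < N -> `|x| < M -> G N x - G N 0 = G M x - G M 0.
  move=> xN xM; have dD (y : R) : `|y| <= `|x| -> is_derive y 1 (fun z => G N z - G M z) 0.
    move=> yx; have d1 := dG N y (le_lt_trans yx xN); have d2 := dG M y (le_lt_trans yx xM).
    by eapply der_eq; [eapply derD; [exact: d1|eapply derN; exact: d2]|rewrite subrr].
  suff : G N 0 - G M 0 = G N x - G M x by lra.
  have [x0|/ltW x0] := leP 0 x.
    apply: (@der0_cst R (fun z => G N z - G M z) 0 x _ x0) => y /andP[y0 yx]; apply: dD.
    by rewrite !ger0_norm.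
  apply/esym/(@der0_cst R (fun z => G N z - G M z) x 0 _ x0) => y /andP[xy y0]; apply: dD.
  by rewrite !ler0_norm// lerN2.
exists (fun x => G (`|x| + 1) x - G (`|x| + 1) 0) => x.
have dx : is_derive x 1 (fun y => G (`|x| + 2) y - G (`|x| + 2) 0) (phi x).
  have d1 := dG (`|x| + 2) x; eapply der_eq.
    by eapply derD; [apply: d1; rewrite ltrDl|apply: derC].
  by rewrite addr0.
apply: near_eq_is_derive dx; near=> y; apply: indep; last by rewrite ltrDl.
have : `|x - y| < 1 by near: y; apply: cvgr_dist_lt => //; exact: cvg_id.
by have := lerB_dist y x; rewrite distrC; lra.
Unshelve. all: by end_near. Qed.

(** Heine's theorem, where y may leave the segment. *)
Lemma uniform_continuity_segment (phi : R -> R) (A e : R) : continuous phi -> 0 < e ->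
  exists2 d, 0 < d & forall x y, `|x| <= A -> `|x - y| <= d -> `|phi x - phi y| <= e.
Proof.
move=> cphi e0.
have /compact_near_coveringP cK := @segment_compact R (- A) A.
have := cK R (0^'+) (fun d x => forall y, `|x - y| <= d -> `|phi x - phi y| <= e) _ _.
case.
  move=> x _; have /cvgrPdist_le := cphi x => /(_ (e / 2) (divr_gt0 e0 (ltr0n _ 2))).
  move=> /nbhs_ballP[r /= r0 rP].
  have r20 : 0 < r / 2 by rewrite divr_gt0.
  exists (ball x (r / 2), [set d : R | d < r / 2]) => /=.
    split; first exact: nbhsx_ballx.
    exact: nbhs_right_lt.
  move=> [z d] [/= zr dr] y zy.
  have h1 : `|phi x - phi z| <= e / 2.
    by apply: rP; apply: le_ball zr; lra.
  have h2 : `|phi x - phi y| <= e / 2.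
    apply: rP; rewrite -ball_normE/=; move: zr; rewrite -ball_normE/= => zr.
    have := ler_distD z x y; lra.
  by have := ler_distD (phi x) (phi z) (phi y); rewrite (distrC (phi z) (phi x)); lra.
move=> d0 /= d00 d0P.
have d20 : 0 < d0 / 2 by rewrite divr_gt0.
exists (d0 / 2) => // x y xA xy; apply: (d0P (d0 / 2) _ d20 x) => //.
  by rewrite /= sub0r normrN gtr0_norm//; lra.
by rewrite /= in_itv/= -ler_norml.
Qed.

End primitives_of_continuous_functions.

(** A Lipschitz condition on h' is all that the gamma Stein equation uses of the second
    derivative. *)
Definition smooth_test (R : realType) (h : R -> R) := exists h' : R -> R,
  [/\ forall x : R, is_derive x 1 h (h' x), forall x, `|h x| <= 1,
      forall x, `|h' x| <= 1 & forall x y, `|h' x - h' y| <= `|x - y|].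

(** Steklov average of order two: a second difference quotient of a second primitive
    of phi, which takes only values of phi at points close to the argument. *)
Section steklov_average.
Context (R : realType).
Variables (phi F G : R -> R) (B eps : R).
Hypotheses (cphi : continuous phi) (phiB : forall x, `|phi x| <= B) (eps0 : 0 < eps).
Hypotheses (dF : forall x : R, is_derive x 1 F (phi x))
  (dG : forall x : R, is_derive x 1 G (F x)).

Definition steklov (x : R) := (G (x + eps + eps) - G (x + eps) - (G (x + eps) - G x)) / eps ^+ 2.

Let shift_der (f f' : R -> R) (a : R) : (forall x : R, is_derive x 1 f (f' x)) ->
  forall x : R, is_derive x 1 (fun y => f (y + a)) (f' (x + a)).
Proof.
move=> df x; eapply der_eq.
  eapply (@der_comp R f (fun y => y + a)); first by apply: df.
  by eapply derD; [apply: derid|apply: derC].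
by rewrite addr0 mulr1.
Qed.

Let diff_der (f f' : R -> R) : (forall x : R, is_derive x 1 f (f' x)) ->
  forall x : R, is_derive x 1 (fun y => f (y + eps) - f y) (f' (x + eps) - f' x).
Proof.
by move=> df x; have h := shift_der eps df x; eapply derD; [exact: h|eapply derN; exact: df].
Qed.

Let mean_value (f f' : R -> R) (x : R) : (forall x : R, is_derive x 1 f (f' x)) ->
  exists2 y, x <= y <= x + eps & f (x + eps) - f x = f' y * eps.
Proof.
move=> df; have xe : x < x + eps by rewrite ltrDl.
have cf : {within `[x, x + eps], continuous f} by apply: cont_within => y; exact: der_cvg.
have [y] := MVT xe (fun y _ => df y) cf; rewrite in_itv/= => /andP[xy ye] E.
by exists y; [rewrite !ltW|rewrite E addrC addKr].
Qed.

Lemma steklov_value x : exists2 y, x <= y <= x + 2 * eps & steklov x = phi y.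
Proof.
have [z /andP[xz ze] Ez] := mean_value x (diff_der dG).
have [y /andP[zy ye] Ey] := mean_value z dF.
exists y; first by apply/andP; split; lra.
rewrite /steklov Ez Ey expr2; field; exact: lt0r_neq0.
Qed.

Lemma steklov_le x : `|steklov x| <= B.
Proof. by have [y _ ->] := steklov_value x. Qed.

Definition steklov' (x : R) := (F (x + eps + eps) - F (x + eps) - (F (x + eps) - F x)) / eps ^+ 2.
Definition steklov'' (x : R) :=
  (phi (x + eps + eps) - phi (x + eps) - (phi (x + eps) - phi x)) / eps ^+ 2.

Let second_der (f f' : R -> R) : (forall x : R, is_derive x 1 f (f' x)) ->
  forall x : R, is_derive x 1
    (fun x => (f (x + eps + eps) - f (x + eps) - (f (x + eps) - f x)) / eps ^+ 2)
    ((f' (x + eps + eps) - f' (x + eps) - (f' (x + eps) - f' x)) / eps ^+ 2).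
Proof.
move=> df x; have h := diff_der (diff_der df) x; eapply der_eq.
  by eapply derM; [exact: h|apply: derC].
by rewrite /= mulr0 add0r mulrC.
Qed.

Lemma steklov_smooth : exists2 c, 0 < c & smooth_test (fun x => steklov x / c).
Proof.
have B0 : 0 <= B by exact: le_trans (phiB 0).
pose b1 := B * eps + B * eps; pose b2 := B + B + (B + B).
have e2 : 0 < eps ^+ 2 by rewrite exprn_gt0.
have ie2 : 0 <= (eps ^+ 2)^-1 by rewrite invr_ge0 ltW.
have F1 x : `|steklov' x| <= b1 / eps ^+ 2.
  rewrite normrM (ger0_norm ie2) ler_wpM2r//.
  apply: (le_trans (ler_normB _ _)); apply: lerD.
    by apply: (le_trans (mvt_lip dF phiB _ _)); rewrite addrAC subrr add0r gtr0_norm.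
  by apply: (le_trans (mvt_lip dF phiB _ _)); rewrite addrAC subrr add0r gtr0_norm.
have F2 x : `|steklov'' x| <= b2 / eps ^+ 2.
  rewrite normrM (ger0_norm ie2) ler_wpM2r//.
  by apply: (le_trans (ler_normB _ _)); apply: lerD; apply: (le_trans (ler_normB _ _)); apply: lerD.
pose c := 1 + B + b1 / eps ^+ 2 + b2 / eps ^+ 2.
have b10 : 0 <= b1 / eps ^+ 2 by exact: le_trans (F1 0).
have b20 : 0 <= b2 / eps ^+ 2 by exact: le_trans (F2 0).
have c0 : 0 < c by rewrite /c; lra.
have div_c (z : R) : `|z| <= c -> `|z / c| <= 1.
  by move=> zc; rewrite normrM normfV (gtr0_norm c0) ler_pdivrMr// mul1r.
exists c => //; exists (fun x => steklov' x / c); split.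
- move=> x; have h := second_der dG x; eapply der_eq; first by eapply derM; [exact: h|apply: derC].
  by rewrite /= mulr0 add0r mulrC.
- by move=> x; apply: div_c; apply: (le_trans (steklov_le x)); rewrite /c; lra.
- by move=> x; apply: div_c; apply: (le_trans (F1 x)); rewrite /c; lra.
- move=> x y; rewrite -mulrBl normrM normfV (gtr0_norm c0) ler_pdivrMr//.
  apply: (le_trans (mvt_lip (second_der dF) F2 x y)).
  by rewrite mulrC ler_wpM2l// /c; lra.
Qed.

End steklov_average.

Section convergence_criterion.
Context (R : realType) d (W : measurableType d) (P : probability W R)
  d' (W' : measurableType d') (Q : probability W' R).
Variables (Y : nat -> W -> R) (V : W' -> R) (K : R).
Hypotheses (mY : forall n, measurable_fun setT (Y n)) (mV : measurable_fun setT V).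
Hypothesis iY : forall n, intble P (fun w => Y n w ^+ 2).
Hypothesis Y_K : \forall n \near \oo, \int[P]_w (Y n w ^+ 2) <= K.
Hypothesis smooth_cvg : forall h, smooth_test h ->
  \int[P]_w h (Y n w) @[n --> \oo] --> \int[Q]_w h (V w).

(** The second moment bounds the mass outside a compact interval, inside which phi is
    uniformly close to its Steklov averages, and these are smooth tests up to a
    factor. *)
Lemma cvg_smooth_bounded (phi : R -> R) (B : R) : continuous phi ->
  (forall x, `|phi x| <= B) ->
  \int[P]_w phi (Y n w) @[n --> \oo] --> \int[Q]_w phi (V w).
Proof.
move=> cphi phiB; have mphi := cont_meas cphi.
have B0 : 0 <= B by exact: le_trans (phiB 0).
have [F dF] := continuous_primitive cphi.
have [G dG] := continuous_primitive (fun x => der_cvg (dF x)).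
pose S k x := steklov G k.+1%:R^-1 x.
have k0 k : 0 < k.+1%:R^-1 :> R by rewrite invr_gt0.
have SB k x : `|S k x| <= B by exact: (steklov_le phiB (k0 k) dF dG).
have mS k : measurable_fun [set: R] (S k).
  have [c c0 [h' [dh _ _ _]]] := steklov_smooth phiB (k0 k) dF dG.
  have -> : S k = fun x => c * (S k x / c).
    by apply/funext => x; rewrite mulrC divfK// lt0r_neq0.
  by apply: measurable_funM => //; apply: cont_meas => x; exact: der_cvg (dh x).
have bi d0 (T : measurableType d0) (p : probability T R) (f : R -> R) (U : T -> R) :
    measurable_fun [set: R] f -> (forall x, `|f x| <= B) -> measurable_fun setT U ->
    intble p (fun w => f (U w)).
  move=> mf fB mU; apply: (@bounded_intble _ _ _ p _ B) => //.
  exact: measurableT_comp mf mU.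
have SV : \int[Q]_w S k (V w) @[k --> \oo] --> \int[Q]_w phi (V w).
  apply: (@Rint_dct _ W' R Q _ _ (fun=> B)).
  - by move=> k; exact: measurableT_comp (mS k) mV.
  - exact: measurableT_comp mphi mV.
  - move=> w; apply/cvgrPdist_le => e e0.
    have [dl dl0 dlP] := uniform_continuity_segment `|V w| cphi e0.
    near=> k; rewrite /S; have [y /andP[h1 h2] ->] := steklov_value (k0 k) dF dG (V w).
    apply: dlP => //; rewrite distrC ger0_norm ?subr_ge0//.
    have : k.+1%:R^-1 <= dl / 2 :> R.
      by near: k; apply: (cvgr_le _ (@cvg_inv_succ R)); exact: divr_gt0.
    by move: (k.+1%:R^-1) h2 => u; lra.
  - exact: intble_cst.
  - by move=> k w.
have SY k : \int[P]_w S k (Y n w) @[n --> \oo] --> \int[Q]_w S k (V w).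
  have [c c0 sm] := steklov_smooth phiB (k0 k) dF dG.
  have E d0 (T : measurableType d0) (p : probability T R) (U : T -> R) :
      measurable_fun setT U ->
      \int[p]_w S k (U w) = c * \int[p]_w (S k (U w) / c).
    move=> mU; rewrite -RintZ; last first.
      by apply: (@bounded_intble _ _ _ p _ (B / c)) => [|w];
        [apply: measurable_funM => //; exact: measurableT_comp (mS k) mU
        |rewrite normrM normfV (gtr0_norm c0) ler_wpM2r ?invr_ge0 ?(ltW c0)].
    by apply: eq_Rint => w; rewrite mulrC divfK// lt0r_neq0.
  rewrite (_ : (fun n => _) = fun n => c * \int[P]_w (S k (Y n w) / c)); last first.
    by apply/funext => n; exact: E.
  by rewrite (E _ _ Q V mV); apply: cvgMr; exact: smooth_cvg sm.
apply/cvgrPdist_le => e e0; have e4 : 0 < e / 4 by rewrite divr_gt0.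
have K0 : 0 <= K.
  have [n Kn] := filter_ex Y_K.
  by apply: le_trans Kn; apply: Rint_ge0 => w; exact: sqr_ge0.
(* Beyond |x| = sqrt A2 the second moment bound makes the contribution of the tails,
   at most 2 B K / A2, smaller than e / 4. *)
pose A2 := 8 * B * K / e + 1.
have A20 : 0 < A2 by rewrite /A2 ltr_wpDl// divr_ge0 ?(ltW e0)// mulr_ge0// mulr_ge0.
have [dl dl0 dlP] := uniform_continuity_segment (Num.sqrt A2) cphi e4.
have [k [kdl kV]] : exists k : nat, k.+1%:R^-1 <= dl / 2 :> R /\
    `|\int[Q]_w phi (V w) - \int[Q]_w S k (V w)| <= e / 4.
  apply: (@filter_ex _ \oo); apply: filterI.
    by apply: (cvgr_le _ (@cvg_inv_succ R)); exact: divr_gt0.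
  by move/cvgrPdist_le: SV; apply.
have pw x : `|phi x - S k x| <= e / 4 + 2 * B / A2 * x ^+ 2.
  have h0 : 0 <= 2 * B / A2 by rewrite divr_ge0 ?(ltW A20)// mulr_ge0.
  have [xA|xA] := leP `|x| (Num.sqrt A2).
    rewrite /S; have [y /andP[h1 h2] ->] := steklov_value (k0 k) dF dG x.
    apply: ler_wpDr; first by rewrite mulr_ge0// sqr_ge0.
    apply: dlP => //; rewrite distrC ger0_norm ?subr_ge0//.
    by move: (k.+1%:R^-1) h2 kdl => u; lra.
  apply: ler_wpDl; first exact: ltW.
  have x2 : A2 <= x ^+ 2.
    rewrite -(real_normK (num_real x)) -[leLHS](sqr_sqrtr (ltW A20)).
    by rewrite lerXn2r ?nnegrE ?sqrtr_ge0// ltW.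
  apply: (@le_trans _ _ (2 * B / A2 * A2)).
    rewrite divfK ?lt0r_neq0// (le_trans (ler_normB _ _))//.
    by rewrite (_ : 2 * B = B + B) ?lerD//; ring.
  by rewrite ler_wpM2l.
have close n : \int[P]_w (Y n w ^+ 2) <= K ->
    `|\int[P]_w phi (Y n w) - \int[P]_w S k (Y n w)| <= e / 2.
  move=> nK; have ib : intble P (fun w => e / 4 + 2 * B / A2 * Y n w ^+ 2).
    by apply: intbleD; [exact: intble_cst|exact: intbleZ].
  have i1 := bi _ _ P _ _ mphi phiB (mY n); have i2 := bi _ _ P _ _ (mS k) (SB k) (mY n).
  rewrite -RintB//.
  apply: (le_trans (Rint_abs_le ib (intble_meas (intbleB i1 i2)) _)) => //.
  rewrite RintD; [|exact: intble_cst|exact: intbleZ].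
  rewrite Rint_cst RintZ// (_ : e / 2 = e / 4 + e / 4); last by field.
  rewrite lerD2l.
  apply: (@le_trans _ _ (2 * B / A2 * K)).
    by rewrite ler_wpM2l// divr_ge0 ?(ltW A20)// mulr_ge0.
  rewrite mulrAC ler_pdivrMr// /A2.
  have -> : e / 4 * (8 * B * K / e + 1) = 2 * B * K + e / 4 by field; exact: lt0r_neq0.
  by lra.
near=> n.
have h1 : `|\int[P]_w phi (Y n w) - \int[P]_w S k (Y n w)| <= e / 2.
  by apply: close; near: n.
have h2 : `|\int[Q]_w S k (V w) - \int[P]_w S k (Y n w)| <= e / 4.
  by near: n; have /cvgrPdist_le := SY k; apply.
move: h1 h2 kV; set a := \int[P]_w _; set b := \int[P]_w _; set c := \int[Q]_w _.
set c' := \int[Q]_w _ => h1 h2 h3.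
rewrite (_ : c' - a = (c' - c) + (c - b) - (a - b)); last by ring.
apply: (le_trans (ler_normB _ _)); have := ler_normD (c' - c) (c - b); lra.
Unshelve. all: by end_near. Qed.

End convergence_criterion.

Section total_variation_approximation.
Context (R : realType) d (W : measurableType d) (P : probability W R)
  d' (W' : measurableType d') (Q : probability W' R).
Variables (U : W -> R) (V : W' -> R).
Hypotheses (mU : measurable_fun setT U) (mV : measurable_fun setT V).

Definition lipschitz01 (h : R -> R) :=
  (exists L, forall x y, `|h x - h y| <= L * `|x - y|) /\ forall x, 0 <= h x <= 1.

Definition l1_close (f h : R -> R) (e : R) :=
  \int[P]_w `|f (U w) - h (U w)| <= e /\ \int[Q]_w `|f (V w) - h (V w)| <= e.

(** These sets form a sigma-algebra containing the open half-lines, hence exhaust the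
    Borel sets; measurability is included to make the integrals meaningful. *)
Definition lipschitz_approximable (B : set R) := measurable B /\
  forall e, 0 < e -> exists2 h, lipschitz01 h & l1_close \1_B h e.

Lemma lipschitz01_cont h : lipschitz01 h -> continuous h.
Proof. by move=> [[L hL] _]; exact: lipschitz_cont hL. Qed.

Lemma lipschitz01_meas h : lipschitz01 h -> measurable_fun [set: R] h.
Proof. by move=> /lipschitz01_cont; exact: cont_meas. Qed.

Lemma indic01 (B : set R) x : 0 <= (\1_B x : R) <= 1.
Proof. by rewrite indicE; case: (_ \in _); rewrite !lexx ler01. Qed.

Let dist01 (a b : R) : 0 <= a <= 1 -> 0 <= b <= 1 -> `|a - b| <= 1.
Proof. by move=> /andP[? ?] /andP[? ?]; rewrite ler_norml; apply/andP; split; lra. Qed.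

Let i01 d0 (T : measurableType d0) (p : probability T R) (X : T -> R) (f h : R -> R) :
  measurable_fun setT X -> measurable_fun [set: R] f -> measurable_fun [set: R] h ->
  (forall x, 0 <= f x <= 1) -> (forall x, 0 <= h x <= 1) ->
  intble p (fun w => `|f (X w) - h (X w)|).
Proof.
move=> mX mf mh f01 h01; apply: (@bounded_intble _ _ _ p _ 1).
  apply: measurableT_comp => //; apply: measurable_funB; exact: measurableT_comp.
by move=> w; rewrite normr_id; exact: dist01.
Qed.

Lemma l1_closeD (f g h : R -> R) (e1 e2 : R) :
  measurable_fun [set: R] f -> measurable_fun [set: R] g -> measurable_fun [set: R] h ->
  (forall x, 0 <= f x <= 1) -> (forall x, 0 <= g x <= 1) -> (forall x, 0 <= h x <= 1) ->
  l1_close f g e1 -> l1_close g h e2 -> l1_close f h (e1 + e2).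
Proof.
move=> mf mg mh f01 g01 h01 [c1 c1'] [c2 c2']; split.
- apply: le_trans (lerD c1 c2); rewrite -RintD; [|exact: i01|exact: i01].
  apply: Rint_le; [exact: i01|by apply: intbleD; exact: i01|].
  by move=> w; exact: ler_distD.
- apply: le_trans (lerD c1' c2'); rewrite -RintD; [|exact: i01|exact: i01].
  apply: Rint_le; [exact: i01|by apply: intbleD; exact: i01|].
  by move=> w; exact: ler_distD.
Qed.

Lemma l1_close_limit (f : R -> R) (f_ : nat -> R -> R) (e : R) :
  measurable_fun [set: R] f -> (forall n, measurable_fun [set: R] (f_ n)) ->
  (forall x, 0 <= f x <= 1) -> (forall n x, 0 <= f_ n x <= 1) ->
  (forall x, f_ n x @[n --> \oo] --> f x) -> 0 < e -> exists n, l1_close f (f_ n) e.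
Proof.
move=> mf mf_ f01 f_01 lim e0.
have L d0 (T : measurableType d0) (p : probability T R) (X : T -> R) :
    measurable_fun setT X -> \int[p]_w `|f (X w) - f_ n (X w)| @[n --> \oo] --> (0 : R).
  move=> mX; rewrite -(@Rint0 _ T R p); apply: (@Rint_dct _ T R p _ _ (fun=> 1)).
  - by move=> n; exact: (intble_meas (i01 p mX mf (mf_ n) f01 (f_01 n))).
  - exact: measurable_cst.
  - move=> w; have : `|f (X w) - f_ n (X w)| @[n --> \oo] --> `|f (X w) - f (X w)|.
      by apply: cvg_norm; apply: cvgB => //; exact: cvg_cst.
    by rewrite subrr normr0.
  - exact: intble_cst.
  - by move=> n w; rewrite normr_id; exact: dist01.
apply: (@filter_ex _ \oo); apply: filterI; exact: (cvgr_le _ (L _ _ _ _ _)).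
Qed.

Lemma lipschitz_approximableC B : lipschitz_approximable B -> lipschitz_approximable (~` B).
Proof.
move=> [mB hB]; split; first exact: measurableC.
move=> e e0; have [h [[L hL] h01] [c1 c2]] := hB e e0.
exists (fun x => 1 - h x).
  split.
    exists L => x y; have -> : 1 - h x - (1 - h y) = h y - h x by ring.
    by rewrite distrC; exact: hL.
  by move=> x; have /andP[? ?] := h01 x; apply/andP; split; lra.
have E x : `|\1_(~` B) x - (1 - h x)| = `|\1_B x - h x|.
  rewrite !indicE in_setC; case: (x \in B) => /=; first by rewrite sub0r normrN.
  by rewrite subKr sub0r normrN.
split; [apply: le_trans c1|apply: le_trans c2]; rewrite le_eqVlt; apply/orP; left; apply/eqP;
  by apply: eq_Rint => w; exact: E.
Qed.

Lemma lipschitz_approximableU A B : lipschitz_approximable A -> lipschitz_approximable B ->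
  lipschitz_approximable (A `|` B).
Proof.
move=> [mA hA] [mB hB]; split; first exact: measurableU.
move=> e e0; have e20 : 0 < e / 2 by rewrite divr_gt0.
have [h lh [c1 c1']] := hA _ e20; have [k lk [c2 c2']] := hB _ e20.
have [[L hL] h01] := lh; have [[M kM] k01] := lk.
have maxlip (a b a' b' : R) : `|Num.max a b - Num.max a' b'| <= `|a - a'| + `|b - b'|.
  have := ler_norm (a - a'); have := ler_norm (b - b').
  have := ler_norm (a' - a); have := ler_norm (b' - b); rewrite (distrC a') (distrC b').
  have := normr_ge0 (a - a'); have := normr_ge0 (b - b').
  move: `|a - a'| `|b - b'| => u v *.
  by rewrite ler_norml; apply/andP; rewrite /Num.max; case: ltP => ?; case: ltP => ?; split; lra.
have mh := lipschitz01_meas lh; have mk := lipschitz01_meas lk.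
exists (fun x => Num.max (h x) (k x)).
  split.
    exists (L + M) => x y; apply: (le_trans (maxlip _ _ _ _)).
    by rewrite mulrDl lerD.
  move=> x; have /andP[? ?] := h01 x; have /andP[? ?] := k01 x.
  by rewrite le_max ge_max; apply/andP; split; [apply/orP; left|apply/andP; split].
have key x : `|\1_(A `|` B) x - Num.max (h x) (k x)| <=
    `|\1_A x - h x| + `|\1_B x - k x|.
  apply: le_trans (maxlip _ _ _ _); rewrite le_eqVlt; apply/orP; left; apply/eqP.
  congr `|_ - _|; rewrite !indicE in_setU; rewrite /Num.max.
  by case: (x \in A); case: (x \in B); rewrite /= ?ltxx ?ltr01 ?ltr10.
have mAi : measurable_fun [set: R] (\1_A : R -> R) by exact: measurable_indic.
have mBi : measurable_fun [set: R] (\1_B : R -> R) by exact: measurable_indic.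
have m1 : measurable_fun [set: R] (\1_(A `|` B) : R -> R).
  by apply: measurable_indic; exact: measurableU.
have m2 : measurable_fun [set: R] (fun x => Num.max (h x) (k x)) by exact: measurable_maxr.
have m01 x : 0 <= Num.max (h x) (k x) <= 1.
  have /andP[? ?] := h01 x; have /andP[? ?] := k01 x.
  by rewrite le_max ge_max; apply/andP; split; [apply/orP; left|apply/andP; split].
have I01 := indic01; rewrite (splitr e); split.
- apply: le_trans (lerD c1 c2); rewrite -RintD; [|exact: i01|exact: i01].
  apply: Rint_le; [exact: (i01 P mU m1 m2)|by apply: intbleD; exact: i01|by move=> w; exact: key].
- apply: le_trans (lerD c1' c2'); rewrite -RintD; [|exact: i01|exact: i01].
  apply: Rint_le; [exact: (i01 Q mV m1 m2)|by apply: intbleD; exact: i01|by move=> w; exact: key].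
Qed.

Lemma lipschitz_approximable0 : lipschitz_approximable set0.
Proof.
split=> // e e0; exists (fun=> 0).
  split; first by exists 0 => x y; rewrite subrr normr0 mul0r.
  by move=> x; rewrite lexx ler01.
have E x : `|\1_set0 x - 0| = 0 :> R by rewrite indic0 subrr normr0.
by split; rewrite (eq_Rint _ (g := fun=> 0)) ?Rint0 ?ltW// => w; exact: E.
Qed.

Lemma lipschitz_approximable_bigcup (F : nat -> set R) :
  (forall n, lipschitz_approximable (F n)) -> lipschitz_approximable (\bigcup_n F n).
Proof.
move=> hF; split; first by apply: bigcup_measurable => n _; exact: (hF n).1.
move=> e e0; have e20 : 0 < e / 2 by rewrite divr_gt0.
have hS n : lipschitz_approximable (\big[setU/set0]_(i < n) F i).
  elim: n => [|n IH]; first by rewrite big_ord0; exact: lipschitz_approximable0.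
  by rewrite big_ord_recr/=; exact: lipschitz_approximableU.
have mF : measurable (\bigcup_n F n) by apply: bigcup_measurable => n _; exact: (hF n).1.
have [n cn] : exists n, l1_close \1_(\bigcup_n F n) \1_(\big[setU/set0]_(i < n) F i) (e / 2).
  apply: (@l1_close_limit \1_(\bigcup_n F n) (fun n => \1_(\big[setU/set0]_(i < n) F i))) => //.
  - by move=> n; apply: measurable_indic; exact: (hS n).1.
  - exact: indic01.
  - by move=> n; exact: indic01.
  - move=> x; apply: cvg_near_cst; have [[m _ Fx]|nF] := pselect ((\bigcup_n F n) x).
      near=> n; rewrite !indicE !mem_set//; first by exists m.
      by rewrite -bigcup_mkord; exists m => //=; near: n; exact: nbhs_infty_gt.
    near=> n; rewrite !indicE !memNset//.
    by rewrite -bigcup_mkord => -[m _ Fx]; apply: nF; exists m.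
have [h lh ch] := (hS n).2 _ e20; exists h => //.
rewrite (splitr e); apply: l1_closeD cn ch => //.
- by apply: measurable_indic; exact: (hS n).1.
- exact: lipschitz01_meas.
- exact: indic01.
- exact: indic01.
- exact: lh.2.
Unshelve. all: by end_near. Qed.

Lemma lipschitz_approximable_ray a : lipschitz_approximable `]-oo, a[.
Proof.
split=> // e e0.
pose f (n : nat) (x : R) := Num.min 1 (n%:R * Num.max 0 (a - x)).
have max0lip (u v : R) : `|Num.max 0 u - Num.max 0 v| <= `|u - v|.
  have := ler_norm (u - v); have := ler_norm (v - u); rewrite (distrC v).
  have := normr_ge0 (u - v); move: `|u - v| => w *.
  by rewrite ler_norml; apply/andP; rewrite /Num.max; case: ltP => ?; case: ltP => ?; split; lra.
have min1lip (u v : R) : `|Num.min 1 u - Num.min 1 v| <= `|u - v|.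
  have := ler_norm (u - v); have := ler_norm (v - u); rewrite (distrC v).
  have := normr_ge0 (u - v); move: `|u - v| => w *.
  by rewrite ler_norml; apply/andP; rewrite /Num.min; case: ltP => ?; case: ltP => ?; split; lra.
have fl n : lipschitz01 (f n).
  split.
    exists n%:R => x y; apply: (le_trans (min1lip _ _)).
    rewrite -mulrBr normrM ger0_norm// ler_wpM2l//.
    apply: (le_trans (max0lip _ _)).
    have -> : a - x - (a - y) = y - x by ring.
    by rewrite distrC.
  move=> x; rewrite le_min ge_min lexx ler01/= andbT mulr_ge0//.
  by rewrite le_max lexx.
have [n cn] : exists n, l1_close \1_(`]-oo, a[%classic) (f n) e.
  apply: l1_close_limit => //.
  - by move=> n; exact: lipschitz01_meas.
  - exact: indic01.
  - by move=> n; exact: (fl n).2.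
  - move=> x; apply: cvg_near_cst; have [ax|xa] := leP a x.
      near=> n; rewrite /f indicE memNset ?max_l ?subr_le0// ?mulr0 ?min_r//=.
      by rewrite in_itv/= ltNge ax.
    near=> n; rewrite /f indicE mem_set//= max_r ?subr_ge0 ?(ltW xa)// min_l//.
    rewrite -ler_pdivrMr ?subr_gt0//; near: n; exact: nbhs_infty_ger.
by exists (f n).
Unshelve. all: by end_near. Qed.

Lemma lipschitz_approximable_measurable (B : set R) : measurable B -> lipschitz_approximable B.
Proof.
have sub : <<s (@RGenInftyO.G R) >> `<=` lipschitz_approximable.
  apply: smallest_sub; last first.
    by move=> _ [a ->]; exact: lipschitz_approximable_ray.
  split; first exact: lipschitz_approximable0.
    by move=> A hA; rewrite setTD; exact: lipschitz_approximableC.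
  exact: lipschitz_approximable_bigcup.
have E : @measurable _ (measurableTypeR R) = <<s (@RGenInftyO.G R) >>.
  exact: RGenInftyO.measurableE.
by move=> mB; apply: sub; rewrite -E.
Qed.

(** Total variation from Lipschitz tests. No constant is lost because the bound e does
    not depend on the Lipschitz constant. *)
Lemma indicator_le_of_lipschitz (e : R) :
  (forall h, lipschitz01 h -> `|\int[P]_w h (U w) - \int[Q]_w h (V w)| <= e) ->
  forall B : set R, measurable B ->
  `|\int[P]_w \1_B (U w) - \int[Q]_w \1_B (V w)| <= e.
Proof.
move=> he B mB; apply/ler_addgt0Pr => r r0.
have r20 : 0 < r / 2 by rewrite divr_gt0.
have [h lh [c1 c2]] := (lipschitz_approximable_measurable mB).2 _ r20.
have mh := lipschitz01_meas lh; have [_ h01] := lh.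
have mBi : measurable_fun [set: R] (\1_B : R -> R) by exact: measurable_indic.
have bi d0 (T : measurableType d0) (p : probability T R) (X : T -> R) (f : R -> R) :
    measurable_fun setT X -> measurable_fun [set: R] f -> (forall x, 0 <= f x <= 1) ->
    intble p (fun w => f (X w)).
  move=> mX mf f01; apply: (@bounded_intble _ _ _ p _ 1).
    exact: measurableT_comp mf mX.
  by move=> w; have /andP[? ?] := f01 (X w); rewrite ger0_norm.
have I01 := indic01 B.
have near d0 (T : measurableType d0) (p : probability T R) (X : T -> R) :
    measurable_fun setT X -> \int[p]_w `|\1_B (X w) - h (X w)| <= r / 2 ->
    `|\int[p]_w \1_B (X w) - \int[p]_w h (X w)| <= r / 2.
  move=> mX; apply: le_trans; rewrite -RintB; [|exact: bi|exact: bi].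
  by apply: Rint_abs; apply: intbleB; exact: bi.
have := near _ _ P _ mU c1; have := near _ _ Q _ mV c2; have := he h lh.
set x1 := \int[P]_w _; set x2 := \int[Q]_w _; set x3 := \int[Q]_w _; set x4 := \int[P]_w _.
move=> h1 h2 h3; rewrite (_ : x4 - x3 = (x4 - x1) + (x1 - x2) - (x3 - x2)); last by ring.
apply: (le_trans (ler_normB _ _)); have := ler_normD (x4 - x1) (x1 - x2); lra.
Qed.

End total_variation_approximation.

(** * The fourth moment bounds *)

Section laws.
Context (R : realType) d (W : measurableType d) (P : probability W R).

Lemma momentE k (Z : {RV P >-> R}) : moment k Z = \int[P]_w (Z w ^+ k).
Proof. by rewrite /moment unlock. Qed.

Lemma expectationE (Z : {RV P >-> R}) (h : R -> R) : intble P (fun w => h (Z w)) ->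
  ('E_P[h \o Z] = (\int[P]_w h (Z w))%:E)%E.
Proof. by move=> hi; rewrite unlock -intE. Qed.

Lemma prob_indic (U : W -> R) (B : set R) : measurable_fun setT U -> measurable B ->
  P (U @^-1` B) = (\int[P]_w \1_B (U w))%:E.
Proof.
move=> mU mB; have mUB : measurable (U @^-1` B) by rewrite -[X in measurable X]setTI; exact: mU.
rewrite -intE; last first.
  apply: (@bounded_intble _ _ _ P _ 1).
    by apply: measurableT_comp mU; exact: measurable_indic.
  by move=> w; have /andP[? ?] := indic01 B (U w); rewrite ger0_norm.
transitivity (\int[P]_w (\1_(U @^-1` B) w)%:E)%E.
  by rewrite integral_indic// setIT.
by apply: eq_integral => w _; rewrite -preim_indic.
Qed.

End laws.

Lemma cvg_in_law_smooth (R : realType) d (W : measurableType d) (P : probability W R)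
  d' (W' : measurableType d') (Q : probability W' R)
  (Z : nat -> {RV P >-> R}) (V : {RV Q >-> R}) (K : R) :
  (forall n, intble P (fun w => Z n w ^+ 2)) ->
  (\forall n \near \oo, \int[P]_w (Z n w ^+ 2) <= K) ->
  (forall h, smooth_test h ->
    \int[P]_w h (Z n w) @[n --> \oo] --> \int[Q]_w h (V w)) -> cvg_in_law Z V.
Proof.
move=> Z2 ZK sm phi cphi [M phiM]; have mphi := cont_meas cphi.
rewrite expectationE; last first.
  by apply: (@bounded_intble _ _ _ Q _ M) => //; exact: measurableT_comp.
rewrite (_ : (fun n => _) = fun n => (\int[P]_w phi (Z n w))%:E); last first.
  apply/funext => n; rewrite expectationE//.
  by apply: (@bounded_intble _ _ _ P _ M) => //; exact: measurableT_comp.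
apply: cvg_EFin; first exact: nearW.
exact: (cvg_smooth_bounded _ _ Z2 ZK sm cphi phiM).
Qed.

Section chaos_moments.
Context (R : realType) (d : measure_display) (W : measurableType d)
  (P : probability W R) (H T : completeNormedModType R).
Variables (dotH : {dot H for @idfun R}) (tens : {bilinear H -> H -> T}).
Variables (X : H -> {RV P >-> R}) (I2 : T -> {RV P >-> R}).
Hypotheses (dotHP : hilbert_dot dotH) (XP : isonormal dotH X)
  (I2P : double_wiener_ito tens X I2).
Variable Z : {RV P >-> R}.
Hypothesis ZP : second_chaos tens I2 Z.

Let mX j : measurable_fun setT (fun w => Z w ^+ j).
Proof. exact: measurable_funX. Qed.

Lemma chaos_intble_sqr : intble P (fun w => Z w ^+ 2).
Proof.
have [g sg Zg] := ZP; apply: (ae_intble (mX 2) _ (I2_isometry I2P sg).1).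
by move: Zg; apply: filterS => w ->.
Qed.

Lemma chaos_moment2_ge0 : 0 <= moment 2 Z.
Proof. by rewrite momentE; apply: Rint_ge0 => w; exact: sqr_ge0. Qed.

(** Stein's method: h is evaluated at Z through the solution f of the Stein equation.
    The two targets correspond to (a, b) = (0, 1) and (2, 2 nu). *)
Lemma chaos_stein_bound (f f' h : R -> R) (M L a b c : R) :
  (forall x : R, is_derive x 1 f (f' x)) -> continuous f' -> (forall x, `|f' x| <= M) ->
  (forall x y, `|h x - h y| <= L * `|x - y|) ->
  (forall x, (a * x + b) * f' x - x * f x = h x - c) ->
  `|\int[P]_w h (Z w) - c| <= M * Num.sqrt ((b - moment 2 Z) ^+ 2 + a ^+ 2 * moment 2 Z -
     a * moment 3 Z + (moment 4 Z - 3 * moment 2 Z ^+ 2) / 6).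
Proof.
move=> df cf' f'M hL eqf; have [g sg Zg] := ZP.
have [hi] := I2_stein_bound dotHP XP I2P df cf' f'M hL eqf sg.
have mE j : moment j Z = \int[P]_w (I2 g w ^+ j).
  rewrite momentE; apply: ae_Rint => //; first exact: measurable_funX.
  by move: Zg; apply: filterS => w ->.
have mh : measurable_fun [set: R] h.
  have : continuous (fun x => a * x + b).
    by move=> x; apply: cvgD; [apply: cvgM; [exact: cvg_cst|exact: cvg_id]|exact: cvg_cst].
  move=> cab; have -> : h = fun x => (a * x + b) * f' x - x * f x + c.
    by apply/funext => x; rewrite eqf subrK.
  apply: cont_meas => x; apply: cvgD; last exact: cvg_cst.
  apply: cvgB; first by apply: cvgM; [exact: cab|exact: cf'].
  by apply: cvgM; [exact: cvg_id|exact: der_cvg].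
have -> : \int[P]_w h (Z w) = \int[P]_w h (I2 g w).
  apply: ae_Rint; [exact: measurableT_comp|exact: measurableT_comp|].
  by move: Zg; apply: filterS => w ->.
by rewrite !mE.
Qed.

Section normal_target.
Context d' (W' : measurableType d') (Q : probability W' R) (N : {RV Q >-> R}).
Hypothesis lawN : has_law Q N (normal_prob 0 1).
Let A := 6^-1 * `|moment 4 Z - 3| + (3 + moment 2 Z) / 2 * `|moment 2 Z - 1|.

(** For (a, b) = (0, 1) the radicand is (m4 - 3) / 6 + (m2 - 3) (m2 - 1) / 2, and
    |m2 - 3| <= 3 + m2. *)
Lemma chaos_normal_lipschitz h : lipschitz01 h ->
  `|\int[P]_w h (Z w) - \int[Q]_w h (N w)| <= 2 * Num.sqrt A.
Proof.
move=> lh; have [[L hL] h01] := lh.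
have ch := lipschitz01_cont lh.
have [f [f' [df cf' f'2 eqf]]] := normal_stein_solution ch h01.
rewrite (law_Rint (measurable_funPT N) lawN (lipschitz01_meas lh)).
apply: (le_trans (chaos_stein_bound df cf' f'2 hL eqf)).
rewrite ler_wpM2l// ler_wsqrtr// /A; have := chaos_moment2_ge0.
move: (moment 2 Z) (moment 3 Z) (moment 4 Z) => m2 m3 m4 m20.
have -> : (1 - m2) ^+ 2 + 0 ^+ 2 * m2 - 0 * m3 + (m4 - 3 * m2 ^+ 2) / 6 =
    6^-1 * (m4 - 3) + ((m2 - 3) / 2) * (m2 - 1) by field.
apply: lerD; first by rewrite ler_wpM2l// ler_norm.
apply: (le_trans (ler_norm _)); rewrite normrM ler_wpM2r// ler_norml.
by apply/andP; split; lra.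
Qed.

Lemma chaos_normal_dTV : (dTV Z N <= (2 * Num.sqrt A)%:E)%E.
Proof.
apply: ge_ereal_sup => _ [B mB <-].
rewrite (prob_indic P (measurable_funPT Z) mB) (prob_indic Q (measurable_funPT N) mB).
rewrite -EFinB abse_EFin lee_fin.
apply: (indicator_le_of_lipschitz (measurable_funPT Z) (measurable_funPT N) _ mB).
exact: chaos_normal_lipschitz.
Qed.

End normal_target.

Section gamma_target.
Context (nu : R) d' (W' : measurableType d') (Q : probability W' R) (F : {RV Q >-> R}).
Hypotheses (nu0 : 0 < nu) (lawF : has_law Q F (centered_gamma nu)).
Notation lam := (@lebesgue_measure R).
Notation p := (gamma_pdf (nu / 2)).

(** The law of F being a probability, the gamma density has mass 1. This bypasses
    the convergence of the integral defining Gamma. *)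
Lemma gamma_law_mass : (\int[lam]_x (p x)%:E = 1)%E.
Proof.
have := lawF measurableT; rewrite preimage_setT probability_setT => ->.
by rewrite /centered_gamma /gamma_law preimage_setT.
Qed.

Lemma gamma_law_Rint (h : R -> R) : measurable_fun [set: R] h ->
  \int[Q]_w h (F w) = \int[lam]_x (h (2 * x - nu) * p x).
Proof.
move=> mh; pose s (x : R) := 2^-1 * (x + nu).
have ms : measurable_fun [set: R] s by apply: cont_meas; rewrite /s; contder.
have mk : measurable_fun [set: R] (fun x : R => h (2 * x - nu)).
  by apply: measurableT_comp mh _; apply: cont_meas; contder.
have sK x : 2 * s x - nu = x by rewrite /s; field.
have Ks x : s (2 * x - nu) = x by rewrite /s; field.
pose U : W' -> measurableTypeR R := s \o F.
have mU : measurable_fun setT U by exact: measurableT_comp.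
transitivity (\int[Q]_w h (2 * U w - nu)).
  by apply: eq_Rint => w; rewrite /U/= sK.
pose m : {measure set (measurableTypeR R) -> \bar R} :=
  measure_function_pushforward__canonical__measure_function_Measure Q mU.
transitivity (\int[m]_x h (2 * x - nu)).
  exact: (@same_law_Rint _ W' _ (measurableTypeR R) _ (measurableTypeR R) R Q
    m U idfun mU (@measurable_id _ _ setT) (fun B _ => erefl) _ mk).
apply: (@density_Rint _ (measurableTypeR R) R lam m p) => //.
- exact: measurable_gamma_pdf.
- exact: gamma_pdf_ge0 gamma_law_mass.
- move=> B mB; rewrite /m/= /pushforward.
  have -> : U @^-1` B = F @^-1` (s @^-1` B) by [].
  rewrite lawF; last by rewrite -[X in measurable X]setTI; exact: ms.
  rewrite /centered_gamma /gamma_law; congr (integral _ _ _).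
  by apply/seteqP; split => x /=; rewrite Ks.
Qed.

Let A := 6^-1 * `|moment 4 Z - 12 * moment 3 Z - 12 * nu ^+ 2 + 48 * nu|
  + `|8 - 6 * nu + moment 2 Z| / 2 * `|moment 2 Z - 2 * nu|.

(** For (a, b) = (2, 2 nu) the radicand is exactly the combination of moments in A,
    without the absolute values. *)
Lemma chaos_gamma_smooth h : smooth_test h ->
  `|\int[P]_w h (Z w) - \int[Q]_w h (F w)| <=
  Num.max 1 (Num.max (1 / nu) (2 / nu ^+ 2)) * Num.sqrt A.
Proof.
move=> [h' [dh h1 h'1 h'L]].
have [f [f' [df cf' f'M eqf]]] := gamma_stein_solution nu0 gamma_law_mass dh h1 h'1 h'L.
have mh : measurable_fun [set: R] h by apply: cont_meas => x; exact: der_cvg.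
rewrite gamma_law_Rint//.
apply: (le_trans (chaos_stein_bound df cf' f'M (mvt_lip dh h'1) eqf)).
apply: ler_pM; rewrite ?sqrtr_ge0//; first by rewrite le_max ler01.
  rewrite ge_max !le_max lexx/= div1r lexx orbT//.
rewrite ler_wsqrtr// /A.
move: (moment 2 Z) (moment 3 Z) (moment 4 Z) => m2 m3 m4.
have -> : (2 * nu - m2) ^+ 2 + 2 ^+ 2 * m2 - 2 * m3 + (m4 - 3 * m2 ^+ 2) / 6 =
    6^-1 * (m4 - 12 * m3 - 12 * nu ^+ 2 + 48 * nu) + (8 - 6 * nu + m2) / 2 * (m2 - 2 * nu).
  by field.
apply: lerD; first by rewrite ler_wpM2l// ler_norm.
apply: (le_trans (ler_norm _)); rewrite normrM ler_wpM2r// normrM.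
by rewrite (ger0_norm (_ : 0 <= 2^-1)).
Qed.

Lemma H2_smooth_test h : H2 R h -> smooth_test h.
Proof.
move=> [[dh dh' _ _] h1 h'1 h''1]; exists (h^`()%classic); split => //.
  by move=> x; exact: derivable_der.
move=> x y; rewrite -[leRHS]mul1r.
by apply: (mvt_lip (fun x => derivable_der (dh' x))).
Qed.

Lemma chaos_gamma_dclass : (dclass (H2 R) Z F <=
  (Num.max 1 (Num.max (1 / nu) (2 / nu ^+ 2)) * Num.sqrt A)%:E)%E.
Proof.
apply: ge_ereal_sup => _ [h /H2_smooth_test sh <-].
have [h' [dh h1 _ _]] := sh.
have mh : measurable_fun [set: R] h by apply: cont_meas => x; exact: der_cvg.
rewrite expectationE; last first.
  by apply: (@bounded_intble _ _ _ P _ 1) => //; exact: measurableT_comp.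
rewrite expectationE; last first.
  by apply: (@bounded_intble _ _ _ Q _ 1) => //; exact: measurableT_comp.
by rewrite -EFinB abse_EFin lee_fin; exact: chaos_gamma_smooth.
Qed.

End gamma_target.
End chaos_moments.

Theorem theorem1p5 (R : realType)
    (d : measure_display) (W : measurableType d) (P : probability W R)
    (H T : completeNormedModType R)
    (dotH : {dot H for @idfun R}) (dotT : {dot T for @idfun R})
    (tens : {bilinear H -> H -> T})
    (X : H -> {RV P >-> R}) (I2 : T -> {RV P >-> R})
    (Z : nat -> {RV P >-> R})
    (dotHP : hilbert_dot dotH) (dotTP : hilbert_dot dotT)
    (sepH : separable H)
    (tensP : hilbert_tensor_square dotH dotT tens)
    (XP : isonormal dotH X)
    (I2P : double_wiener_ito tens X I2)
    (ZP : forall n : nat, second_chaos tens I2 (Z n)) :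
  (moment 2 (Z n) @[n --> \oo] --> (1 : R) ->
   moment 4 (Z n) @[n --> \oo] --> (3 : R) ->
   forall (d' : measure_display) (W' : measurableType d')
     (Q : probability W' R) (N : {RV Q >-> R}),
     has_law Q N (normal_prob 0 1) ->
     cvg_in_law Z N /\
     forall n : nat,
       (dTV (Z n) N <=
        (2 * Num.sqrt (6^-1 * `|moment 4 (Z n) - 3|
                       + (3 + moment 2 (Z n)) / 2 * `|moment 2 (Z n) - 1|))%:E)%E)
  /\
  (forall nu : R, 0 < nu ->
   moment 2 (Z n) @[n --> \oo] --> 2 * nu ->
   (moment 4 (Z n) - 12 * moment 3 (Z n)) @[n --> \oo]
     --> 12 * nu ^+ 2 - 48 * nu ->
   forall (d' : measure_display) (W' : measurableType d')
     (Q : probability W' R) (F : {RV Q >-> R}),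
     has_law Q F (centered_gamma nu) ->
     cvg_in_law Z F /\
     forall n : nat,
       (dclass (H2 R) (Z n) F <=
        (Num.max 1 (Num.max (1 / nu) (2 / nu ^+ 2)) *
         Num.sqrt (6^-1 * `|moment 4 (Z n) - 12 * moment 3 (Z n)
                            - 12 * nu ^+ 2 + 48 * nu|
                   + `|8 - 6 * nu + moment 2 (Z n)| / 2
                     * `|moment 2 (Z n) - 2 * nu|))%:E)%E).
Proof.
have Z2 n : intble P (fun w => Z n w ^+ 2) by exact: (chaos_intble_sqr I2P (ZP n)).
have Z2K l : moment 2 (Z n) @[n --> \oo] --> (l : R) ->
    \forall n \near \oo, \int[P]_w (Z n w ^+ 2) <= l + 1.
  move=> ml; have l1 : l < l + 1 by rewrite ltrDl.
  by apply: filterS (cvgr_le _ ml _ l1) => n; rewrite momentE.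
have conv d' (W' : measurableType d') (Q : probability W' R) (V : {RV Q >-> R})
    (e : nat -> R) (C : R) : e n @[n --> \oo] --> (0 : R) ->
    (forall h, smooth_test h -> forall n,
      `|\int[P]_w h (Z n w) - \int[Q]_w h (V w)| <= C * Num.sqrt (e n)) ->
    forall h, smooth_test h ->
      \int[P]_w h (Z n w) @[n --> \oo] --> \int[Q]_w h (V w).
  move=> e0 he h sh; apply/cvgrPdist_le => r r0.
  have se : C * Num.sqrt (e n) @[n --> \oo] --> (0 : R).
    rewrite -(mulr0 C) -(@sqrtr0 R); apply: cvgMr.
    exact: (cvg_comp e Num.sqrt e0 (@sqrt_continuous R 0)).
  near=> n; rewrite distrC; apply: (le_trans (he h sh n)).
  by near: n; exact: (cvgr_le _ se).
split=> [m2 m4 d' W' Q N lawN|nu nu0 m2 m43 d' W' Q F lawF].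
  split=> [|n]; last exact: (chaos_normal_dTV dotHP XP I2P (ZP n) lawN).
  apply: (cvg_in_law_smooth Z2 (Z2K _ m2)).
  apply: (conv _ _ _ _ (fun n => 6^-1 * `|moment 4 (Z n) - 3| +
    (3 + moment 2 (Z n)) / 2 * `|moment 2 (Z n) - 1|) 4).
    have -> : 0 = 6^-1 * `|3 - 3| + (3 + 1) / 2 * `|1 - 1| :> R.
      by rewrite !subrr normr0 !mulr0 addr0.
    apply: cvgD; first by apply: cvgMr; apply: cvg_norm; apply: cvgB => //; exact: cvg_cst.
    apply: cvgM; first by apply: cvgMl; apply: cvgD => //; exact: cvg_cst.
    by apply: cvg_norm; apply: cvgB => //; exact: cvg_cst.
  move=> h [h' [dh h1 h'1 h'L]] n.
  (* A test with values in [-1, 1] is rescaled to [0, 1], at the cost of a factor 2. *)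
  have mh : measurable_fun [set: R] h by apply: cont_meas => x; exact: der_cvg.
  have hi d0 (T0 : measurableType d0) (p : probability T0 R) (U : {RV p >-> R}) :
      intble p (fun w => h (U w)).
    by apply: (@bounded_intble _ _ _ p _ 1) => //; exact: measurableT_comp.
  have lk : lipschitz01 (fun x => (h x + 1) / 2).
    split.
      exists (2^-1) => x y; have -> : (h x + 1) / 2 - (h y + 1) / 2 = 2^-1 * (h x - h y) by field.
      rewrite normrM (ger0_norm (_ : 0 <= 2^-1))// ler_wpM2l//.
      by rewrite -[leRHS]mul1r; exact: mvt_lip dh h'1 x y.
    by move=> x; have := h1 x; rewrite ler_norml => /andP[? ?]; apply/andP; split; lra.
  have kE d0 (T0 : measurableType d0) (p : probability T0 R) (U : {RV p >-> R}) :
      \int[p]_w ((h (U w) + 1) / 2) = 2^-1 * (\int[p]_w h (U w) + 1).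
    transitivity (\int[p]_w (2^-1 * (h (U w) + 1))).
      by apply: eq_Rint => w; rewrite mulrC.
    rewrite RintZ; last by apply: intbleD; [exact: hi|exact: intble_cst].
    by rewrite RintD ?Rint_cst//; first [exact: hi|exact: intble_cst].
  have := chaos_normal_lipschitz dotHP XP I2P (ZP n) lawN lk.
  rewrite !kE -mulrBr opprD addrACA subrr addr0 normrM (ger0_norm (_ : 0 <= 2^-1))//.
  lra.
split=> [|n]; last exact: (chaos_gamma_dclass dotHP XP I2P (ZP n) nu0 lawF).
apply: (cvg_in_law_smooth Z2 (Z2K _ m2)).
apply: (conv _ _ _ _ (fun n => 6^-1 * `|moment 4 (Z n) - 12 * moment 3 (Z n)
  - 12 * nu ^+ 2 + 48 * nu| + `|8 - 6 * nu + moment 2 (Z n)| / 2 * `|moment 2 (Z n) - 2 * nu|)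
  (Num.max 1 (Num.max (1 / nu) (2 / nu ^+ 2)))).
  have -> : 0 = 6^-1 * `|(12 * nu ^+ 2 - 48 * nu) - 12 * nu ^+ 2 + 48 * nu|
      + `|8 - 6 * nu + 2 * nu| / 2 * `|2 * nu - 2 * nu|.
    have -> : 12 * nu ^+ 2 - 48 * nu - 12 * nu ^+ 2 + 48 * nu = 0 by ring.
    by rewrite subrr normr0 !mulr0 addr0.
  apply: cvgD.
    apply: cvgMr; apply: cvg_norm; apply: cvgD; last exact: cvg_cst.
    by apply: cvgB => //; exact: cvg_cst.
  apply: cvgM.
    by apply: cvgMl; apply: cvg_norm; apply: cvgD => //; exact: cvg_cst.
  by apply: cvg_norm; apply: cvgB => //; exact: cvg_cst.
by move=> h sh n; exact: (chaos_gamma_smooth dotHP XP I2P (ZP n) nu0 lawF).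
Unshelve. all: by end_near. Qed.
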